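(* Let $(X,\mathscr{A},\mu)$ be a $\sigma$-finite measure space and $\phi$ a nonsingular transformation of $X$ such that $C_\phi\in\mathbf{B}(L^2(\mu))$ (i.e. $C_\phi$ is bounded and everywhere defined). Consider the condition (CC): $\mathsf{E}(P(\cdot,\sigma))(x)=\dfrac{\int_\sigma t\,P(\phi(x),\mathrm{d}t)}{\mathsf{h}_\phi(\phi(x))}$ for $\mu$-a.e. $x\in X$, for every $\sigma\in\mathfrak{B}(\mathbb{R}_+)$, and the condition (CC$^{-1}$): $\mathsf{h}_\phi(x)\big(\mathsf{E}(P(\cdot,\sigma))\circ\phi^{-1}\big)(x)=\int_\sigma t\,P(x,\mathrm{d}t)$ for $\mu$-a.e. $x\in X$, for every $\sigma\in\mathfrak{B}(\mathbb{R}_+)$. Then the following are equivalent: (i) $C_\phi$ is subnormal; (ii) $C_\phi$ is injective and there exists an $\mathscr{A}$-measurable family $P\colon X\times\mathfrak{B}(\mathbb{R}_+)\to[0,1]$ of probability measures satisfying (CC); (ii$'$) there exists an $\mathscr{A}$-measurable family $P\colon X\times\mathfrak{B}(\mathbb{R}_+)\to[0,1]$ of probability measures satisfying (CC$^{-1}$); (iii) $C_\phi$ is injective and there exists an $\mathscr{A}$-measurable family $P$ of probability measures on $\mathfrak{B}(\mathbb{R}_+)$ such that (CC) holds and the closed support of $P(x,\cdot)$ is contained in $[0,\|C_\phi\|^2]$ for $\mu$-a.e. $x\in X$; (iii$'$) there exists an $\mathscr{A}$-measurable family $P$ of probability measures on $\mathfrak{B}(\mathbb{R}_+)$ such that (CC$^{-1}$)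 holds and the closed support of $P(x,\cdot)$ is contained in $[0,\|C_\phi\|^2]$ for $\mu$-a.e. $x\in X$. These conditions remain equivalent if the expression ''for $\mu$-a.e. $x\in X$'' in (iii) and (iii$'$) is replaced by ''for every $x\in X$''. Moreover, if $C_\phi$ is subnormal and $P_1,P_2\colon X\times\mathfrak{B}(\mathbb{R}_+)\to[0,1]$ are $\mathscr{A}$-measurable families of probability measures both satisfying (CC), then $P_1(x,\cdot)=P_2(x,\cdot)$ for $\mu$-a.e. $x\in X$.
   Context: $\mathbb{R}_+=[0,\infty)$ and $\mathfrak{B}(\mathbb{R}_+)$ its Borel $\sigma$-algebra. Conventions: $0\cdot\infty=0$, $1/0=\infty$, $0/0=1$. A nonsingular transformation $\phi$ of $X$: $\phi^{-1}(\Delta)\in\mathscr{A}$ for all $\Delta\in\mathscr{A}$ and $\mu(\phi^{-1}(\Delta))=0$ whenever $\mu(\Delta)=0$. $C_\phi f=f\circ\phi$ on $\mathcal{D}(C_\phi)=\{f\in L^2(\mu):f\circ\phi\in L^2(\mu)\}$. $\mathsf{h}_\phi$ is the Radon–Nikodym derivative of $\mu\circ\phi^{-1}$ w.r.t. $\mu$. For $\mathscr{A}$-measurable $f\colon X\to[0,\infty]$, $\mathsf{E}(f)$ is the conditional expectation with respect to $\phi^{-1}(\mathscr{A})$: the a.e. unique $\phi^{-1}(\mathscr{A})$-measurable function with $\int(g\circ\phi)f\,\mathrm{d}\mu=\int(g\circ\phi)\mathsf{E}(f)\,\mathrm{d}\mu$ for all $\mathscr{A}$-measurable $g\ge0$;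 $\mathsf{E}(f)\circ\phi^{-1}$ is the a.e. unique $\mathscr{A}$-measurable $g\ge0$ with $g=0$ a.e. on $\{\mathsf{h}_\phi=0\}$ and $\mathsf{E}(f)=g\circ\phi$ a.e. An $\mathscr{A}$-measurable family of probability measures: each $P(x,\cdot)$ a probability measure, each $P(\cdot,\sigma)$ $\mathscr{A}$-measurable. Subnormal: restriction of a normal operator in a larger Hilbert space (for bounded operators, the usual notion). *)

(* Defs.v *)
(* mathcomp-analysis (measure theory, kernels) + complex numbers R[i]. *)
From HB Require Import structures.
From mathcomp Require Import all_boot all_order all_algebra.
From mathcomp Require Import all_classical all_reals all_analysis.
From mathcomp Require Import measurable_realfun.
From mathcomp Require Import complex.
Set Implicit Arguments. Unset Strict Implicit. Unset Printing Implicit Defensive.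
Import Order.TTheory GRing.Theory Num.Theory.
Import numFieldTopology.Exports.
Local Open Scope classical_set_scope.
Local Open Scope ring_scope.

(* Complex Hilbert spaces (abstract), bounded normal operators.               *)
Section Hilbert.
Variable R : realType.
Local Notation C := R[i].

(* squared modulus of a complex number *)
Definition csq (z : C) : R := (complex.Re z) ^+ 2 + (complex.Im z) ^+ 2.

(* ip is an inner product (linear in the first variable, conjugate symmetric,
   positive definite) making K a complete space, i.e. a complex Hilbert space *)
Definition is_hilbert (K : lmodType C) (ip : K -> K -> C) : Prop :=
  [/\ (forall (a : C) (x y z : K), ip (a *: x + y) z = a * ip x z + ip y z),
      (forall x y : K, ip y x = (ip x y)^*),
      (forall x : K, complex.Im (ip x x) = 0 /\ 0 <= complex.Re (ip x x)),
      (forall x : K, ip x x = 0 -> x = 0) &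
      (forall u : nat -> K,
         (forall e : R, 0 < e -> exists N : nat, forall m n : nat,
              (N <= m)%N -> (N <= n)%N -> complex.Re (ip (u m - u n) (u m - u n)) < e) ->
         exists l : K, forall e : R, 0 < e -> exists N : nat, forall n : nat,
              (N <= n)%N -> complex.Re (ip (u n - l) (u n - l)) < e)].

(* squared norm in K *)
Definition hnsq (K : lmodType C) (ip : K -> K -> C) (x : K) : R := complex.Re (ip x x).

(* N is a bounded (everywhere defined) linear operator on K *)
Definition bounded_op (K : lmodType C) (ip : K -> K -> C) (N : K -> K) : Prop :=
  (forall (a : C) (x y : K), N (a *: x + y) = a *: N x + N y) /\
  exists c : R, forall x : K, hnsq ip (N x) <= c * hnsq ip x.

(* N is a bounded normal operator: N has an adjoint N* and N N* = N* N *)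
Definition bounded_normal (K : lmodType C) (ip : K -> K -> C) (N : K -> K) : Prop :=
  bounded_op ip N /\
  exists Nstar : K -> K,
    (forall x y : K, ip (N x) y = ip x (Nstar y)) /\
    (forall x : K, N (Nstar x) = Nstar (N x)).
End Hilbert.

(* L^2(mu) of complex functions, composition operators.                       *)
Section L2.
Context d (X : measurableType d) (R : realType).
Variable mu : {measure set X -> \bar R}.
Local Notation C := R[i].

(* f is (a representative of) an element of L^2(mu) *)
Definition L2 (f : X -> C) : Prop :=
  [/\ measurable_fun setT (fun x => complex.Re (f x)),
      measurable_fun setT (fun x => complex.Im (f x)) &
      (\int[mu]_x (csq (f x))%:E < +oo)%E].

(* squared L^2 norm *)
Definition L2nsq (f : X -> C) : R := fine (\int[mu]_x (csq (f x))%:E)%E.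

(* phi is a nonsingular transformation of X *)
Definition nonsingular (phi : X -> X) : Prop :=
  measurable_fun setT phi /\
  forall D : set X, measurable D -> mu D = 0%E -> mu (phi @^-1` D) = 0%E.

(* C_phi is in B(L^2(mu)): everywhere defined and bounded *)
Definition Cphi_bounded (phi : X -> X) : Prop :=
  (forall f, L2 f -> L2 (f \o phi)) /\
  exists c : R, forall f, L2 f -> L2nsq (f \o phi) <= c * L2nsq f.

(* C_phi is injective on L^2(mu) *)
Definition Cphi_injective (phi : X -> X) : Prop :=
  forall f, L2 f -> {ae mu, forall x, f (phi x) = 0} -> {ae mu, forall x, f x = 0}.

(* ||C_phi||^2 (as an extended real) *)
Definition Cphi_norm2 (phi : X -> X) : \bar R :=
  ereal_sup [set (L2nsq (f \o phi))%:E | f in [set f | L2 f /\ L2nsq f <= 1]].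

(* C_phi is subnormal: there are a complex Hilbert space K, an isometric linear
   embedding J of L^2(mu) into K and a bounded normal operator N on K
   such that N restricted to (the image of) L^2(mu) is C_phi *)
Definition Cphi_subnormal (phi : X -> X) : Prop :=
  exists (K : lmodType C) (ip : K -> K -> C) (J : (X -> C) -> K) (N : K -> K),
    [/\ is_hilbert ip,
        (forall (a : C) f g, L2 f -> L2 g ->
            J (fun x => a * f x + g x) = a *: J f + J g),
        (forall f, L2 f -> hnsq ip (J f) = L2nsq f),
        bounded_normal ip N &
        (forall f, L2 f -> N (J f) = J (f \o phi))].

(* h_phi, conditional expectation E, and E(f) o phi^{-1}.                    *)

(* h is (a version of) the Radon-Nikodym derivative of mu o phi^{-1} wrt mu *)
Definition is_hphi (phi : X -> X) (h : X -> \bar R) : Prop :=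
  [/\ measurable_fun setT h, (forall x, 0 <= h x)%E &
      forall D : set X, measurable D -> mu (phi @^-1` D) = (\int[mu]_(x in D) h x)%E].

(* g is (a version of) the conditional expectation E(f) of f : X -> [0,oo]
   with respect to the sigma-algebra phi^{-1}(A) *)
Definition is_condexp (phi : X -> X) (f g : X -> \bar R) : Prop :=
  [/\ (forall x, 0 <= g x)%E,
      (forall B : set (\bar R), measurable B ->
          exists D : set X, measurable D /\ g @^-1` B = phi @^-1` D) &
      forall u : X -> \bar R, measurable_fun setT u -> (forall x, 0 <= u x)%E ->
        (\int[mu]_x (u (phi x) * f x) = \int[mu]_x (u (phi x) * g x))%E].

(* g is (a version of) E(f) o phi^{-1}, given Ef = E(f) and h = h_phi *)
Definition is_Einv (phi : X -> X) (h Ef g : X -> \bar R) : Prop :=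
  [/\ measurable_fun setT g, (forall x, 0 <= g x)%E,
      {ae mu, forall x, h x = 0%E -> g x = 0%E} &
      {ae mu, forall x, Ef x = g (phi x)}].
End L2.

(* Division on [0,oo] with the conventions 1/0 = oo, 0/0 = 1 (and a/oo = 0). *)
Definition ediv (R : realType) (a b : \bar R) : \bar R :=
  if b == 0%E then (if a == 0%E then 1%E else +oo%E)
  else if b == +oo%E then 0%E
  else (a * ((fine b)^-1)%:E)%E.

(* Measurable families of probability measures on B(R_+).                    *)
(* A family P : X x B(R_+) -> [0,1] is represented by a probability kernel   *)
(* from X to R (Borel sets) concentrated on [0, +oo).                        *)
Section Families.
Context d (X : measurableType d) (R : realType).
Variable mu : {measure set X -> \bar R}.

Definition on_Rplus (P : R.-pker X ~> R) : Prop :=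
  forall x, P x [set t : R | (0 <= t)%R] = 1%E.

(* Borel subsets of R_+ *)
Definition borel_Rplus (s : set R) : Prop := measurable s /\ s `<=` [set t : R | (0 <= t)%R].

(* condition (CC) *)
Definition CC (phi : X -> X) (h : X -> \bar R) (E : (X -> \bar R) -> X -> \bar R)
    (P : R.-pker X ~> R) : Prop :=
  forall s, borel_Rplus s ->
    {ae mu, forall x, E (fun y => P y s) x =
                      ediv (\int[P (phi x)]_(t in s) t%:E)%E (h (phi x))}.

(* condition (CC^{-1}) *)
Definition CCinv (phi : X -> X) (h : X -> \bar R) (E : (X -> \bar R) -> X -> \bar R)
    (P : R.-pker X ~> R) : Prop :=
  forall s, borel_Rplus s ->
    forall g, is_Einv mu phi h (E (fun y => P y s)) g ->
    {ae mu, forall x, (h x * g x = \int[P x]_(t in s) t%:E)%E}.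

(* closed support of a measure on R *)
Definition msupport (m : set R -> \bar R) : set R :=
  [set t | forall U : set R, open U -> U t -> (0 < m U)%E].

(* closed support of P(x, .) is contained in [0, c] *)
Definition supp_in (P : R.-pker X ~> R) (x : X) (c : \bar R) : Prop :=
  forall t, msupport (P x) t -> (0 <= t)%R /\ (t%:E <= c)%E.
End Families.

(* The conditions of the theorem.                                            *)
Section Conditions.
Context d (X : measurableType d) (R : realType).
Variables (mu : {measure set X -> \bar R}) (phi : X -> X) (h : X -> \bar R)
  (E : (X -> \bar R) -> X -> \bar R).

(* (ii) *)
Definition cond_ii : Prop :=
  Cphi_injective mu phi /\
  exists P : R.-pker X ~> R, on_Rplus P /\ CC mu phi h E P.

(* (ii') *)
Definition cond_ii' : Prop :=
  exists P : R.-pker X ~> R, on_Rplus P /\ CCinv mu phi h E P.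

(* (iii), with "for mu-a.e. x" *)
Definition cond_iii : Prop :=
  Cphi_injective mu phi /\
  exists P : R.-pker X ~> R, [/\ on_Rplus P, CC mu phi h E P &
    {ae mu, forall x, supp_in P x (Cphi_norm2 mu phi)}].

(* (iii'), with "for mu-a.e. x" *)
Definition cond_iii' : Prop :=
  exists P : R.-pker X ~> R, [/\ on_Rplus P, CCinv mu phi h E P &
    {ae mu, forall x, supp_in P x (Cphi_norm2 mu phi)}].

(* (iii), with "for every x" *)
Definition cond_iii_every : Prop :=
  Cphi_injective mu phi /\
  exists P : R.-pker X ~> R, [/\ on_Rplus P, CC mu phi h E P &
    forall x, supp_in P x (Cphi_norm2 mu phi)].

(* (iii'), with "for every x" *)
Definition cond_iii'_every : Prop :=
  exists P : R.-pker X ~> R, [/\ on_Rplus P, CCinv mu phi h E P &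
    forall x, supp_in P x (Cphi_norm2 mu phi)].

(* uniqueness of P satisfying (CC) *)
Definition CC_unique : Prop :=
  forall P1 P2 : R.-pker X ~> R, on_Rplus P1 -> on_Rplus P2 ->
    CC mu phi h E P1 -> CC mu phi h E P2 ->
    {ae mu, forall x, forall s, borel_Rplus s -> P1 x s = P2 x s}.
End Conditions.

(* Main.v *)
(* Both (CC) and (CC^-1) amount to the identity
     int_(phi^-1 D) P(x, s) dmu = int_D int_s t P(x, dt) dmu     for all D and s.     (K)
   Given (K), let rho = mu(dx) P(x, dt) on X * R and Phi(x, t) = (phi x, t). Then
   h_Phi(x, t) = t is Phi-invariant, so C_Phi = U A on L^2(rho) with A multiplication by
   sqrt t and U an isometry commuting with A, and C_Phi is quasinormal. Dilating U to
   a unitary of L^2(rho) + L^2(rho) gives a normal extension of C_Phi, and f |-> f o fst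
   embeds C_phi in C_Phi. Moreover (K) gives mu(phi^-n D) = int_D int t^n P(x, dt) dmu;
   since mu(phi^-n D) <= ||C_phi||^(2n) mu(D), almost every P(x, .) is carried by
   [0, ||C_phi||^2] and is determined by its moments.
   Conversely, if N is a bounded normal extension and c >= ||N||^2, then
   <(N*N)^n (c - N*N)^k 1_D, 1_D> >= 0 says that the iterated differences of
   n |-> mu(phi^-n D) are nonnegative for every D of finite measure, hence so are those of
   n |-> h_n(x) for almost every x, where h_n is the density of mu o phi^-n.
   The Hausdorff moment theorem, with a solution depending measurably on x, yields P, and
   (K) holds because both of its sides are finite measures in s with the same moments
   mu(phi^-(n+1) D). *)

(* The conditional expectation and the division by [h] disappear by writing [E f] as [w (phi x)].
   For f = P(., s), (K) is then the a.e. equality of [w x * h x] with the integral of t over s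
   against P(x, dt); (CC^-1) is this equality at x and (CC) is the same equality at [phi x].
   Returning from [phi x] to x needs h > 0 a.e., that is, injectivity of C_phi; hence (CC) comes
   with injectivity and (CC^-1) does not. Under (K) it is automatic: P(x, .) would be the Dirac mass
   at 0 where h = 0, but (K) with s = {0} gives P(x, {0}) = 0 a.e. The obstacle in the converse is
   measurability in x. The distribution function is therefore written as an infimum of countably
   many expressions in the moments, built from Bernstein polynomials of step functions; the same
   polynomials give uniqueness. The bound c of the extension may exceed ||C_phi||^2: the kernel is
   first carried by [0, c] and then cut down by the growth of its moments. Dirac moments on the
   exceptional null set make the support condition hold at every x. *)
Require Import Defs.
From HB Require Import structures.
From mathcomp Require Import all_boot all_order all_algebra.
From mathcomp Require Import all_classical all_reals all_analysis.
From mathcomp Require Import measurable_realfun.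
From mathcomp Require Import complex.
From mathcomp Require Import ring lra zify.

Set Implicit Arguments. Unset Strict Implicit. Unset Printing Implicit Defensive.
Import Order.TTheory GRing.Theory Num.Theory.
Import numFieldTopology.Exports.
Local Open Scope classical_set_scope.
Local Open Scope ring_scope.

(** * Normal operators on Hilbert spaces *)

Section HilbertTheory.
Variables (R : realType) (K : lmodType R[i]) (ip : K -> K -> R[i]).
Hypothesis HK : is_hilbert ip.

Local Notation re x y := (complex.Re (ip x y)).
Local Notation nsq := (hnsq ip).

Lemma cReM (a b : R[i]) : complex.Re (a * b) =
  complex.Re a * complex.Re b - complex.Im a * complex.Im b.
Proof. by case: a b => [? ?] [? ?]. Qed.

Lemma cImM (a b : R[i]) : complex.Im (a * b) =
  complex.Re a * complex.Im b + complex.Im a * complex.Re b.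
Proof. by case: a b => [? ?] [? ?]. Qed.

Lemma cReD (a b : R[i]) : complex.Re (a + b) = complex.Re a + complex.Re b.
Proof. by case: a b => [? ?] [? ?]. Qed.

Lemma cImD (a b : R[i]) : complex.Im (a + b) = complex.Im a + complex.Im b.
Proof. by case: a b => [? ?] [? ?]. Qed.

Lemma complex_ext (a b : R[i]) :
  complex.Re a = complex.Re b -> complex.Im a = complex.Im b -> a = b.
Proof. by case: a b => [? ?] [? ?] /= -> ->. Qed.

Lemma ipDl x y z : ip (x + y) z = ip x z + ip y z.
Proof. by case: HK => /(_ 1 x y z) + _ _ _ _; rewrite !scale1r mul1r. Qed.

Lemma ip0l z : ip 0 z = 0.
Proof. by apply: (@addrI _ (ip 0 z)); rewrite -ipDl !addr0. Qed.

Lemma ipZl a x z : ip (a *: x) z = a * ip x z.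
Proof. by case: HK => /(_ a x 0 z) + _ _ _ _; rewrite !addr0 ip0l addr0. Qed.

Lemma ipC x y : ip y x = (ip x y)^*.
Proof. by case: HK. Qed.

Lemma ipDr x y z : ip z (x + y) = ip z x + ip z y.
Proof. by rewrite !(ipC _ z) ipDl rmorphD. Qed.

Lemma ipZr a x z : ip z (a *: x) = a^* * ip z x.
Proof. by rewrite !(ipC _ z) ipZl rmorphM. Qed.

Lemma ipNl x y : ip (- x) y = - ip x y.
Proof. by rewrite -scaleN1r ipZl mulN1r. Qed.

Lemma ipNr x y : ip x (- y) = - ip x y.
Proof. by rewrite !(ipC _ x) ipNl rmorphN. Qed.

Lemma ipBl x y z : ip (x - y) z = ip x z - ip y z.
Proof. by rewrite ipDl ipNl. Qed.

Lemma ipBr x y z : ip z (x - y) = ip z x - ip z y.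
Proof. by rewrite ipDr ipNr. Qed.

Lemma re_sym x y : re y x = re x y.
Proof. by rewrite ipC; case: (ip x y). Qed.

Lemma reZl (t : R) x y : re (t%:C%C *: x) y = t * re x y.
Proof. by rewrite ipZl cReM /= mul0r subr0. Qed.

Lemma reZr (t : R) x y : re x (t%:C%C *: y) = t * re x y.
Proof. by rewrite re_sym reZl re_sym. Qed.

(** Reduces identities for the complex form to identities for real parts, applied also to
    ['i *: x]. *)
Lemma Im_ip x y : complex.Im (ip x y) = - re ('i%C *: x) y.
Proof. by rewrite ipZl cReM /= mul0r mul1r sub0r opprK. Qed.

Lemma nsq_ge0 x : 0 <= nsq x.
Proof. by case: HK => _ _ /(_ x) []. Qed.

Lemma nsq_eq0 x : nsq x = 0 -> x = 0.
Proof.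
case: HK => _ _ /(_ x) [i0 _] /(_ x) h _ r0.
by apply: h; apply: complex_ext.
Qed.

Lemma nsqD x y : nsq (x + y) = nsq x + 2 * re x y + nsq y.
Proof. by rewrite /hnsq ipDl !ipDr !cReD (re_sym x y); ring. Qed.

Lemma nsqZ (t : R) x : nsq (t%:C%C *: x) = t ^+ 2 * nsq x.
Proof. by rewrite /hnsq reZl reZr; ring. Qed.

Lemma nsqN x : nsq (- x) = nsq x.
Proof. by rewrite /hnsq ipNl ipNr opprK. Qed.

Lemma nsqB x y : nsq (x - y) = nsq x - 2 * re x y + nsq y.
Proof. by rewrite nsqD nsqN ipNr raddfN /=; ring. Qed.

(** A quadratic polynomial that is never negative has nonpositive discriminant. The case a = 0 is
    included because a will be a squared norm or seminorm that may vanish. *)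
Lemma discr_le (a b e : R) : 0 <= a -> 
  (forall t, 0 <= t ^+ 2 * a + 2 * t * b + e) -> b ^+ 2 <= a * e.
Proof.
move=> a0 h; have [a0'|an0] := eqVneq a 0.
  rewrite a0' mul0r; have [->|b0] := eqVneq b 0; first by rewrite expr0n.
  (* The point where the affine function takes the value -1. *)
  have := h (- (e + 1) / (2 * b)); rewrite a0' mulr0 add0r.
  have -> : 2 * (- (e + 1) / (2 * b)) * b = - (e + 1) by field.
  by lra.
have agt0 : 0 < a by rewrite lt_neqAle eq_sym an0.
have := h (- b / a).
have -> : (- b / a) ^+ 2 * a + 2 * (- b / a) * b + e = (a * e - b ^+ 2) / a.
  by field.
by rewrite pmulr_lge0 ?invr_gt0// subr_ge0.
Qed.

Lemma cauchy_schwarz x y : (re x y) ^+ 2 <= nsq x * nsq y.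
Proof.
rewrite mulrC; apply: discr_le; first exact: nsq_ge0.
move=> t; have := nsq_ge0 (x + t%:C%C *: y).
by rewrite nsqD nsqZ reZr; lra.
Qed.

Lemma re_ext y z : (forall x, re x y = re x z) -> y = z.
Proof.
move=> h; apply/subr0_eq/nsq_eq0.
by rewrite /hnsq ipBr raddfB /= h subrr.
Qed.

Lemma ip_ext y z : (forall x, ip x y = ip x z) -> y = z.
Proof. by move=> h; apply: re_ext => x; rewrite h. Qed.

(** The representing vector minimises |x|^2 - 2 r(x). A minimising sequence is Cauchy by the
    parallelogram law, and its limit represents r because the first variation vanishes at a minimum.
    Only real linearity is asked, so that the result applies to real parts of complex
    functionals. *)
Lemma riesz_real (r : K -> R) (c : R) :
  (forall (t : R) x y, r (t%:C%C *: x + y) = t * r x + r y) ->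
  (forall x, (r x) ^+ 2 <= c * nsq x) ->
  exists z, forall x, r x = re x z.
Proof.
move=> rl rb'.
(* The given bound may be negative; its absolute value is not. *)
have [d d0 rb] : exists2 d, 0 <= d & forall x, (r x) ^+ 2 <= d * nsq x.
  exists `|c| => // x; apply: le_trans (rb' x) _.
  by rewrite ler_wpM2r ?nsq_ge0// ler_norm.
pose J x := nsq x - 2 * r x.
have Jlb x : - d <= J x.
  (* With n = |x|^2: (2 r(x))^2 <= 4 d n <= (n + d)^2, hence 2 r(x) <= n + d. *)
  rewrite /J; have := rb x; set n := nsq x => h; set u := r x in h *.
  have n0 : 0 <= n by exact: nsq_ge0.
  have h2 := sqr_ge0 (n - d).
  have h3 : (2 * u) ^+ 2 <= (n + d) ^+ 2 by nra.
  have nc : 0 <= n + d by lra.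
  case: (leP 0 u) => u0; last by lra.
  by rewrite ler_sqr ?nnegrE// in h3; lra.
pose S := [set J x | x in [set: K]].
have Sinf : has_inf S.
  split; first by exists (J 0), 0.
  by exists (- d) => _ [x _ <-].
pose m := inf S.
have mle x : m <= J x by apply: ge_inf; [case: Sinf | exists x].
have ex n : exists x, J x < m + n.+1%:R^-1.
  have e0 : (0 : R) < n.+1%:R^-1 by rewrite invr_gt0.
  by have [_ [x _ <-] h] := inf_adherent e0 Sinf; exists x.
have /choice [u hu] := ex.
have rD x y : r (x + y) = r x + r y.
  by have := rl 1 x y; rewrite mul1r scale1r.
have r0 : r 0 = 0 by apply: (@addrI _ (r 0)); rewrite -rD !addr0.
have rZ t x : r (t%:C%C *: x) = t * r x.
  by have := rl t x 0; rewrite r0 !addr0.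
(* Parallelogram law: |u n - u k|^2 is 2 J(u n) + 2 J(u k) minus 4 times J at the midpoint, where J
   is at least m. *)
have cau n k : nsq (u n - u k) <= 2 * n.+1%:R^-1 + 2 * k.+1%:R^-1.
  have := mle ((2^-1)%:C%C *: (u n + u k)); have := hu n; have := hu k.
  rewrite /J nsqZ nsqD rZ rD nsqB.
  set a := n.+1%:R^-1; set b := k.+1%:R^-1 => h1 h2 h3.
  lra.
case: (HK) => _ _ _ _ /(_ u) [].
  move=> e e0.
  have [N hN] : exists N : nat, forall n, (N <= n)%N -> n.+1%:R^-1 < e / 4.
    have e4 : 0 < e / 4 by rewrite divr_gt0.
    exists (Num.truncn (e / 4)^-1).+1 => n hn.
    rewrite -[ltRHS]invrK ltf_pV2 ?posrE ?invr_gt0//.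
    apply: lt_trans (truncnS_gt _) _.
    by rewrite ltr_nat ltnS.
  exists N => a b ha hb; apply: le_lt_trans (cau a b) _.
  have := hN _ ha; have := hN _ hb.
  by move: (a.+1%:R^-1 : R) (b.+1%:R^-1 : R) => p q; lra.
move=> l hl; exists l => v.
(* J(u n + t v) - m is a nonnegative quadratic in t, with linear coefficient 2 (Re <u n, v> - r v)
   and constant term below 1/(n+1). *)
have e1 n : (re (u n) v - r v) ^+ 2 <= nsq v * n.+1%:R^-1.
  apply: discr_le; first exact: nsq_ge0.
  move=> t; have := mle (u n + t%:C%C *: v); have := hu n.
  rewrite /J nsqD nsqZ reZr rD rZ; move: (n.+1%:R^-1 : R) => p h1 h2; lra.
have lim (e : R) : 0 < e -> (re l v - r v) ^+ 2 <= e.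
  move=> e0.
  have v0 : 0 <= nsq v by exact: nsq_ge0.
  have de0 : 0 < e / (4 * (nsq v + 1)) by rewrite divr_gt0// mulr_gt0//; lra.
  have [N hN] := hl _ de0.
  pose n := maxn N (Num.truncn (e / (4 * (nsq v + 1)))^-1).+1.
  have h1 := hN n (leq_maxl _ _).
  have h2 : n.+1%:R^-1 < e / (4 * (nsq v + 1)).
    rewrite -[ltRHS]invrK ltf_pV2 ?posrE ?invr_gt0//.
    apply: lt_trans (truncnS_gt _) _.
    by rewrite ltr_nat ltnS leq_maxr.
  have h3 := e1 n.
  have h4 := cauchy_schwarz (u n - l) v.
  rewrite ipBl raddfB/= in h4.
  set dd := e / _ in de0 h1 h2.
  have h5 : nsq v * dd <= e / 4.
    rewrite /dd mulrA ler_pdivrMr; last by lra.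
    by nra.
  have h6 : nsq (u n - l) * nsq v <= e / 4.
    by apply: le_trans h5; rewrite mulrC ler_wpM2l// ltW.
  have h7 : nsq v * n.+1%:R^-1 <= e / 4.
    by apply: le_trans h5; rewrite ler_wpM2l// ltW.
  set A := re l v in h4 *; set B := re (u n) v in h3 h4 *; set C := r v in h3 *.
  have {h7}h3 := le_trans h3 h7; have {h6}h4 := le_trans h4 h6.
  by have := sqr_ge0 (A - B - (B - C)); nra.
apply/eqP; rewrite re_sym -subr_eq0 -oppr_eq0 opprB -sqrf_eq0 eq_le sqr_ge0 andbT.
by apply/ler_addgt0Pr => e e0; rewrite add0r; exact: lim.
Qed.

(** Riesz applied to x |-> Re <T x, y>; the imaginary part follows by evaluating at ['i *: x], T
    being complex linear. *)
Lemma adjoint_exists (T : K -> K) : bounded_op ip T ->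
  exists Ts : K -> K, forall x y, ip (T x) y = ip x (Ts y).
Proof.
move=> [Tl [c Tb]].
suff /choice [Ts h] : forall y, exists z, forall x, ip (T x) y = ip x z by exists Ts.
move=> y.
have TD x x' : T (x + x') = T x + T x' by have := Tl 1 x x'; rewrite !scale1r.
have T0 : T 0 = 0 by apply: (@addrI _ (T 0)); rewrite -TD !addr0.
have TZ a x : T (a *: x) = a *: T x by have := Tl a x 0; rewrite T0 !addr0.
have [z hz] : exists z, forall x, re (T x) y = re x z.
  apply: (@riesz_real _ (c * nsq y)).
    by move=> t x x'; rewrite Tl ipDl cReD reZl.
  move=> x; apply: le_trans (cauchy_schwarz _ _) _.
  by rewrite mulrAC ler_wpM2r// nsq_ge0.
exists z => x; apply: complex_ext => //.
by rewrite !Im_ip -TZ hz.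
Qed.

End HilbertTheory.

Definition linmap (R : realType) (K L : lmodType R[i]) (T : K -> L) : Prop :=
  forall (a : R[i]) x y, T (a *: x + y) = a *: T x + T y.

Section Linmap.
Variables (R : realType) (K L : lmodType R[i]) (T : K -> L).
Hypothesis Tl : linmap T.

Lemma linmapD x y : T (x + y) = T x + T y.
Proof. by have := Tl 1 x y; rewrite !scale1r. Qed.

Lemma linmap0 : T 0 = 0.
Proof. by apply: (@addrI _ (T 0)); rewrite -linmapD !addr0. Qed.

Lemma linmapZ a x : T (a *: x) = a *: T x.
Proof. by have := Tl a x 0; rewrite linmap0 !addr0. Qed.

Lemma linmapN x : T (- x) = - T x.
Proof. by rewrite -scaleN1r linmapZ scaleN1r. Qed.

Lemma linmapB x y : T (x - y) = T x - T y.
Proof. by rewrite linmapD linmapN. Qed.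

End Linmap.

(** * Normal dilation of an isometry times a commuting self-adjoint operator *)

Section NormalExtension.
Variables (R : realType) (K : lmodType R[i]) (ip : K -> K -> R[i]).
Hypothesis HK : is_hilbert ip.
Local Notation re x y := (complex.Re (ip x y)).
Local Notation nsq := (hnsq ip).

Lemma adjoint_linmap (T Ts : K -> K) :
  (forall x y, ip (T x) y = ip x (Ts y)) -> linmap Ts.
Proof.
move=> h a x y; apply: (ip_ext HK) => z.
by rewrite -h !(ipDr HK) !(ipZr HK) !h.
Qed.

Definition prod_ip (p q : K * K) : R[i] := ip p.1 q.1 + ip p.2 q.2.

Lemma prod_nsq p : hnsq prod_ip p = nsq p.1 + nsq p.2.
Proof. by rewrite /hnsq /prod_ip cReD. Qed.

Lemma prod_hilbert : is_hilbert prod_ip.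
Proof.
case: (HK) => ipl ipc ippos ipdef ipcpl; split.
- by move=> a x y z; rewrite /prod_ip !ipl mulrDr addrACA.
- by move=> x y; rewrite /prod_ip !(ipC HK x.1) !(ipC HK x.2) rmorphD.
- move=> x; rewrite /prod_ip cImD cReD !(ippos _).1 addr0; split => //.
  by rewrite addr_ge0// (ippos _).2.
- move=> [x1 x2]; rewrite /prod_ip /= => h.
  have /eqP : nsq x1 + nsq x2 = 0 by rewrite /hnsq -cReD h.
  rewrite paddr_eq0 ?(nsq_ge0 HK)// => /andP[/eqP h1 /eqP h2].
  by rewrite (nsq_eq0 HK h1) (nsq_eq0 HK h2).
- move=> u hu.
  have [l1 hl1] : exists l, forall e : R, 0 < e -> exists N : nat, forall n : nat,
      (N <= n)%N -> re ((u n).1 - l) ((u n).1 - l) < e.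
    apply: (ipcpl (fun n => (u n).1)) => e /hu[N hN]; exists N => m n hm hn.
    apply: le_lt_trans (hN m n hm hn).
    by rewrite cReD lerDl (nsq_ge0 HK).
  have [l2 hl2] : exists l, forall e : R, 0 < e -> exists N : nat, forall n : nat,
      (N <= n)%N -> re ((u n).2 - l) ((u n).2 - l) < e.
    apply: (ipcpl (fun n => (u n).2)) => e /hu[N hN]; exists N => m n hm hn.
    apply: le_lt_trans (hN m n hm hn).
    by rewrite cReD lerDr (nsq_ge0 HK).
  exists (l1, l2) => e e0; have e20 : 0 < e / 2 by rewrite divr_gt0.
  have [N1 h1] := hl1 _ e20; have [N2 h2] := hl2 _ e20.
  exists (maxn N1 N2) => n; rewrite geq_max => /andP[/h1 ? /h2 ?].
  by rewrite cReD [ltRHS](splitr e) ltrD.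
Qed.

(* With E = 1 - UU*, the block operator [[U, E], [0, U*]] is unitary on K + K and
   commutes with A + A; their product is normal and its first column is UA. *)
Lemma normal_extension (U A : K -> K) : linmap U -> linmap A ->
  (forall x y, ip (U x) (U y) = ip x y) ->
  (forall x y, ip (A x) y = ip x (A y)) ->
  (exists c : R, forall x, nsq (A x) <= c * nsq x) ->
  (forall x, U (A x) = A (U x)) ->
  exists N : K * K -> K * K,
    bounded_normal prod_ip N /\ forall x, N (x, 0) = (U (A x), 0).
Proof.
move=> Ul Al Uiso Asa [c cA] UA.
have [Us hUs] : exists Us, forall x y, ip (U x) y = ip x (Us y).
  apply: (adjoint_exists HK); split => //; exists 1 => x.
  by rewrite /hnsq Uiso mul1r.
have Usl := adjoint_linmap hUs.
have UsU x : Us (U x) = x.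
  by apply: (ip_ext HK) => z; rewrite -hUs Uiso.
have AUs x : A (Us x) = Us (A x).
  by apply: (ip_ext HK) => z; rewrite -Asa -!hUs -Asa UA.
have hUs' x y : ip (Us x) y = ip x (U y).
  by rewrite (ipC HK) -hUs -(ipC HK).
pose N (p : K * K) := (U (A p.1) + (A p.2 - U (Us (A p.2))), Us (A p.2)).
pose Ns (p : K * K) := (A (Us p.1), A (p.1 - U (Us p.1)) + A (U p.2)).
have NNs x y : prod_ip (N x) y = prod_ip x (Ns y).
  rewrite /prod_ip /N /Ns /= (ipDr HK) -!Asa !(ipDl HK) !(ipBr HK) (ipNl HK).
  by rewrite !hUs !hUs' -!addrA.
(* Since U* U = 1, U* vanishes on the range of 1 - U U*. Both products are therefore block diagonal
   with A^2 twice, which is normality and also yields the norm bound. *)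
have NsN p : Ns (N p) = (A (A p.1), A (A p.2)).
  rewrite /Ns /N /=; congr pair.
    by rewrite (linmapD Usl) (linmapB Usl) !UsU subrr addr0.
  rewrite -(linmapD Al) (linmapD Usl) (linmapB Usl) !UsU subrr addr0.
  by rewrite [U _ + _]addrC addrK subrK.
have NNs' p : N (Ns p) = (A (A p.1), A (A p.2)).
  rewrite /Ns /N /= -(linmapD Al); set w := _ - _ + _.
  have Usw : Us w = p.2.
    by rewrite /w (linmapD Usl) (linmapB Usl) !UsU subrr add0r.
  rewrite -!AUs Usw; congr pair.
  rewrite !UA -!(linmapB Al) -!(linmapD Al) /w addrK.
  by rewrite [U _ + _]addrC subrK.
exists N; split; last first.
  by move=> x; rewrite /N /= (linmap0 Al) (linmap0 Usl) (linmap0 Ul) subr0 addr0.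
split; last by exists Ns; split => // x; rewrite NsN NNs'.
split.
  move=> a x y; rewrite /N /= !(Al, Ul, Usl); congr pair.
  change (a *: U (A x.1) + U (A y.1) +
    (a *: A x.2 + A y.2 - (a *: U (Us (A x.2)) + U (Us (A y.2)))) =
    a *: (U (A x.1) + (A x.2 - U (Us (A x.2)))) +
    (U (A y.1) + (A y.2 - U (Us (A y.2))))).
  by rewrite !scalerDr !scalerN opprD [RHS]addrACA; congr (_ + _); rewrite addrACA.
exists c => p.
suff -> : hnsq prod_ip (N p) = nsq (A p.1) + nsq (A p.2).
  by rewrite prod_nsq mulrDr lerD// cA.
by rewrite {1}/hnsq NNs NsN /prod_ip /= cReD -(Asa p.1) -(Asa p.2).
Qed.

End NormalExtension.

(** The linear functional t^n |-> m n evaluated at t^n (c - t)^k. Its nonnegativity for all n and k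
    is Hausdorff's condition for a moment sequence on [0, c]. *)
Fixpoint cdiff (R : pzRingType) (c : R) (m : nat -> R) (n k : nat) : R :=
  if k is k'.+1 then c * cdiff c m n k' - cdiff c m n.+1 k' else m n.

(* [cdiff c m n k] is [<A^n (c - A)^k v, v>] for A = N*N, and c - A >= 0. *)
Lemma normal_cdiff_ge0 (R : realType) (K : lmodType R[i]) (ip : K -> K -> R[i])
    (N : K -> K) (c : R) (v : K) (n k : nat) :
  is_hilbert ip -> bounded_normal ip N ->
  (forall x, hnsq ip (N x) <= c * hnsq ip x) ->
  0 <= cdiff c (fun n => hnsq ip (iter n N v)) n k.
Proof.
move=> HK [[Nl _] [Ns [NNs comm]]] cN.
have Nsl := adjoint_linmap HK NNs.
pose B x := c%:C%C *: x - Ns (N x).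
have BD x : N (B x) = B (N x).
  by rewrite /B (linmapB Nl) (linmapZ Nl) comm.
have NB j x : N (iter j B x) = iter j B (N x).
  by elim: j => //= j IH; rewrite BD IH.
have Bsa x y : ip (B x) y = ip x (B y).
  rewrite /B (ipBl HK) (ipBr HK) (ipZl HK) (ipZr HK) -NNs; congr (_ * _ - _).
    exact: (esym (conjc_real c)).
  by rewrite (ipC HK) -NNs -(ipC HK).
have cdE j i : cdiff c (fun n => hnsq ip (iter n N v)) i j =
    complex.Re (ip (iter j B (iter i N v)) (iter i N v)).
  elim: j i => [//|j IH] i /=.
  rewrite !IH /B (ipBl HK) raddfB /= (reZl HK); congr (_ - _).
  by rewrite -NB [RHS](re_sym HK) -NNs (re_sym HK).
(* B is self-adjoint: one factor B goes to each argument and k drops by 2. The case k = 0 is a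
   squared norm and k = 1 is the bound on N. *)
rewrite cdE; elim/ltn_ind: k (iter n N v) => -[|[|k]] IH u /=.
- exact: (nsq_ge0 HK).
- rewrite /B (ipBl HK) raddfB /= (reZl HK) subr_ge0.
  by rewrite (re_sym HK) -NNs; exact: cN.
- by rewrite Bsa -iterS iterSr; apply: IH.
Qed.

(** * Densities, semidirect products of measures, factorization *)

Import HBNNSimple.

Section NonnegativeInduction.
Context d (T : measurableType d) (R : realType).
Local Open Scope ereal_scope.

(** Simple functions first, then increasing limits. It serves both for integration against a density
    and for iterated integrals. *)
Lemma ge0_measurable_ind (Q : (T -> \bar R) -> Prop) :
  (forall A, measurable A -> Q (fun x => (\1_A x)%:E)) ->
  (forall f g, measurable_fun setT f -> measurable_fun setT g ->
     (forall x, 0 <= f x) -> (forall x, 0 <= g x) ->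
     Q f -> Q g -> Q (fun x => f x + g x)) ->
  (forall (k : R) f, measurable_fun setT f -> (forall x, 0 <= f x) ->
     (0 <= k)%R -> Q f -> Q (fun x => k%:E * f x)) ->
  (forall (f : (T -> \bar R)^nat) g, (forall n, measurable_fun setT (f n)) ->
     (forall n x, 0 <= f n x) ->
     (forall x, {homo f ^~ x : n m / (n <= m)%N >-> n <= m}) ->
     (forall x, f n x @[n --> \oo] --> g x) ->
     (forall n, Q (f n)) -> Q g) ->
  forall f, measurable_fun setT f -> (forall x, 0 <= f x) -> Q f.
Proof.
move=> Qi Qd Qz Ql f mf f0.
pose g n : {nnsfun T >-> R} := nnsfun_approx measurableT mf n.
apply: (Ql (fun n x => (g n x)%:E) f).
- by move=> n; exact/measurable_EFinP.
- by move=> n x; rewrite lee_fin.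
- by move=> x n m nm; rewrite lee_fin; exact/lefP/nd_nnsfun_approx.
- by move=> x; apply: cvg_nnsfun_approx.
move=> n; move: (g n) => {}g.
(* The values of g are nonnegative; writing [|y|] keeps the coefficients nonnegative in the
   induction over an arbitrary list of reals. *)
have -> : (fun x => (g x)%:E) = (fun x =>
    (\sum_(y <- finmap.enum_fset (fset_set (range g))) `|y| * \1_(g @^-1` [set y]) x)%R%:E).
  apply/funext => x; congr EFin; rewrite {1}(fimfunE g) fsbig_finite//=.
  rewrite !big_seq; apply: eq_bigr => y.
  rewrite in_fset_set// inE => -[z _ <-].
  by rewrite ger0_norm.
have QS (s : seq R) : Q (fun x => (\sum_(y <- s) `|y| * \1_(g @^-1` [set y]) x)%R%:E).
  elim: s => [|y s IH].
    under eq_fun do rewrite big_nil.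
    by have := Qi _ measurable0; under eq_fun do rewrite indic0.
  under eq_fun do rewrite big_cons EFinD EFinM.
  have my : measurable (g @^-1` [set y]) by [].
  have mi : measurable_fun setT (fun x => (\1_(g @^-1` [set y]) x : R)%:E).
    by apply/measurable_EFinP; exact: measurable_indic.
  apply: Qd.
  - exact: emeasurable_funM.
  - apply/measurable_EFinP/measurable_sum => z.
    by apply: measurable_funM => //; exact: measurable_indic.
  - by move=> x; rewrite mule_ge0// lee_fin.
  - by move=> x; rewrite lee_fin sumr_ge0// => z _; rewrite mulr_ge0.
  - by apply: Qz => //; exact: Qi.
  - exact: IH.
exact: QS.
Qed.

End NonnegativeInduction.

(** Multiplication is not continuous at (0, oo). Monotonicity settles the critical case: if the
    limit is 0, all terms are already 0. *)
Lemma ge0_cvgeMr (R : realType) (u : (\bar R)^nat) (l w : \bar R) :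
  (0 <= w)%E -> (forall n, 0 <= u n)%E ->
  {homo u : n m / (n <= m)%N >-> (n <= m)%E} ->
  u n @[n --> \oo] --> l -> (u n * w)%E @[n --> \oo] --> (l * w)%E.
Proof.
move=> w0 u0 und ul.
have ule n : (u n <= l)%E.
  rewrite -(cvg_lim _ ul)//.
  rewrite (cvg_lim _ (ereal_nondecreasing_cvgn und))//.
  by apply: ereal_sup_ubound; exists n.
have [->|wn0] := eqVneq w 0%E.
  rewrite mule0; under eq_fun do rewrite mule0.
  exact: cvg_cst.
have [l0|ln0] := eqVneq l 0%E.
  have -> : (fun n => u n * w)%E = cst 0%E.
    apply/funext => n; suff -> : u n = 0%E by rewrite mul0e.
    by apply/eqP; rewrite eq_le u0 andbT -l0.
  by rewrite l0 mul0e; exact: cvg_cst.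
apply: cvgeM => //; last exact: cvg_cst.
by case: l w ln0 wn0 {ul ule w0} => [l||] [w||].
Qed.

Section Density.
Context d (T : measurableType d) (R : realType).
Variables (nu mu : {measure set T -> \bar R}) (w : T -> \bar R).
Hypotheses (mw : measurable_fun setT w) (w0 : forall x, (0 <= w x)%E).
Hypothesis nuE : forall D, measurable D -> nu D = (\int[mu]_(x in D) w x)%E.
Local Open Scope ereal_scope.

Lemma integral_indicl D (f : T -> \bar R) :
  \int[mu]_x ((\1_D x)%:E * f x) = \int[mu]_(x in D) f x.
Proof.
rewrite [RHS]integral_mkcond; apply: eq_integral => x _.
by rewrite patchE indicE; case: (x \in D); rewrite ?mul1e ?mul0e.
Qed.

Lemma integral_density (f : T -> \bar R) :
  measurable_fun setT f -> (forall x, 0 <= f x) ->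
  \int[nu]_x f x = \int[mu]_x (f x * w x).
Proof.
move: f; apply: ge0_measurable_ind.
- by move=> A mA; rewrite integral_indicl integral_indic// setIT nuE.
- move=> f g mf mg f0 g0 fE gE; rewrite ge0_integralD// fE gE.
  under [RHS]eq_integral do rewrite ge0_muleDl//.
  by rewrite ge0_integralD//; do ?[exact: emeasurable_funM];
     move=> x _; rewrite mule_ge0.
- move=> k f mf f0 k0 fE; rewrite ge0_integralZl// fE.
  under [RHS]eq_integral do rewrite -muleA.
  by rewrite ge0_integralZl//; [exact: emeasurable_funM|move=> x _; rewrite mule_ge0].
- move=> f g mf f0 fnd fg fE.
  transitivity (\int[nu]_x limn (f ^~ x)).
    by apply: eq_integral => x _; apply/esym/cvg_lim => //; exact: fg.
  rewrite monotone_convergence//.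
  transitivity (\int[mu]_x limn (fun n => f n x * w x)).
    rewrite monotone_convergence//.
    - by congr (limn _); apply/funext.
    - by move=> n; exact: emeasurable_funM.
    - by move=> n x _; rewrite mule_ge0.
    - by move=> x _ a b ab; rewrite lee_wpmul2r// fnd.
  apply: eq_integral => x _; apply/cvg_lim => //.
  exact: ge0_cvgeMr (fnd x) (fg x).
Qed.

End Density.

Section SemidirectProduct.
Context d d' (X : measurableType d) (Y : measurableType d') (R : realType).
Variables (mu : {measure set X -> \bar R}) (P : R.-pker X ~> Y).
Local Open Scope ereal_scope.

(** The measure rho = mu(dx) P(x, dy), defined through sections so that [mu] may be infinite. *)
Definition sdprod (S : set (X * Y)) : \bar R := \int[mu]_x P x (xsection S x).

Let measurable_ksection S : measurable S ->
  measurable_fun setT (fun x => P x (xsection S x)).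
Proof. by move=> mS; apply: measurable_fun_xsection_finite_kernel; rewrite inE. Qed.

Let sdprod0 : sdprod set0 = 0.
Proof. by apply: integral0_eq => x _; rewrite xsection0 measure0. Qed.

Let sdprod_ge0 S : 0 <= sdprod S.
Proof. by apply: integral_ge0. Qed.

Let sdprod_sigma_additive : semi_sigma_additive sdprod.
Proof.
move=> F mF tF mU.
have -> : sdprod (\bigcup_n F n) = \sum_(0 <= i <oo) sdprod (F i).
  rewrite /sdprod -integral_nneseries//; last by move=> n; exact: measurable_ksection.
  apply: eq_integral => x _; rewrite xsection_bigcup measure_semi_bigcup//.
  - by move=> i; exact: measurable_xsection.
  - exact: trivIset_xsection.
  - by apply: bigcupT_measurable => i; exact: measurable_xsection.
by apply: is_cvg_nneseries => n _ _; exact: sdprod_ge0.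
Qed.

HB.instance Definition _ := isMeasure.Build _ _ _ sdprod
  sdprod0 sdprod_ge0 sdprod_sigma_additive.

Lemma sdprodX A B : measurable A -> measurable B ->
  sdprod (A `*` B) = \int[mu]_(x in A) P x B.
Proof.
move=> mA mB; rewrite [RHS]integral_mkcond; apply: eq_integral => x _.
rewrite patchE; case: ifPn => xA; first by rewrite in_xsectionX.
by rewrite notin_xsectionX// measure0.
Qed.

(** Measurability of the inner integral and the iterated formula are proved together, since the sum
    and limit steps for the formula rely on the measurability of the pieces. *)
Let integral_sdprod_subproof (f : X * Y -> \bar R) :
  measurable_fun setT f -> (forall z, 0 <= f z) ->
  measurable_fun setT (fun x => \int[P x]_y f (x, y)) /\
  \int[sdprod]_z f z = \int[mu]_x \int[P x]_y f (x, y).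
Proof.
have mf1 (g : X * Y -> \bar R) x : measurable_fun setT g -> measurable_fun setT (fun y => g (x, y)).
  by move=> mg; exact: measurable_fun_pair2.
move: f; apply: ge0_measurable_ind.
- move=> A mA.
  have E x : \int[P x]_y (\1_A (x, y))%:E = P x (xsection A x).
    have -> : (fun y => (\1_A (x, y))%:E) = (fun y => (\1_(xsection A x) y : R)%:E).
      by apply/funext => y; rewrite !indicE mem_xsection.
    by rewrite integral_indic ?setIT//; exact: measurable_xsection.
  under eq_fun do rewrite E; split; first exact: measurable_ksection.
  by rewrite integral_indic// setIT; apply: eq_integral => x _; rewrite ?E.
- move=> f g mf mg f0 g0 [mfi fE] [mgi gE].
  have E x : \int[P x]_y (f (x, y) + g (x, y)) =
      \int[P x]_y f (x, y) + \int[P x]_y g (x, y).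
    by rewrite ge0_integralD//; exact: mf1.
  under eq_fun do rewrite E; split; first exact: emeasurable_funD.
  by rewrite ge0_integralD// fE gE [RHS]ge0_integralD// => x _; apply: integral_ge0.
- move=> k f mf f0 k0 [mfi fE].
  have E x : \int[P x]_y (k%:E * f (x, y)) = k%:E * \int[P x]_y f (x, y).
    by rewrite ge0_integralZl//; exact: mf1.
  under eq_fun do rewrite E; split; first exact: emeasurable_funM.
  by rewrite ge0_integralZl// fE [RHS]ge0_integralZl// => x _; apply: integral_ge0.
- move=> f g mf f0 fnd fg H.
  have E x : (fun n => \int[P x]_y f n (x, y)) @ \oo --> \int[P x]_y g (x, y).
    have -> : \int[P x]_y g (x, y) = \int[P x]_y limn (fun n => f n (x, y)).
      by apply: eq_integral => y _; apply/esym/cvg_lim => //; exact: fg.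
    by apply: cvg_monotone_convergence => // n; exact: mf1.
  split; first by apply: (emeasurable_fun_cvg _ _ (fun n => (H n).1)) => x _; exact: E.
  transitivity (\int[sdprod]_z limn (f ^~ z)).
    by apply: eq_integral => z _; apply/esym/cvg_lim => //; exact: fg.
  rewrite monotone_convergence//.
  transitivity (\int[mu]_x limn (fun n => \int[P x]_y f n (x, y))); last first.
    by apply: eq_integral => x _; apply/cvg_lim => //; exact: E.
  rewrite monotone_convergence//.
  - by congr (limn _); apply/funext => n; rewrite (H n).2.
  - by move=> n; exact: (H n).1.
  - by move=> n x _; apply: integral_ge0.
  - move=> x _ a b ab; apply: ge0_le_integral => //.
    + exact: mf1.
    + exact: mf1.
    + by move=> y _; exact: fnd.
Qed.

Lemma measurable_kernel_integral (f : X * Y -> \bar R) :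
  measurable_fun setT f -> (forall z, 0 <= f z) ->
  measurable_fun setT (fun x => \int[P x]_y f (x, y)).
Proof. by move=> mf f0; case: (integral_sdprod_subproof mf f0). Qed.

Lemma integral_sdprod (f : X * Y -> \bar R) :
  measurable_fun setT f -> (forall z, 0 <= f z) ->
  \int[sdprod]_z f z = \int[mu]_x \int[P x]_y f (x, y).
Proof. by move=> mf f0; case: (integral_sdprod_subproof mf f0). Qed.

End SemidirectProduct.

(** * Comparison of functions through their integrals over sets of finite measure *)

Section AlmostEverywhereComparison.
Context d (T : measurableType d) (R : realType).
Variable mu : {measure set T -> \bar R}.
Hypothesis sf : sigma_finite setT mu.
Local Open Scope ereal_scope.

(** The bad set is covered by countably many sets of finite measure on which v <= n and v + 1/(m+1)
    <= u. There the integral of v is finite and can be cancelled, leaving measure 0. Infinite values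
    of u are allowed; v is finite wherever v < u. *)
Lemma ae_le_integral (u v : T -> \bar R) :
  measurable_fun setT u -> measurable_fun setT v ->
  (forall x, 0 <= u x) -> (forall x, 0 <= v x) ->
  (forall D, measurable D -> mu D < +oo ->
     \int[mu]_(x in D) u x <= \int[mu]_(x in D) v x) ->
  {ae mu, forall x, u x <= v x}.
Proof.
move=> mu_ mv u0 v0 h.
have [F FT mF] := sf.
pose D k m n := F k `&` ([set x | v x <= n%:R%:E] `&`
  [set x | v x + (m.+1%:R^-1)%:E <= u x]).
have mD k m n : measurable (D k m n).
  apply: measurableI; first exact: (mF k).1.
  apply: measurableI.
    by rewrite -[X in measurable X]setTI; exact: emeasurable_fun_infty_c.
  rewrite -[X in measurable X]setTI; apply: measurable_lee => //.
  exact: emeasurable_funD.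
have D0 k m n : mu (D k m n) = 0.
  have muD : mu (D k m n) < +oo.
    apply: le_lt_trans (mF k).2; apply: le_measure; rewrite ?inE//.
      exact: (mF k).1.
    by move=> x [].
  have e0 : (0 < m.+1%:R^-1 :> R)%R by rewrite invr_gt0.
  set e := (m.+1%:R^-1)%R in e0.
  have h1 : \int[mu]_(x in D k m n) v x + e%:E * mu (D k m n) <=
            \int[mu]_(x in D k m n) v x.
    rewrite -integral_cst// -ge0_integralD//; last 2 first.
    - exact: measurable_funTS.
    - by move=> x _; rewrite lee_fin ltW.
    apply: le_trans (h _ (mD k m n) muD); apply: ge0_le_integral => //.
    - by move=> x _; rewrite adde_ge0// lee_fin ltW.
    - by apply: emeasurable_funD => //; exact: measurable_funTS.
    - exact: measurable_funTS.
    - by move=> x [_ []].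
  have vfin : \int[mu]_(x in D k m n) v x \is a fin_num.
    rewrite ge0_fin_numE ?integral_ge0//.
    apply: (@le_lt_trans _ _ (n%:R%:E * mu (D k m n))).
      rewrite -integral_cst//; apply: ge0_le_integral => //.
      - exact: measurable_funTS.
      - by move=> x [_ []].
    by rewrite lte_mul_pinfty// lee_fin.
  have : e%:E * mu (D k m n) <= 0 by rewrite -(leeD2lE _ _ vfin) adde0.
  have muDfin : mu (D k m n) \is a fin_num by rewrite ge0_fin_numE.
  rewrite -(fineK muDfin) -EFinM lee_fin pmulr_rle0// => h2.
  by congr EFin; apply/eqP; rewrite eq_le h2 fine_ge0.
have : mu.-negligible (\bigcup_k \bigcup_m \bigcup_n D k m n).
  apply: negligible_bigcup => k; apply: negligible_bigcup => m.
  by apply: negligible_bigcup => n; exists (D k m n); split.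
apply: negligibleS => x /= /negP; rewrite -ltNge => vu.
have [k _ Fx] : (\bigcup_k F k) x by rewrite -FT.
have vfin : v x \is a fin_num by rewrite ge0_fin_numE// (lt_le_trans vu) ?leey.
have [m hm] : exists m : nat, v x + (m.+1%:R^-1)%:E <= u x.
  case: (u x) vu => [r| |]; last by rewrite ltNge leNye.
    rewrite -(fineK vfin) lte_fin => vr.
    have rv : (0 < r - fine (v x))%R by rewrite subr_gt0.
    exists (Num.truncn (r - fine (v x))^-1); rewrite -EFinD lee_fin.
    rewrite -lerBrDl -[leRHS]invrK lef_pV2 ?posrE ?invr_gt0//.
    exact/ltW/truncnS_gt.
  by exists 0%N; rewrite leey.
exists k => //; exists m => //; exists (Num.truncn (fine (v x))).+1 => //.
split => //; split => //=.
by rewrite -[leLHS](fineK vfin) lee_fin; exact/ltW/truncnS_gt.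
Qed.

Lemma ae_eq_integral_sets (u v : T -> \bar R) :
  measurable_fun setT u -> measurable_fun setT v ->
  (forall x, 0 <= u x) -> (forall x, 0 <= v x) ->
  (forall D, measurable D -> mu D < +oo ->
     \int[mu]_(x in D) u x = \int[mu]_(x in D) v x) ->
  {ae mu, forall x, u x = v x}.
Proof.
move=> mu_ mv u0 v0 h.
have h1 : {ae mu, forall x, u x <= v x}.
  by apply: ae_le_integral => // D mD Doo; rewrite h.
have h2 : {ae mu, forall x, v x <= u x}.
  by apply: ae_le_integral => // D mD Doo; rewrite h.
by apply: filterS2 h1 h2 => x uv vu; apply/eqP; rewrite eq_le uv.
Qed.

End AlmostEverywhereComparison.

(* Doob-Dynkin: with g^-1(-oo, q) = phi^-1(D q) for rational q, take
   w y = inf { q | y in D q }. *)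
Lemma factor_through d (X : measurableType d) (R : realType) (phi : X -> X)
    (g : X -> \bar R) :
  (forall x, 0 <= g x)%E ->
  (forall B : set (\bar R), measurable B ->
     exists D : set X, measurable D /\ g @^-1` B = phi @^-1` D) ->
  exists w : X -> \bar R, [/\ measurable_fun setT w, (forall x, 0 <= w x)%E &
    forall x, g x = w (phi x)].
Proof.
move=> g0 hg.
have /choice [D hD] : forall q : rat, exists D : set X, measurable D /\
    g @^-1` [set` `]-oo, (ratr q)%:E[ ] = phi @^-1` D.
  by move=> q; apply: hg; exact: emeasurable_itv.
(* Rationals are enumerated through their codes, so that the infimum runs over a sequence of
   measurable functions; codes of nothing and points outside [D q] contribute +oo. *)
pose f (n : nat) (y : X) : \bar R :=
  if unpickle n is Some q then (if `[< D q y >] then (ratr q)%:E else +oo%E) else +oo%E.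
have mf n : measurable_fun setT (f n).
  rewrite /f; case: (unpickle n) => [q|]; last exact: measurable_cst.
  apply: measurable_fun_ifT => //.
  apply: (measurable_fun_bool true); rewrite setTI.
  rewrite [X in measurable X](_ : _ = D q); first exact: (hD q).1.
  by apply/seteqP; split => y /= /asboolP.
pose w0 y := einfs (f ^~ y) 0%N.
have w0E x : g x = w0 (phi x).
  apply/eqP; rewrite eq_le; apply/andP; split.
    apply/ereal_infP => _ [n _ <-]; rewrite /f.
    case: (unpickle n) => [q|]; last by rewrite leey.
    case: asboolP => [Dq|_]; last by rewrite leey.
    have : (phi @^-1` D q) x by [].
    by rewrite -(hD q).2 /= in_itv /= => /ltW.
  rewrite leNgt; apply/negP => gw.
  have [r gr rw] : exists2 r : rat, (g x < (ratr r)%:E)%E & ((ratr r)%:E < w0 (phi x))%E.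
    have gfin : g x \is a fin_num by rewrite ge0_fin_numE// (lt_le_trans gw) ?leey.
    have [s gs sw] : exists2 s : R, fine (g x) < s & (s%:E <= w0 (phi x))%E.
      case: (w0 (phi x)) gw => [s| |]; last by rewrite ltNge leNye.
        by rewrite -[X in (X < _)%E](fineK gfin) lte_fin => ?; exists s.
      by exists (fine (g x) + 1); rewrite ?ltrDl// leey.
    have [q] := rat_in_itvoo gs; rewrite in_itv /= => /andP[q1 q2].
    exists q; first by rewrite -[X in (X < _)%E](fineK gfin) lte_fin.
    by apply: lt_le_trans sw; rewrite lte_fin.
  move: rw; apply/negP; rewrite -leNgt.
  apply: ereal_inf_lbound; exists (pickle r) => //; rewrite /f pickleK.
  case: asboolP => // nD; exfalso; apply: nD.
  have : (g @^-1` [set` `]-oo, (ratr r)%:E[ ]) x by rewrite /= in_itv.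
  by rewrite (hD r).2.
(* Off the range of phi the sets [D q] are unconstrained and [w0] may be negative, hence the maximum
   with 0. *)
exists (fun y => maxe (w0 y) 0%E); split.
- by apply: measurable_maxe => //; exact: measurable_fun_einfs.
- by move=> x; rewrite le_max lexx orbT.
- by move=> x; rewrite -w0E; apply/esym/max_idPl.
Qed.

Section ChangeOfVariables.
Context d (X : measurableType d) (R : realType).
Variables (mu : {measure set X -> \bar R}) (phi : X -> X) (h : X -> \bar R).
Hypotheses (mphi : measurable_fun setT phi) (hh : is_hphi mu phi h).
Local Open Scope ereal_scope.

Lemma integral_comp_hphi (u : X -> \bar R) :
  measurable_fun setT u -> (forall x, 0 <= u x) ->
  \int[mu]_x u (phi x) = \int[mu]_x (u x * h x).
Proof.
case: hh => mh h0 hE mu_ u0.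
have <- : \int[pushforward mu phi]_y u y = \int[mu]_x u (phi x).
  by rewrite ge0_integral_pushforward.
rewrite -(@integral_density _ _ _
  (measure_function_pushforward__canonical__measure_function_Measure mu mphi)) //.
Qed.

End ChangeOfVariables.

(** * The Hausdorff moment problem *)

Section Bernstein.
Variable R : realFieldType.
Implicit Types (p : {poly R}) (s t e : R).

Definition bern N j : {poly R} := 'C(N, j)%:R *: ('X^j * (1 - 'X) ^+ (N - j)).

(** Pascal's rule for the Bernstein basis; in probabilistic terms, conditioning a binomial variable
    on one trial. *)
Lemma sum_bern_rec (f : nat -> R) k :
  \sum_(j < k.+2) f j *: bern k.+1 j =
  'X * (\sum_(j < k.+1) f j.+1 *: bern k j) +
  (1 - 'X) * (\sum_(j < k.+1) f j *: bern k j).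
Proof.
have bS j : bern k.+1 j.+1 = 'X * bern k j + (1 - 'X) * bern k j.+1.
  rewrite /bern binS natrD scalerDl addrC subSS; congr (_ + _).
    by rewrite -scalerAr mulrA -exprS.
  have [jk|kj] := ltnP j k; last by rewrite bin_small ?ltnS// !scale0r mulr0.
  by rewrite -scalerAr [(1 - _) * _]mulrC -mulrA -exprSr -subSn// subSS.
have b0 : bern k.+1 0 = (1 - 'X) * bern k 0.
  by rewrite /bern !bin0 !scale1r !subn0 !expr0 !mul1r exprS.
have bk : bern k k.+1 = 0 by rewrite /bern bin_small// scale0r.
rewrite big_ord_recl b0 !mulr_sumr.
under eq_bigr do rewrite lift0 bS scalerDr.
rewrite big_split /= addrCA; congr (_ + _).
  by apply: eq_bigr => j _; rewrite scalerAr.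
rewrite [in RHS]big_ord_recl scalerAr; congr (_ + _).
rewrite big_ord_recr /= bk mulr0 scaler0 addr0.
by apply: eq_bigr => j _; rewrite scalerAr.
Qed.

(** The factorial moments of the binomial law. They give its total mass and variance, and later an
    exact formula for m n. *)
Lemma sum_bern_bin k n :
  \sum_(j < k.+1) 'C(j, n)%:R *: bern k j = 'C(k, n)%:R *: 'X^n.
Proof.
elim: k n => [|k IH] n.
  rewrite big_ord1 /bern /= bin0 subn0 expr0 scale1r mulr1.
  by case: n => [|n]; rewrite ?bin0// bin0n /= !scale0r.
rewrite (sum_bern_rec (fun j => 'C(j, n)%:R)) IH.
case: n => [|n].
  under eq_bigr => j _ do rewrite bin0 -(bin0 j).
  by rewrite IH !bin0 !scale1r expr0 !mulr1 addrC subrK.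
under eq_bigr => j _ do rewrite binS natrD scalerDl.
rewrite big_split /= !IH binS natrD scalerDl.
have -> : ('C(k, n)%:R : R) *: ('X^(n.+1) : {poly R}) = 'X * (('C(k, n)%:R : R) *: 'X^n).
  by rewrite -scalerAr -exprS.
by ring.
Qed.

Lemma sum_bern k : \sum_(j < k.+1) bern k j = 1.
Proof.
have := sum_bern_bin k 0; rewrite bin0 scale1r expr0 => <-.
by apply: eq_bigr => j _; rewrite bin0 scale1r.
Qed.

Lemma horner_bern N j s :
  (bern N j).[s] = 'C(N, j)%:R * (s ^+ j * (1 - s) ^+ (N - j)).
Proof. by rewrite /bern !hornerE. Qed.

Lemma bern_ge0 N j s : 0 <= s <= 1 -> 0 <= (bern N j).[s].
Proof.
move=> /andP[s0 s1]; rewrite horner_bern mulr_ge0// mulr_ge0// exprn_ge0//.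
by rewrite subr_ge0.
Qed.

Lemma sum_horner_bern N s : \sum_(j < N.+1) (bern N j).[s] = 1.
Proof. by rewrite -horner_sum sum_bern hornerE. Qed.

(** Follows from the first factorial moments through j^2 = 2 C(j, 2) + C(j, 1). *)
Lemma bern_variance N s :
  \sum_(j < N.+1) (j%:R - N%:R * s) ^+ 2 * (bern N j).[s] = N%:R * s * (1 - s).
Proof.
have H n : \sum_(j < N.+1) 'C(j, n)%:R * (bern N j).[s] = 'C(N, n)%:R * s ^+ n.
  have /(congr1 (fun p => p.[s])) := sum_bern_bin N n.
  rewrite horner_sum !hornerE => <-.
  by apply: eq_bigr => j _; rewrite hornerE.
have sq (j : nat) : (j%:R : R) ^+ 2 = 2 * 'C(j, 2)%:R + 'C(j, 1)%:R.
  rewrite bin1 -natrM (mul_bin_left j 1) bin1 -natrD -natrX; congr (_%:R).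
  by case: j => //= j; rewrite expnS expn1; nia.
transitivity (\sum_(j < N.+1) (2 * ('C(j, 2)%:R * (bern N j).[s]) +
    (1 - 2 * N%:R * s) * ('C(j, 1)%:R * (bern N j).[s]) +
    N%:R ^+ 2 * s ^+ 2 * ('C(j, 0)%:R * (bern N j).[s]))).
  apply: eq_bigr => j _; have := sq j; rewrite bin0 bin1 mul1r.
  move: ('C(j, 2)%:R : R) (j%:R : R) (N%:R : R) (bern N j).[s] => c x n b h.
  have -> : c = (x ^+ 2 - x) / 2 by rewrite h; field.
  by field.
rewrite !big_split /= -!mulr_sumr !H.
have := sq N; rewrite bin0 bin1 mul1r expr0 expr1 mulr1.
move: ('C(N, 2)%:R : R) (N%:R : R) => c n h.
have -> : c = (n ^+ 2 - n) / 2 by rewrite h; field.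
by field.
Qed.

(* Bernstein's polynomial for the indicator function of (-oo, t] *)
Definition qstep N t : {poly R} := \sum_(j < N.+1 | j%:R <= N%:R * t) bern N j.

Lemma qstepC N t s :
  1 - (qstep N t).[s] = \sum_(j < N.+1 | ~~ (j%:R <= N%:R * t)) (bern N j).[s].
Proof.
have := sum_horner_bern N s.
rewrite (bigID (fun j : 'I_N.+1 => j%:R <= N%:R * t)) /= => h.
by rewrite /qstep horner_sum; apply/eqP; rewrite subr_eq [X in _ == X]addrC h.
Qed.

Lemma qstep_ge0 N t s : 0 <= s <= 1 -> 0 <= (qstep N t).[s].
Proof.
by move=> s01; rewrite /qstep horner_sum sumr_ge0// => j _; exact: bern_ge0.
Qed.

Lemma qstep_le1 N t s : 0 <= s <= 1 -> (qstep N t).[s] <= 1.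
Proof.
move=> s01; rewrite -subr_ge0 qstepC sumr_ge0// => j _; exact: bern_ge0.
Qed.

(** Chebyshev's inequality for the binomial law, its variance N s (1 - s) being bounded by N. *)
Lemma bern_chebyshev N (P : pred nat) s e : (0 < N)%N -> 0 < e -> 0 <= s <= 1 ->
  (forall j, P j -> (N%:R * e) ^+ 2 <= (j%:R - N%:R * s) ^+ 2) ->
  \sum_(j < N.+1 | P j) (bern N j).[s] <= (N%:R * e ^+ 2)^-1.
Proof.
move=> N0 e0 s01 hP.
have N0' : (0 : R) < N%:R by rewrite ltr0n.
have ne0 : 0 < (N%:R * e) ^+ 2 by rewrite exprn_gt0// mulr_gt0.
have : (N%:R * e) ^+ 2 * (\sum_(j < N.+1 | P j) (bern N j).[s]) <= N%:R.
  apply: (@le_trans _ _ (N%:R * s * (1 - s))); last first.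
    rewrite -mulrA ler_piMr// ?ltW//.
    by case/andP: s01 => s0 s1; nra.
  rewrite -bern_variance mulr_sumr [leRHS](bigID (fun j : 'I_N.+1 => P j)) /=.
  rewrite -[leLHS]addr0 lerD//.
    by apply: ler_sum => j Pj; rewrite ler_wpM2r ?bern_ge0// hP.
  by rewrite sumr_ge0// => j _; rewrite mulr_ge0 ?bern_ge0// sqr_ge0.
rewrite mulrC -ler_pdivlMr// => /le_trans; apply.
rewrite exprMn [N%:R ^+ 2]expr2 -mulrA invfM mulrA divff ?gt_eqF// mul1r.
exact: lexx.
Qed.

Lemma qstep_left N t e s : (0 < N)%N -> 0 < e -> 0 <= s <= 1 -> s + e <= t ->
  1 - (qstep N t).[s] <= (N%:R * e ^+ 2)^-1.
Proof.
move=> N0 e0 s01 st; rewrite qstepC.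
apply: (bern_chebyshev (P := fun j => ~~ (j%:R <= N%:R * t))) => // j.
rewrite -ltNge => h.
have N0' : (0 : R) < N%:R by rewrite ltr0n.
have : N%:R * e <= j%:R - N%:R * s by nra.
by move=> h'; rewrite ler_sqr// nnegrE; [nra|apply: le_trans h'; nra].
Qed.

Lemma qstep_right N t e s : (0 < N)%N -> 0 < e -> 0 <= s <= 1 -> t + e <= s ->
  (qstep N t).[s] <= (N%:R * e ^+ 2)^-1.
Proof.
move=> N0 e0 s01 st; rewrite /qstep horner_sum.
apply: (bern_chebyshev (P := fun j => j%:R <= N%:R * t)) => // j h.
have N0' : (0 : R) < N%:R by rewrite ltr0n.
have h' : N%:R * e <= N%:R * s - j%:R by nra.
rewrite -[leRHS]sqrrN opprB ler_sqr// nnegrE; [nra|apply: le_trans h'; nra].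
Qed.

End Bernstein.

(** * The moment functional on polynomials and its positivity on [0, 1] *)

Section MomentFunctional.
Variables (R : realType) (m : nat -> R).
Implicit Types (p q : {poly R}) (s t e : R).

(** The linear functional sending X^n to m n: integration against the measure to be found, available
    before that measure is. *)
Definition pmom p : R := \sum_(i < size p) p`_i * m i.

Lemma pmomE n p : (size p <= n)%N -> pmom p = \sum_(i < n) p`_i * m i.
Proof.
move=> pn; rewrite /pmom (big_ord_widen n (fun i => p`_i * m i))// big_mkcond /=.
apply: eq_bigr => i _; case: ifPn => //; rewrite -leqNgt => h.
by rewrite nth_default// mul0r.
Qed.

Lemma pmomD p q : pmom (p + q) = pmom p + pmom q.
Proof.
pose n := maxn (size p) (size q).
rewrite !(@pmomE n) ?leq_maxl ?leq_maxr ?size_polyD// -big_split /=.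
by apply: eq_bigr => i _; rewrite coefD mulrDl.
Qed.

Lemma pmomZ c p : pmom (c *: p) = c * pmom p.
Proof.
rewrite (@pmomE (size p)) ?size_scale_leq// /pmom mulr_sumr.
by apply: eq_bigr => i _; rewrite coefZ mulrA.
Qed.

Lemma pmom0 : pmom 0 = 0.
Proof. by rewrite /pmom size_poly0 big_ord0. Qed.

Lemma pmomN p : pmom (- p) = - pmom p.
Proof. by rewrite -scaleN1r pmomZ mulN1r. Qed.

Lemma pmomB p q : pmom (p - q) = pmom p - pmom q.
Proof. by rewrite pmomD pmomN. Qed.

Lemma pmom_sum (I : Type) (r : seq I) (P : pred I) (F : I -> {poly R}) :
  pmom (\sum_(i <- r | P i) F i) = \sum_(i <- r | P i) pmom (F i).
Proof. exact: (big_morph _ pmomD pmom0). Qed.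

Lemma pmomXn n : pmom 'X^n = m n.
Proof.
rewrite (@pmomE n.+1) ?size_polyXn// (bigD1 ord_max)//= coefXn eqxx mul1r.
rewrite big1 ?addr0// => i /eqP h; rewrite coefXn.
suff -> : (i == n :> nat) = false by rewrite mul0r.
by apply/negbTE/eqP => E; apply: h; apply: val_inj.
Qed.

Lemma pmom_cdiff n k : pmom ('X^n * (1 - 'X) ^+ k) = cdiff 1 m n k.
Proof.
elim: k n => [|k IH] n /=; first by rewrite expr0 mulr1 pmomXn.
rewrite -!IH mul1r -pmomB; congr pmom.
by rewrite !exprS; ring.
Qed.

Hypotheses (m0 : m 0%N = 1) (cm : forall n k, 0 <= cdiff 1 m n k).

Lemma pmom1 : pmom 1 = 1.
Proof. by rewrite -(expr0 'X) pmomXn. Qed.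

Lemma pmomC c : pmom c%:P = c.
Proof. by rewrite -[c%:P]mulr1 mul_polyC pmomZ pmom1 mulr1. Qed.

Lemma pmom_bern_ge0 N j : 0 <= pmom (bern R N j).
Proof. by rewrite /bern pmomZ pmom_cdiff mulr_ge0. Qed.

Lemma sum_pmom_bern N : \sum_(j < N.+1) pmom (bern R N j) = 1.
Proof. by rewrite -pmom_sum sum_bern pmom1. Qed.

(** The ratio for n + 1 is the ratio for n times (j - n)/(k - n), a factor within n/k of j/k. The
    errors add up, as n^2 + n <= (n + 1)^2. *)
Lemma bin_ratio_approx k n j : (n <= k)%N -> (0 < k)%N -> (j <= k)%N ->
  `|'C(j, n)%:R / 'C(k, n)%:R - (j%:R / k%:R) ^+ n| <= n%:R ^+ 2 / k%:R :> R.
Proof.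
move=> nk k0 jk.
have k0' : (0 : R) < k%:R by rewrite ltr0n.
have jk' : 0 <= (j%:R / k%:R : R) <= 1.
  by apply/andP; split; [rewrite divr_ge0|rewrite ler_pdivrMr// mul1r ler_nat].
elim: n nk => [|n IH] nk.
  by rewrite !bin0 expr0 divrr ?unitr1// subrr normr0 expr0n mul0r.
pose r : R := (j - n)%:R / (k - n)%:R.
have kn0 : (0 : R) < (k - n)%:R by rewrite ltr0n subn_gt0.
have Ckn : 'C(k, n)%:R != 0 :> R by rewrite pnatr_eq0 -lt0n bin_gt0 ltnW.
have Ckn1 : 'C(k, n.+1)%:R != 0 :> R by rewrite pnatr_eq0 -lt0n bin_gt0.
have rE : 'C(j, n.+1)%:R / 'C(k, n.+1)%:R = ('C(j, n)%:R / 'C(k, n)%:R) * r.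
  rewrite /r mulf_div; have kn0' : (k - n)%:R != 0 :> R by rewrite gt_eqF.
  apply/eqP; rewrite eqr_div ?mulf_neq0//.
  rewrite -!natrM eqr_nat; apply/eqP.
  have h1 := mul_bin_left j n; have h2 := mul_bin_left k n.
  apply/eqP; rewrite -(eqn_pmul2l (ltn0Sn n)); apply/eqP.
  rewrite mulnA h1.
  transitivity ('C(j, n) * (j - n) * (n.+1 * 'C(k, n.+1)))%N; last by nia.
  by rewrite h2; nia.
have r01 : 0 <= r <= 1.
  apply/andP; split; first by rewrite /r divr_ge0.
  by rewrite /r ler_pdivrMr// mul1r ler_nat leq_sub2r.
have rj : `|r - j%:R / k%:R| <= n%:R / k%:R.
  (* For j < n the truncated difference j - n is 0, in agreement with the vanishing of C(j, n+1). *)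
  have [nj|jn] := leqP n j; last first.
    rewrite /r (eqP (_ : (j - n == 0)%N)); last by rewrite subn_eq0 ltnW.
    rewrite mul0r sub0r normrN ger0_norm; last by case/andP: jk'.
    by rewrite ler_pM2r ?invr_gt0// ler_nat ltnW.
  have nk' : (n <= k)%N by rewrite ltnW.
  rewrite ler0_norm /r !natrB//; rewrite natrB// subr_gt0 in kn0.
    rewrite opprB -subr_ge0.
    have -> : n%:R / k%:R - (j%:R / k%:R - (j%:R - n%:R) / (k%:R - n%:R)) =
      n%:R * (j%:R - n%:R) / (k%:R * (k%:R - n%:R)) + 0 :> R.
      by field; rewrite !gt_eqF// subr_gt0.
    rewrite addr0 divr_ge0// mulr_ge0// ?subr_ge0 ?ler_nat//.
  rewrite -oppr_ge0.
  have -> : - ((j%:R - n%:R) / (k%:R - n%:R) - j%:R / k%:R) =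
    n%:R * (k%:R - j%:R) / (k%:R * (k%:R - n%:R)) :> R.
    by field; rewrite !gt_eqF// subr_gt0.
  rewrite divr_ge0// mulr_ge0// ?subr_ge0 ?ler_nat//.
rewrite rE exprSr; have {}IH := IH (ltnW nk).
set a := _ / _ in IH *; set x := j%:R / k%:R in IH rj jk' *.
have xn : 0 <= x ^+ n <= 1.
  by case/andP: jk' => x0 x1; rewrite exprn_ge0//= exprn_ile1.
have -> : a * r - x ^+ n * x = (a - x ^+ n) * r + x ^+ n * (r - x) by ring.
apply: le_trans (ler_normD _ _) _; rewrite (normrM _ r) (normrM _ (r - x)).
case/andP: r01 => r0 r1; case/andP: xn => xn0 xn1.
rewrite (ger0_norm r0) (ger0_norm xn0).
apply: (@le_trans _ _ (n%:R ^+ 2 / k%:R + n%:R / k%:R)).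
  apply: lerD.
    by apply: le_trans IH; rewrite ler_piMr.
  by apply: le_trans rj; rewrite ler_piMl.
rewrite -mulrDl ler_pM2r ?invr_gt0// -natr1.
by have : 0 <= (n%:R : R) by []; nra.
Qed.

(** By [sum_bern_bin], m n is exactly the sum of [pmom (bern R k j)] times C(j, n)/C(k, n), and the
    ratio is close to (j/k)^n. The masses [pmom (bern R k j)] at the points j/k thus form a discrete
    approximate solution of the moment problem. *)
Lemma pmom_approx k n : (n <= k)%N -> (0 < k)%N ->
  `|m n - \sum_(j < k.+1) pmom (bern R k j) * (j%:R / k%:R) ^+ n| <=
  n%:R ^+ 2 / k%:R.
Proof.
move=> nk k0.
have Ckn : 'C(k, n)%:R != 0 :> R by rewrite pnatr_eq0 -lt0n bin_gt0.
have -> : m n = \sum_(j < k.+1) pmom (bern R k j) * ('C(j, n)%:R / 'C(k, n)%:R).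
  apply: (mulfI Ckn); rewrite -pmomXn -pmomZ -sum_bern_bin pmom_sum mulr_sumr.
  by apply: eq_bigr => j _; rewrite pmomZ; field.
rewrite -sumrB; apply: le_trans (ler_norm_sum _ _ _) _.
apply: (@le_trans _ _ (\sum_(j < k.+1) pmom (bern R k j) * (n%:R ^+ 2 / k%:R))).
  apply: ler_sum => j _; rewrite -mulrBr normrM ger0_norm ?pmom_bern_ge0//.
  by rewrite ler_wpM2l ?pmom_bern_ge0// bin_ratio_approx// -ltnS.
by rewrite -mulr_suml sum_pmom_bern mul1r.
Qed.

(** The discrete approximate solution of order k gives p a nonnegative value, which differs from
    [pmom p] by at most A/k, where A collects the errors of [pmom_approx] coefficient by
    coefficient. *)
Lemma pmom_ge0 p : (forall s, 0 <= s <= 1 -> 0 <= p.[s]) -> 0 <= pmom p.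
Proof.
move=> p0.
pose A := \sum_(i < size p) `|p`_i| * i%:R ^+ 2.
have A0 : 0 <= A by apply: sumr_ge0 => i _; rewrite mulr_ge0.
have bnd k : (size p <= k)%N -> (0 < k)%N -> - (A / k%:R) <= pmom p.
  move=> pk k0.
  pose S := \sum_(j < k.+1) pmom (bern R k j) * p.[j%:R / k%:R].
  have S0 : 0 <= S.
    apply: sumr_ge0 => j _; rewrite mulr_ge0 ?pmom_bern_ge0// p0//.
    apply/andP; split; first by rewrite divr_ge0.
    by rewrite ler_pdivrMr ?ltr0n// mul1r ler_nat -ltnS.
  have SE : S = \sum_(i < size p) p`_i *
      \sum_(j < k.+1) pmom (bern R k j) * (j%:R / k%:R) ^+ i.
    under [RHS]eq_bigr => i _ do rewrite mulr_sumr.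
    rewrite exchange_big /=; apply: eq_bigr => j _.
    by rewrite horner_coef mulr_sumr; apply: eq_bigr => i _; rewrite mulrCA.
  have : `|pmom p - S| <= A / k%:R.
    rewrite SE /pmom -sumrB; apply: le_trans (ler_norm_sum _ _ _) _.
    rewrite /A mulr_suml; apply: ler_sum => i _.
    rewrite -mulrBr normrM -mulrA ler_wpM2l// pmom_approx//.
    by apply: leq_trans pk; rewrite ltnW.
  by rewrite ler_norml => /andP[h _]; apply: le_trans h _; rewrite lerBlDr lerDl.
apply/ler_addgt0Pr => e e0.
pose k := maxn (size p) (Num.truncn (A / e)).+1.
have k0 : (0 < k)%N by rewrite leq_max orbT.
have := bnd k (leq_maxl _ _) k0.
suff : A / k%:R <= e by move=> h1 h2; lra.
rewrite ler_pdivrMr ?ltr0n// mulrC -ler_pdivrMr//.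
apply: ltW; apply: lt_le_trans (truncnS_gt _) _.
by rewrite ler_nat leq_maxr.
Qed.

Lemma pmom_le p q : (forall s, 0 <= s <= 1 -> p.[s] <= q.[s]) -> pmom p <= pmom q.
Proof.
move=> pq; rewrite -subr_ge0 -pmomB; apply: pmom_ge0 => s s01.
by rewrite !hornerE subr_ge0 pq.
Qed.

End MomentFunctional.

Section StepSums.
Variable R : realType.
Implicit Types (s t e : R).

Lemma expr_sub_le n (a b : R) : 0 <= b -> b <= a -> a <= 1 ->
  a ^+ n - b ^+ n <= n%:R * (a - b).
Proof.
move=> b0 ba a1; elim: n => [|n IH]; first by rewrite !expr0 subrr mul0r.
have a0 : 0 <= a by exact: le_trans ba.
have an : 0 <= a ^+ n <= 1 by rewrite exprn_ge0//= exprn_ile1.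
have bn : 0 <= b ^+ n <= 1.
  by rewrite exprn_ge0//= exprn_ile1// (le_trans ba).
have ab : 0 <= a ^+ n - b ^+ n by rewrite subr_ge0 lerXn2r.
rewrite !exprS -natr1.
have -> : a * a ^+ n - b * b ^+ n = (a - b) * a ^+ n + b * (a ^+ n - b ^+ n) by ring.
case/andP: an => an0 an1.
have h1 : (a - b) * a ^+ n <= a - b by rewrite ler_piMr// subr_ge0.
have h2 : b * (a ^+ n - b ^+ n) <= a ^+ n - b ^+ n.
  by rewrite ler_piMl// (le_trans ba).
by move: h1 h2 IH; set u := a ^+ n; set v := b ^+ n; lra.
Qed.

(** Increments over distance k telescope: only k terms at each end survive, and each difference is
    at most 1. *)
Lemma sum_shift_le (f : nat -> R) k r : (forall i, 0 <= f i <= 1) ->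
  \sum_(i < r) (f (i + k)%N - f i) <= k%:R.
Proof.
move=> f01.
have -> : \sum_(i < r) (f (i + k)%N - f i) = \sum_(j < k) (f (r + j)%N - f j).
  elim: r => [|r IH].
    by rewrite big_ord0 big1// => j _; rewrite add0n subrr.
  rewrite big_ord_recr /= IH.
  rewrite !sumrB addrAC; congr (_ - _).
  have h : \sum_(j < k.+1) f (r + j)%N = f r + \sum_(j < k) f (r + j.+1)%N.
    by rewrite big_ord_recl addn0.
  rewrite big_ord_recr /= in h.
  have -> : \sum_(i < k) f (r + i)%N = f r + \sum_(i < k) f (r.+1 + i)%N - f (r + k)%N.
    apply/eqP; rewrite eq_sym subr_eq h; apply/eqP; congr (_ + _).
    by apply: eq_bigr => j _; rewrite addSnnS.
  by ring.
rewrite -[leRHS]mulr1 mulr_natl -[X in _ *+ X]card_ord -sumr_const.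
apply: ler_sum => j _; have /andP[_ h1] := f01 (r + j)%N; have /andP[h2 _] := f01 j.
by lra.
Qed.

Variables (n r : nat).
Hypothesis n0 : (0 < n)%N.
Local Notation x i := ((i%:R / r.+1%:R) : R).

(** Increments of s^n along the grid i/(r+1): the weights that write s^n as a sum of step
    functions. *)
Definition powstep i : R := x i.+1 ^+ n - x i ^+ n.

Lemma powstep_ge0 i : 0 <= powstep i.
Proof.
rewrite subr_ge0 lerXn2r ?nnegrE ?divr_ge0//.
by rewrite ler_pM2r ?invr_gt0// ler_nat.
Qed.

Lemma sum_powstep k : \sum_(i < k) powstep i = x k ^+ n.
Proof.
elim: k => [|k IH]; first by rewrite big_ord0 mul0r expr0n eqn0Ngt n0.
by rewrite big_ord_recr /= IH /powstep addrC subrK.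
Qed.

Lemma powstep_le i : (i <= r)%N -> powstep i <= n%:R / r.+1%:R.
Proof.
move=> ir; apply: le_trans (expr_sub_le _ _ _ _) _.
- by rewrite divr_ge0.
- by rewrite ler_pM2r ?invr_gt0// ler_nat.
- by rewrite ler_pdivrMr// mul1r ler_nat.
- by rewrite -mulrBl -natrB// subSnn mul1r.
Qed.

(** Left end points count every increment up to and including the cell of s, so the telescoped sum
    reaches s^n. [steps_le_pow] uses right end points and stays below. *)
Lemma pow_le_steps s k : 0 <= s -> s <= x k ->
  s ^+ n <= \sum_(i < k) powstep i * (x i < s)%R%:R.
Proof.
move=> s0; elim: k => [|k IH] sk.
  rewrite mul0r in sk; rewrite big_ord0.
  have -> : s = 0 by apply/eqP; rewrite eq_le sk.
  by rewrite expr0n eqn0Ngt n0.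
have [sk'|ks] := leP s (x k).
  apply: le_trans (IH sk') _; rewrite big_ord_recr /= lerDl mulr_ge0//.
  exact: powstep_ge0.
rewrite (eq_bigr (fun i : 'I_k.+1 => powstep i)).
  by rewrite sum_powstep lerXn2r ?nnegrE// divr_ge0.
move=> i _; suff -> : x i < s by rewrite mulr1.
by apply: le_lt_trans ks; rewrite ler_pM2r ?invr_gt0// ler_nat -ltnS.
Qed.

Lemma steps_le_pow s k : 0 <= s ->
  \sum_(i < k) powstep i * (x i.+1 < s)%R%:R <= s ^+ n.
Proof.
move=> s0; elim: k => [|k IH]; first by rewrite big_ord0 exprn_ge0.
have [ks|sk] := ltP (x k.+1) s; last first.
  by rewrite big_ord_recr /= ltNge sk mulr0 addr0.
apply: (@le_trans _ _ (\sum_(i < k.+1) powstep i)).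
  by apply: ler_sum => i _; rewrite ler_piMr ?powstep_ge0//; case: (_ < _).
by rewrite sum_powstep lerXn2r ?nnegrE ?divr_ge0// ltW.
Qed.

End StepSums.

(** * An explicit distribution function computed from the moments *)

Section HausdorffCdf.
Variables (R : realType) (m : nat -> R).
Hypotheses (m0 : m 0%N = 1) (cm : forall n k, 0 <= cdiff 1 m n k).
Implicit Types (s t e : R) (N M l : nat).

(** Stand-in for the distribution function at t of the unknown measure. The degree is [N.+1] because
    Chebyshev's bound divides by it. *)
Definition stepmom N t : R := pmom m (qstep N.+1 t).
Definition cheberr N e : R := (N.+1%:R * e ^+ 2)^-1.

Lemma cheberr_ge0 N e : 0 <= cheberr N e.
Proof. by rewrite invr_ge0 mulr_ge0// sqr_ge0. Qed.

Lemma cheberr_lim e d : 0 < e -> 0 < d -> exists N, cheberr N e <= d.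
Proof.
move=> e0 d0; exists (Num.truncn (d * e ^+ 2)^-1).
have de : 0 < d * e ^+ 2 by rewrite mulr_gt0// exprn_gt0.
have e2 : 0 < e ^+ 2 by rewrite exprn_gt0.
rewrite /cheberr -[leRHS]invrK lef_pV2 ?posrE ?invr_gt0//; last first.
  by rewrite mulr_gt0.
have := truncnS_gt (d * e ^+ 2)^-1.
rewrite invfM -ltr_pdivlMr ?invr_gt0// invrK.
exact: ltW.
Qed.

Lemma stepmomE N t : stepmom N t =
  \sum_(j < N.+2 | j%:R <= N.+1%:R * t) pmom m (bern R N.+1 j).
Proof. by rewrite /stepmom /qstep pmom_sum. Qed.

Lemma stepmom_homo N t t' : t <= t' -> stepmom N t <= stepmom N t'.
Proof.
move=> tt'; rewrite !stepmomE [leLHS]big_mkcond [leRHS]big_mkcond /=.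
apply: ler_sum => j _; case: ifPn => [h|_].
  by rewrite (le_trans h)// ler_wpM2l.
by case: ifP => // _; exact: pmom_bern_ge0.
Qed.

Lemma stepmom_ge0 N t : 0 <= stepmom N t.
Proof. by rewrite stepmomE sumr_ge0// => j _; exact: pmom_bern_ge0. Qed.

Lemma stepmom_ge1 N t : 1 <= t -> stepmom N t = 1.
Proof.
move=> t1; rewrite stepmomE -[RHS](sum_pmom_bern m0 N.+1).
apply: eq_bigl => j.
have jN : (j%:R : R) <= N.+1%:R by rewrite ler_nat -ltnS.
by rewrite (le_trans jN)// ler_peMr.
Qed.

Lemma stepmom_lt0 N t : t < 0 -> stepmom N t = 0.
Proof.
move=> t0; rewrite stepmomE big1// => j h; exfalso; move: h; apply/negP.
rewrite -ltNge; apply: (@lt_le_trans _ _ 0) => //.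
by rewrite pmulr_rlt0.
Qed.

Lemma stepmom_le1 N t : stepmom N t <= 1.
Proof.
rewrite -(stepmom_ge1 N (lexx 1)).
have [t1|t1] := leP t 1; first exact: stepmom_homo.
by rewrite !stepmom_ge1// ltW.
Qed.

(** Compare the two step polynomials pointwise on [0, 1]: right of t + e the first is small, and
    elsewhere s + e' <= t', where the second is close to 1. The degrees N and M are unrelated, so no
    limit in N is needed. *)
Lemma stepmom_cmp N M t t' e e' : 0 < e -> 0 < e' -> t + e + e' <= t' ->
  stepmom N t <= stepmom M t' + (cheberr N e + cheberr M e').
Proof.
move=> e0 e0' tt'.
rewrite -[X in _ <= _ + X](pmomC m0) -pmomD; apply: (pmom_le m0 cm) => s s01.
rewrite hornerD hornerC.
have h1 := cheberr_ge0 N e; have h2 := cheberr_ge0 M e'.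
have h3 := qstep_ge0 M.+1 t' s01; have h4 := qstep_le1 N.+1 t s01.
have [ts|st] := leP (t + e) s.
  have h5 := @qstep_right _ N.+1 t e s isT e0 s01 ts.
  by rewrite -/(cheberr N e) in h5; lra.
have h5 := @qstep_left _ M.+1 t' e' s isT e0' s01 _.
rewrite -/(cheberr M e') in h5; have := h5 ltac:(lra); lra.
Qed.

(** One upper bound for the distribution function at t per code of a triple (N, l, q), where q is a
    rational lying more than 2/(l+1) beyond t and the error is Chebyshev's at gap 1/(l+1). Countably
    many bounds keep the infimum [mcdf] measurable in the moments; the default 1 and the cut at 1
    keep it in [0, 1]. *)
Definition cdfval t (k : nat) : R :=
  if unpickle k is Some (N, l, q) then
    if t + 2 * l.+1%:R^-1 < ratr q then
      Num.min 1 (stepmom N (ratr q) + cheberr N l.+1%:R^-1) else 1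
  else 1.

Definition mcdf t : R := inf (range (cdfval t)).

Lemma cdfval_ge0 t k : 0 <= cdfval t k.
Proof.
rewrite /cdfval; case: unpickle => // -[[N l] q]; case: ifP => // _.
by rewrite le_min ler01 addr_ge0 ?stepmom_ge0 ?cheberr_ge0.
Qed.

Lemma cdfval_le1 t k : cdfval t k <= 1.
Proof.
rewrite /cdfval; case: unpickle => // -[[N l] q]; case: ifP => // _.
by rewrite ge_min lexx.
Qed.

Lemma cdfval_homo t t' k : t <= t' -> cdfval t k <= cdfval t' k.
Proof.
move=> tt'; have := cdfval_le1 t k; rewrite /cdfval.
case: unpickle => // -[[N l] q] h.
have [h'|//] := ltP (t' + _); rewrite ifT//.
by apply: le_lt_trans h'; rewrite lerD2r.
Qed.

Lemma has_inf_cdfval t : has_inf (range (cdfval t)).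
Proof.
split; first by exists (cdfval t 0%N), 0%N.
by exists 0 => _ [k _ <-]; exact: cdfval_ge0.
Qed.

Lemma mcdf_le t k : mcdf t <= cdfval t k.
Proof. by apply: ge_inf; [case: (has_inf_cdfval t)|exists k]. Qed.

Lemma le_mcdf t a : (forall k, a <= cdfval t k) -> a <= mcdf t.
Proof.
by move=> h; apply: lb_le_inf; [case: (has_inf_cdfval t)|move=> _ [k _ <-]].
Qed.

Lemma mcdf_ge0 t : 0 <= mcdf t.
Proof. by apply: le_mcdf => k; exact: cdfval_ge0. Qed.

Lemma mcdf_homo : {homo mcdf : t t' / t <= t'}.
Proof.
move=> t t' tt'; apply: le_mcdf => k.
by apply: le_trans (mcdf_le t k) _; exact: cdfval_homo.
Qed.

Lemma mcdf_ge1 t : 1 <= t -> mcdf t = 1.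
Proof.
move=> t1; apply/eqP; rewrite eq_le (le_trans (mcdf_le t 0%N)) ?cdfval_le1//=.
apply: le_mcdf => k; rewrite /cdfval; case: unpickle => // -[[N l] q].
case: ltP => // h; rewrite le_min lexx /= stepmom_ge1 ?lerDl ?cheberr_ge0//.
apply: le_trans t1 _; apply: le_trans (ltW h); rewrite lerDl.
by rewrite mulr_ge0// invr_ge0.
Qed.

Lemma mcdf_le_stepmom N l t t' : t + 2 * l.+1%:R^-1 < t' ->
  mcdf t <= stepmom N t' + cheberr N l.+1%:R^-1.
Proof.
move=> tt'; have [q] := rat_in_itvoo tt'; rewrite in_itv /= => /andP[q1 q2].
apply: le_trans (mcdf_le t (pickle (N, l, q))) _.
rewrite /cdfval pickleK q1 ge_min; apply/orP; right.
by rewrite lerD2r stepmom_homo// ltW.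
Qed.

(** The half of the sandwich opposite to [mcdf_le_stepmom]: each bound entering [mcdf t] sits at
    some q far enough to the right of t - e for [stepmom_cmp]. *)
Lemma stepmom_le_mcdf N t e : 0 < e -> stepmom N (t - e) <= mcdf t + cheberr N e.
Proof.
move=> e0; rewrite -lerBlDr; apply: le_mcdf => k; rewrite lerBlDr /cdfval.
have h1 : stepmom N (t - e) <= 1 + cheberr N e.
  by rewrite (le_trans (stepmom_le1 _ _))// lerDl cheberr_ge0.
case: unpickle => // -[[M l] q]; case: ltP => // h.
rewrite minElt; case: ifP => // _.
rewrite -addrA [cheberr M _ + _]addrC; apply: stepmom_cmp => //.
have : (0 : R) < l.+1%:R^-1 by rewrite invr_gt0.
by move: h; move: (l.+1%:R^-1 : R) => a; lra.
Qed.

Lemma invS_lt d : 0 < d -> exists l : nat, (l.+1%:R^-1 : R) < d.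
Proof.
move=> d0; exists (Num.truncn d^-1).
by rewrite -[ltRHS]invrK ltf_pV2 ?posrE ?invr_gt0// truncnS_gt.
Qed.

Lemma mcdf_lt0 t : t < 0 -> mcdf t = 0.
Proof.
move=> t0; apply/eqP; rewrite eq_le mcdf_ge0 andbT.
apply/ler_addgt0Pr => e e0; rewrite add0r.
have [l hl] : exists l : nat, (l.+1%:R^-1 : R) < - t / 4.
  by apply: invS_lt; rewrite divr_gt0// oppr_gt0.
have [N hN] : exists N, cheberr N l.+1%:R^-1 <= e.
  by apply: cheberr_lim => //; rewrite invr_gt0.
have h0 : stepmom N (t / 4) = 0 by apply: stepmom_lt0; rewrite ltr_pdivrMr// mul0r.
apply: le_trans hN; rewrite -[leRHS]add0r -[X in X + _]h0.
apply: mcdf_le_stepmom; move: hl; move: (l.+1%:R^-1 : R) => a; lra.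
Qed.

(** The constraint t + 2/(l+1) < q is open in t, so a nearly optimal bound at t keeps its value
    slightly to the right, and the infimum cannot jump up. A code violating the constraint has value
    1, which is maximal. *)
Lemma mcdf_right_continuous : right_continuous mcdf.
Proof.
move=> t; apply/cvgrPdist_le => e e0.
have [k hk] : exists k, cdfval t k < mcdf t + e.
  have [_ [k _ <-] h] := inf_adherent e0 (has_inf_cdfval t).
  by exists k.
have [d d0 hd] : exists2 d, 0 < d & forall t', t' < t + d -> cdfval t' k <= cdfval t k.
  rewrite /cdfval in hk *; case: unpickle hk => [[[N l] q]|] hk; last by exists 1.
  case: (ltP (t + 2 * l.+1%:R^-1) (ratr q)) hk => h hk; last first.
    by exists 1 => // t' _; case: ifP => // _; rewrite ge_min lexx.
  exists (ratr q - (t + 2 * l.+1%:R^-1)); first by rewrite subr_gt0.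
  move=> t' ht'; rewrite ifT//.
  by move: ht'; move: (l.+1%:R^-1 : R) => a; lra.
near=> t'.
have tt' : t < t' by near: t'; exact: nbhs_right_gt.
have t'd : t' < t + d by near: t'; apply: nbhs_right_lt; rewrite ltrDl.
rewrite distrC ger0_norm ?subr_ge0 ?mcdf_homo ?(ltW tt')//.
rewrite lerBlDl; apply: le_trans (mcdf_le t' k) _.
by apply: le_trans (hd _ t'd) _; exact: ltW.
Unshelve. all: by end_near. Qed.

End HausdorffCdf.

Section ProbabilityOfCdf.
Variables (R : realType) (G : R -> R).
Hypotheses (G_homo : {homo G : t t' / t <= t'}) (G_rc : right_continuous G)
  (G_lt0 : forall t, t < 0 -> G t = 0) (G_ge1 : forall t, 1 <= t -> G t = 1).

Let G_Ny : G @ -oo --> (0 : R).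
Proof.
apply: cvg_near_cst; exists (-1); split; first by rewrite num_real.
by move=> x x1; apply: G_lt0; rewrite (lt_trans x1).
Qed.

Let G_y : G @ +oo --> (1 : R).
Proof.
apply: cvg_near_cst; exists 1; split; first by rewrite num_real.
by move=> x /ltW x1; exact: G_ge1.
Qed.

#[local] HB.instance Definition _ := isCumulative.Build R _ R G G_homo G_rc.
#[local] HB.instance Definition _ := isCumulativeBounded.Build R 0 1 G G_Ny G_y.

(** The Lebesgue-Stieltjes measure lives on [measurableTypeR R]; its image under this identity map
    is a probability on [R]. *)
Let idTR : measurableTypeR R -> R := idfun.

#[local] HB.instance Definition _ :=
  @isMeasurableFun.Build _ _ _ _ idTR (@measurable_id _ _ setT).

Lemma exists_probability_cdf :
  exists nu : probability R R, forall t, nu `]-oo, t]%classic = (G t)%:E.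
Proof.
pose P : probability (measurableTypeR R) R := lebesgue_stieltjes_measure G.
exists (distribution P (idTR : {RV P >-> R})) => t.
exact: (cdf_lebesgue_stieltjes_id G t).
Qed.

End ProbabilityOfCdf.

Lemma measurable_powabs (R : realType) n :
  measurable_fun setT (fun t : R => (`|t| ^+ n)%:E).
Proof.
by apply/measurable_EFinP; apply: measurable_funX; exact: normr_measurable.
Qed.

Section HausdorffMoments.
Variables (R : realType) (m : nat -> R).
Hypotheses (m0 : m 0%N = 1) (cm : forall n k, 0 <= cdiff 1 m n k).
Variable nu : probability R R.
Hypothesis nuE : forall t, nu `]-oo, t]%classic = (mcdf m t)%:E.
Implicit Types (s t e : R) (N M l : nat).

Lemma nu_gt t : nu `]t, +oo[%classic = (1 - mcdf m t)%:E.
Proof.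
rewrite EFinB -nuE -(probability_setC nu)//; congr (nu _).
by rewrite setCitvl.
Qed.

Lemma nu_itv01 : nu (~` `[0, 1]%classic) = 0%E.
Proof.
apply/eqP; rewrite eq_le measure_ge0 andbT.
have neg : nu `]-oo, 0[%classic = 0%E.
  have -> : `]-oo, (0 : R)[%classic = \bigcup_n `]-oo, - n.+1%:R^-1]%classic.
    apply/seteqP; split => x /=.
      rewrite in_itv /= => x0.
      have [l hl] : exists l : nat, (l.+1%:R^-1 : R) < - x by apply: invS_lt; rewrite oppr_gt0.
      by exists l => //=; rewrite in_itv /= lerNr ltW.
    move=> [l _] /=; rewrite !in_itv /= => /le_lt_trans; apply.
    by rewrite oppr_lt0 invr_gt0.
  apply/eqP; rewrite eq_le measure_ge0 andbT.
  apply: le_trans (measure_sigma_subadditive _ _ _ (@subset_refl _ _)) _ => //.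
    exact: bigcupT_measurable.
  rewrite eseries0// => n _ _ /=; rewrite nuE; congr EFin.
  by apply: (mcdf_lt0 cm); rewrite oppr_lt0 invr_gt0.
have gt1 : nu `]1, +oo[%classic = 0%E by rewrite nu_gt (mcdf_ge1 m0 cm)// subrr.
rewrite setCitv /=; apply: le_trans (measureU2 _ _ _) _ => //.
by rewrite [X in (X + _)%E]neg [X in (_ + X)%E]gt1 adde0.
Qed.

Section Steps.
Variables (n r N : nat).
Hypothesis n0 : (0 < n)%N.
Local Notation x i := ((i%:R / r.+1%:R) : R).
Local Notation c i := (powstep R n r i).
Local Notation err := (cheberr N (r.+1%:R^-1 : R)).

(** The lag of one cell is the gap 1/(r+1) that [stepmom_le_mcdf] costs. *)
Let f (i : nat) : R := stepmom m N ((i%:R - 1) / r.+1%:R).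

Let Nr0 : (0 : R) < r.+1%:R^-1. Proof. by rewrite invr_gt0. Qed.

Let sumc : \sum_(i < r.+1) c i = 1.
Proof. by rewrite sum_powstep// divff ?expr1n. Qed.

Let sumc_le (a b : nat -> R) e :
  (forall i, (i < r.+1)%N -> a i <= b i + e) ->
  \sum_(i < r.+1) c i * a i <= \sum_(i < r.+1) c i * b i + e.
Proof.
move=> ab; rewrite -[X in _ + X]mul1r -sumc mulr_suml -big_split /=.
apply: ler_sum => i _; rewrite -mulrDr ler_wpM2l ?powstep_ge0//.
exact: ab.
Qed.

Let stepfun (b : nat) (t : R) : R := \sum_(i < r.+1) c i * (x (i + b)%N < t)%R%:R.

Let measurable_stepfun b : measurable_fun setT (fun t => (stepfun b t)%:E).
Proof.
apply/measurable_EFinP; apply: measurable_sum => i; apply: measurable_funM => //.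
rewrite (_ : (fun t => _) = \1_(`]x (i + b)%N, +oo[%classic)) //.
apply/funext => t; rewrite indicE; congr (_%:R); congr nat_of_bool.
by apply/idP/idP; rewrite inE/= in_itv /= andbT.
Qed.

Let stepfun_ge0 b t : 0 <= stepfun b t.
Proof. by apply: sumr_ge0 => i _; rewrite mulr_ge0// powstep_ge0. Qed.

Let integral_stepfun b :
  (\int[nu]_t (stepfun b t)%:E = (\sum_(i < r.+1) c i * (1 - mcdf m (x (i + b)%N)))%:E)%E.
Proof.
rewrite /stepfun.
under eq_integral do rewrite -sumEFin.
have mi t : measurable_fun setT (fun s : R => ((t < s)%R%:R : R)).
  rewrite (_ : (fun s => _) = \1_(`]t, +oo[%classic)) //.
  apply/funext => s; rewrite indicE; congr (_%:R); congr nat_of_bool.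
  by apply/idP/idP; rewrite inE/= in_itv /= andbT.
rewrite ge0_integral_sum//; last 2 first.
- by move=> i; apply/measurable_EFinP; apply: measurable_funM.
- by move=> i t _; rewrite lee_fin mulr_ge0// powstep_ge0.
rewrite -sumEFin; apply: eq_bigr => i _.
under eq_integral do rewrite EFinM.
rewrite ge0_integralZl//; last 2 first.
- exact/measurable_EFinP.
- by rewrite lee_fin powstep_ge0.
rewrite EFinM -nu_gt; congr (_ * _)%E.
transitivity (\int[nu]_t (\1_(`]x (i + b)%N, +oo[%classic) t : R)%:E)%E; last first.
  by rewrite integral_indic// setIT.
apply: eq_integral => t _.
rewrite indicE; congr ((_%:R)%:E); congr nat_of_bool.
by apply/idP/idP; rewrite inE/= in_itv /= andbT.
Qed.

(** Sums of increments of s^n against tails 1 - f, meant to bracket the n-th moment. The shift 5 is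
    the least that works: at the grid point i + 1, [mcdf_le_stepmom] needs an argument strictly
    beyond the grid point i + 3, and f lags by one cell. Since the weights are at most n/(r+1), W
    exceeds V by at most 5n/(r+1). *)
Let W := \sum_(i < r.+1) c i * (1 - f i).
Let V := \sum_(i < r.+1) c i * (1 - f (i + 5)%N).

Let WV : W - V <= 5 * (n%:R / r.+1%:R).
Proof.
rewrite /W /V -sumrB.
apply: (@le_trans _ _ (\sum_(i < r.+1) (n%:R / r.+1%:R) * (f (i + 5)%N - f i))).
  apply: ler_sum => i _; rewrite -mulrBr.
  have -> : 1 - f i - (1 - f (i + 5)%N) = f (i + 5)%N - f i by ring.
  apply: ler_wpM2r; last by rewrite powstep_le// -ltnS.
  rewrite subr_ge0; apply: stepmom_homo => //.
  by rewrite ler_pM2r// lerD2r ler_nat leq_addr.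
rewrite -mulr_sumr mulrC ler_wpM2r ?divr_ge0//.
apply: sum_shift_le => i; apply/andP; split; first exact: stepmom_ge0.
exact: stepmom_le1.
Qed.

Let integral_up : (\int[nu]_t (`|t| ^+ n)%:E <= (W + err)%:E)%E.
Proof.
apply: (@le_trans _ _ (\int[nu]_t (stepfun 0 t)%:E)%E).
  apply: ae_ge0_le_integral => //.
  - exact: measurable_powabs.
  - by move=> t _; rewrite lee_fin; exact: stepfun_ge0.
  exists (~` `[0, 1]%classic); split; [exact: measurableC|exact: nu_itv01|].
  move=> t /=; apply: contra_not; rewrite in_itv /= => /andP[t0 t1] _.
  rewrite lee_fin ger0_norm// /stepfun.
  under eq_bigr => i _ do rewrite addn0.
  by have := @pow_le_steps R n r n0 t r.+1 t0; rewrite divff// => /(_ t1).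
rewrite integral_stepfun lee_fin; apply: (sumc_le (a := fun i => 1 - mcdf m (x (i + 0)%N)) (b := fun i => 1 - f i)) => i _.
have := stepmom_le_mcdf m0 cm N (x i) Nr0.
have -> : x i - r.+1%:R^-1 = (i%:R - 1) / r.+1%:R by rewrite mulrBl mul1r.
by rewrite addn0 -/(f i); lra.
Qed.

Let integral_dn : ((V - err)%:E <= \int[nu]_t (`|t| ^+ n)%:E)%E.
Proof.
apply: (@le_trans _ _ (\int[nu]_t (stepfun 1 t)%:E)%E).
  rewrite integral_stepfun lee_fin lerBlDr.
  apply: (sumc_le (a := fun i => 1 - f (i + 5)%N) (b := fun i => 1 - mcdf m (x (i + 1)%N))) => i _.
  have : mcdf m (x (i + 1)%N) <= stepmom m N (((i + 5)%:R - 1) / r.+1%:R) + err.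
    apply: mcdf_le_stepmom => //; rewrite -mulrDl ltr_pM2r//.
    by rewrite !natrD; lra.
  by rewrite -/(f _); lra.
apply: ge0_le_integral => //.
- by move=> t _; rewrite lee_fin; exact: stepfun_ge0.
- exact: measurable_powabs.
- move=> t _; rewrite lee_fin /stepfun.
  have [t0|t0] := leP 0 t.
    under eq_bigr => i _ do rewrite addn1.
    by rewrite ger0_norm//; exact: steps_le_pow.
  rewrite big1 ?exprn_ge0// => i _.
  rewrite ltNge (le_trans (ltW t0)) ?mulr0// divr_ge0//.
Qed.

Let mom_up : m n <= W + err.
Proof.
rewrite -(pmomXn m n).
apply: (@le_trans _ _ (pmom m (\sum_(i < r.+1) c i *: (1 - qstep N.+1 ((i%:R - 1) / r.+1%:R)) + err%:P))).
  apply: (pmom_le m0 cm) => s s01; rewrite !hornerE horner_sum.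
  case/andP: (s01) => s0 s1.
  have := @pow_le_steps R n r n0 s r.+1 s0; rewrite divff// => /(_ s1).
  move=> /le_trans; apply.
  under [X in _ <= X + _]eq_bigr do rewrite !hornerE.
  apply: (sumc_le (a := fun i => (x i < s)%R%:R) (b := fun i => 1 - (qstep N.+1 ((i%:R - 1) / r.+1%:R)).[s])) => i _.
  have h1 := qstep_le1 N.+1 ((i%:R - 1) / r.+1%:R) s01.
  have h2 : 0 <= err by exact: cheberr_ge0.
  case: ltP => h /=; last by move: h1 h2; set u := (qstep _ _).[_]; lra.
  have := @qstep_right _ N.+1 ((i%:R - 1) / r.+1%:R) _ s isT Nr0 s01.
  rewrite -/err => h3; have := h3 _; set u := (qstep _ _).[_] => h4.
  have := h4 ltac:(by rewrite -[X in _ + X <= _]mul1r -mulrDl subrK; exact: ltW); lra.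
rewrite pmomD pmomC// pmom_sum; apply: lerD => //.
apply: ler_sum => i _; rewrite pmomZ pmomB pmom1//.
Qed.

Let mom_dn : V - err <= m n.
Proof.
rewrite -(pmomXn m n) lerBlDr -(pmomC m0 err) -pmomD.
apply: (@le_trans _ _ (pmom m (\sum_(i < r.+1) c i *: (1 - qstep N.+1 (((i + 5)%:R - 1) / r.+1%:R))))).
  rewrite pmom_sum; apply: ler_sum => i _; rewrite pmomZ pmomB pmom1//.
apply: (pmom_le m0 cm) => s s01; rewrite !hornerE horner_sum.
case/andP: (s01) => s0 s1.
under eq_bigr do rewrite !hornerE.
apply: (@le_trans _ _ (\sum_(i < r.+1) c i * (x i.+1 < s)%R%:R + err)).
  apply: (sumc_le (b := fun i => (x i.+1 < s)%R%:R) (a := fun i => 1 - (qstep N.+1 (((i + 5)%:R - 1) / r.+1%:R)).[s])) => i _.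
  have h1 := qstep_ge0 N.+1 (((i + 5)%:R - 1) / r.+1%:R) s01.
  have h2 : 0 <= err by exact: cheberr_ge0.
  case: ltP => h /=; first by move: h1 h2; set u := (qstep _ _).[_]; lra.
  have := @qstep_left _ N.+1 (((i + 5)%:R - 1) / r.+1%:R) _ s isT Nr0 s01.
  rewrite -/err => h3; have := h3 _; set u := (qstep _ _).[_] => h4.
  have := h4 _; rewrite add0r; apply.
  apply: (@le_trans _ _ (x i.+1 + r.+1%:R^-1)); first by rewrite lerD2r.
  rewrite -[X in _ + X]mul1r -mulrDl ler_pM2r//.
  by rewrite natrD -natr1; lra.
by rewrite lerD2r steps_le_pow.
Qed.

(** Both the integral and m n lie between V - err and W + err. *)
Lemma integral_pow_approx :
  (\int[nu]_t (`|t| ^+ n)%:E <= (m n + (5 * (n%:R / r.+1%:R) + 2 * err))%:E)%E /\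
  ((m n - (5 * (n%:R / r.+1%:R) + 2 * err))%:E <= \int[nu]_t (`|t| ^+ n)%:E)%E.
Proof.
split; [apply: le_trans integral_up _|apply: le_trans _ integral_dn].
all: rewrite lee_fin; move: WV mom_up mom_dn.
all: by move: W V (n%:R / r.+1%:R : R) err => w v a e; lra.
Qed.

End Steps.

Lemma hausdorff_moments n : (\int[nu]_t (`|t| ^+ n)%:E = (m n)%:E)%E.
Proof.
have [->|n0] := posnP n.
  under eq_integral do rewrite expr0.
  by rewrite integral_cst//= mul1e m0 [LHS]probability_setT.
(* r comes before N, because the Chebyshev error is small only once its gap 1/(r+1) is fixed. The
   shares are 5 e/10 + 2 e/4 = e. *)
have ex e : 0 < e -> exists r N, 5 * (n%:R / r.+1%:R) + 2 * cheberr N (r.+1%:R^-1 : R) <= e.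
  move=> e0; have n0' : (0 : R) < n%:R by rewrite ltr0n.
  have [r hr] : exists r : nat, (r.+1%:R^-1 : R) < e / (10 * n%:R).
    by apply: invS_lt; rewrite divr_gt0// mulr_gt0.
  have [N hN] : exists N, cheberr N (r.+1%:R^-1 : R) <= e / 4.
    by apply: cheberr_lim; rewrite ?invr_gt0// divr_gt0.
  exists r, N.
  have : n%:R / r.+1%:R <= e / 10.
    rewrite mulrC -ler_pdivlMr//; apply: le_trans (ltW hr) _.
    by rewrite invfM mulrA.
  by move: hN; set a := cheberr _ _; set b := _ / r.+1%:R; lra.
apply/eqP; rewrite eq_le; apply/andP; split; apply/lee_addgt0Pr => e e0.
  have [r [N h]] := ex _ e0.
  apply: le_trans (integral_pow_approx r N n0).1 _.
  by rewrite -EFinD lee_fin lerD2l.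
have [r [N h]] := ex _ e0.
rewrite -leeBlDr//; apply: le_trans _ (integral_pow_approx r N n0).2.
by rewrite -EFinB lee_fin lerD2l lerN2.
Qed.

End HausdorffMoments.

Lemma integral_conull d (T : measurableType d) (R : realType)
    (nu : {measure set T -> \bar R}) (D : set T) (f : T -> \bar R) :
  measurable D -> nu (~` D) = 0%E -> measurable_fun setT f ->
  (forall x, 0 <= f x)%E ->
  (\int[nu]_x f x = \int[nu]_(x in D) f x)%E.
Proof.
move=> mD nD mf f0; rewrite [RHS]integral_mkcond.
apply: ge0_ae_eq_integral => //.
- by apply/(measurable_restrictT f mD); exact: measurable_funTS.
- by move=> x _; rewrite patchE; case: ifP.
exists (~` D); split => //; first exact: measurableC.
by move=> x /=; apply: contra_not => Dx _; rewrite patchE mem_set.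
Qed.

(** * A finite measure on a compact interval is determined by its moments *)

Section MomentUniqueness.
Variables (R : realType) (c : R).
Hypothesis c0 : 0 < c.

Local Notation D := (`[0, c]%classic : set R).

Let D01 t : D t -> 0 <= `|t| / c <= 1.
Proof.
rewrite /= in_itv /= => /andP[t0 tc]; rewrite ger0_norm// divr_ge0//=; last exact: ltW.
by rewrite ler_pdivrMr// mul1r.
Qed.

Let measurable_hornerabs (p : {poly R}) :
  measurable_fun setT (fun t : R => (p.[`|t| / c])%:E).
Proof.
apply/measurable_EFinP; under eq_fun do rewrite horner_coef.
apply: measurable_sum => i; apply: measurable_funM => //; apply: measurable_funX.
by apply: measurable_funM => //; exact: normr_measurable.
Qed.

Let integrable_powabs (nu : {measure set R -> \bar R}) n : (nu setT < +oo)%E ->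
  nu.-integrable D (fun t : R => (`|t| ^+ n)%:E).
Proof.
move=> nuoo; apply/integrableP; split.
  by apply: measurable_funTS; exact: measurable_powabs.
under eq_integral do rewrite gee0_abs ?lee_fin ?exprn_ge0//.
apply: (@le_lt_trans _ _ (\int[nu]_(t in D) (c ^+ n)%:E)%E).
  apply: ge0_le_integral => //.
  - exact: measurable_funTS (@measurable_powabs R n).
  - move=> t Dt; rewrite lee_fin lerXn2r ?nnegrE//; first exact: ltW.
    by have := D01 Dt => /andP[_]; rewrite ler_pdivrMr// mul1r.
rewrite integral_cst//= lte_mul_pinfty// ?lee_fin ?exprn_ge0 ?ltW//.
by apply: le_lt_trans nuoo; apply: le_measure; rewrite ?inE.
Qed.

Let integral_hornerabs (nu : {measure set R -> \bar R}) (p : {poly R}) :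
  (nu setT < +oo)%E ->
  (\int[nu]_(t in D) (p.[`|t| / c])%:E =
   \sum_(i < size p) (p`_i / c ^+ i)%:E * \int[nu]_(t in D) (`|t| ^+ i)%:E)%E.
Proof.
move=> nuoo.
transitivity (\int[nu]_(t in D)
    (\sum_(i < size p) (p`_i / c ^+ i)%:E * (`|t| ^+ i)%:E))%E.
  apply: eq_integral => t _; rewrite horner_coef -sumEFin; apply: eq_bigr => i _.
  by rewrite -EFinM; congr EFin; rewrite expr_div_n mulrA mulrAC.
rewrite integral_sum//; last first.
  by move=> i; apply: integrableZl => //; exact: integrable_powabs.
by apply: eq_bigr => i _; rewrite integralZl//; exact: integrable_powabs.
Qed.

(** After rescaling to [0, 1], a step polynomial lies between the indicators of ]-oo, a] and ]-oo, a
    + d] up to a small error, and both measures integrate it to the same value. First the degree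
    tends to infinity, then d to 0 by continuity from above. *)
Let cdf_le (nu1 nu2 : {measure set R -> \bar R}) (a : R) :
  (nu1 setT < +oo)%E -> (nu2 setT < +oo)%E ->
  nu1 (~` D) = 0%E -> nu2 (~` D) = 0%E ->
  (forall n, \int[nu1]_t (`|t| ^+ n)%:E = \int[nu2]_t (`|t| ^+ n)%:E)%E ->
  (nu1 `]-oo, a]%classic <= nu2 `]-oo, a]%classic)%E.
Proof.
move=> f1 f2 n1 n2 mE.
have mED n : (\int[nu1]_(t in D) (`|t| ^+ n)%:E = \int[nu2]_(t in D) (`|t| ^+ n)%:E)%E.
  have cn (nu : {measure set R -> \bar R}) : nu (~` D) = 0%E ->
      (\int[nu]_t (`|t| ^+ n)%:E = \int[nu]_(t in D) (`|t| ^+ n)%:E)%E.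
    move=> nD; apply: integral_conull => //; exact: measurable_powabs.
  by rewrite -!cn.
have pE p : (\int[nu1]_(t in D) (p.[`|t| / c])%:E = \int[nu2]_(t in D) (p.[`|t| / c])%:E)%E.
  by rewrite !integral_hornerabs//; apply: eq_bigr => i _; rewrite mED.
have ID (nu : {measure set R -> \bar R}) (A : set R) : measurable A ->
    nu (~` D) = 0%E -> (nu A = \int[nu]_(t in D) (\1_A t)%:E)%E.
  move=> mA nD; rewrite -integral_conull//.
    by rewrite integral_indic// setIT.
  by apply/measurable_EFinP; exact: measurable_indic.
have mind (A : set R) (b : R) : measurable A -> measurable_fun D (fun t => (\1_A t + b)%:E).
  move=> mA; apply: measurable_funTS; apply/measurable_EFinP.
  by apply: measurable_funD => //; exact: measurable_indic.
have mhor (p : {poly R}) (b : R) : measurable_fun D (fun t : R => (p.[`|t| / c] + b)%:E).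
  apply: measurable_funTS; apply/measurable_EFinP; apply: measurable_funD => //.
  by have /measurable_EFinP := measurable_hornerabs p.
have IDD (nu : {measure set R -> \bar R}) (f : R -> R) (b : R) : 0 <= b ->
    (forall t, D t -> 0 <= f t) -> measurable_fun D (fun t => (f t)%:E) ->
    (\int[nu]_(t in D) (f t + b)%:E = \int[nu]_(t in D) (f t)%:E + b%:E * nu D)%E.
  move=> b0 ff mf; under eq_integral do rewrite EFinD.
  by rewrite ge0_integralD//= integral_cst.
have key l N : (nu1 `]-oo, a]%classic <= nu2 `]-oo, (a + l.+1%:R^-1)%R]%classic +
    (cheberr N (l.+1%:R^-1 / (2 * c))%R)%:E * (nu1 D + nu2 D))%E.
  (* The step is centred at a/c + e, midway between a/c and (a + d)/c, leaving the gap e on either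
     side. *)
  set d := l.+1%:R^-1; set e := d / (2 * c); set er := cheberr N e.
  have d0 : 0 < d by rewrite invr_gt0.
  have e0 : 0 < e by rewrite divr_gt0// mulr_gt0.
  have er0 : 0 <= er by exact: cheberr_ge0.
  pose q := qstep N.+1 (a / c + e).
  have q0 t : D t -> 0 <= q.[`|t| / c] by move=> /D01; exact: qstep_ge0.
  have lo t : D t -> \1_`]-oo, a] t <= q.[`|t| / c] + er.
    move=> Dt; have t01 := D01 Dt.
    rewrite indicE; case: (boolP (t \in _)); last by rewrite addr_ge0// q0.
    rewrite inE /= in_itv /= => ta.
    have := @qstep_left _ N.+1 (a / c + e) e (`|t| / c) isT e0 t01.
    rewrite -/er -/q => h; have := h _; set u := q.[_] => {}h.
    suff : 1 - u <= er by lra.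
    apply: h; rewrite lerD2r ler_pM2r ?invr_gt0//.
    by move: Dt; rewrite /= in_itv /= => /andP[t0 _]; rewrite ger0_norm.
  have hi t : D t -> q.[`|t| / c] <= \1_`]-oo, (a + d)] t + er.
    move=> Dt; have t01 := D01 Dt.
    rewrite indicE; case: (boolP (t \in _)).
      by move=> _; rewrite (le_trans (qstep_le1 _ _ t01))// lerDl.
    rewrite notin_setE /= in_itv /= => /negP; rewrite -ltNge => ta.
    rewrite add0r; apply: qstep_right => //.
    have -> : a / c + e + e = (a + d) / c.
      by rewrite /e; field; rewrite gt_eqF.
    rewrite ler_pM2r ?invr_gt0//.
    move: Dt; rewrite /= in_itv /= => /andP[t0 _]; rewrite ger0_norm//.
    exact: ltW.
  rewrite (ID nu1)//.
  apply: (@le_trans _ _ (\int[nu1]_(t in D) (q.[`|t| / c] + er)%:E)%E).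
    apply: ge0_le_integral => //.
    by apply: measurable_funTS; apply/measurable_EFinP; exact: measurable_indic.
  rewrite IDD//; last by apply: measurable_funTS; exact: measurable_hornerabs.
  rewrite pE.
  have : (\int[nu2]_(t in D) (q.[`|t| / c])%:E <=
    nu2 `]-oo, (a + d)%R]%classic + er%:E * nu2 D)%E.
    rewrite (ID nu2)// -IDD//; last first.
      apply: measurable_funTS; apply/measurable_EFinP; exact: measurable_indic.
    apply: ge0_le_integral => //.
    - by apply: measurable_funTS; exact: measurable_hornerabs.
    - exact: mind.
  move=> h; apply: le_trans (leeD h (lexx _)) _.
  by rewrite -addeA -ge0_muleDr// [(nu2 D + _)%E]addeC.
have fD (nu : {measure set R -> \bar R}) A : (nu setT < +oo)%E -> measurable A -> nu A \is a fin_num.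
  move=> nuoo mA; rewrite ge0_fin_numE//; apply: le_lt_trans nuoo.
  by apply: le_measure; rewrite ?inE.
have key2 l : (nu1 `]-oo, a]%classic <= nu2 `]-oo, (a + l.+1%:R^-1)%R]%classic)%E.
  apply/lee_addgt0Pr => e e0.
  have dc : 0 < l.+1%:R^-1 / (2 * c) by rewrite divr_gt0// mulr_gt0.
  pose V := fine (nu1 D + nu2 D)%E.
  have V0 : 0 <= V by apply: fine_ge0; rewrite adde_ge0.
  have [N hN] : exists N, cheberr N (l.+1%:R^-1 / (2 * c)) <= e / (V + 1).
    by apply: cheberr_lim => //; rewrite divr_gt0// ltr_wpDl.
  apply: le_trans (key l N) _; rewrite leeD2l//.
  have -> : (nu1 D + nu2 D)%E = V%:E by rewrite fineK// fin_numD !fD.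
  rewrite -EFinM lee_fin; apply: le_trans (ler_wpM2r V0 hN) _.
  by rewrite mulrAC ler_pdivrMr ?ltr_wpDl// ler_wpM2l ?(ltW e0)// lerDl.
have cv : (nu2 \o (fun l => `]-oo, (a + l.+1%:R^-1)%R]%classic)) l @[l --> \oo] -->
    nu2 (\bigcap_l `]-oo, (a + l.+1%:R^-1)%R]%classic).
  apply: nonincreasing_cvg_mu => //.
  - by rewrite ltey_eq fD.
  - exact: bigcapT_measurable.
  - move=> i j ij; apply/subsetPset => x /=; rewrite !in_itv /= => /le_trans; apply.
    by rewrite lerD2l lef_pV2 ?posrE// ler_nat.
have E : \bigcap_l `]-oo, (a + l.+1%:R^-1)%R]%classic = `]-oo, a]%classic.
  apply/seteqP; split => x /=; last first.
    rewrite in_itv /= => xa l _ /=; rewrite in_itv /= (le_trans xa)// lerDl.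
    by rewrite invr_ge0.
  move=> h; rewrite in_itv /=; apply/ler_addgt0Pr => e /invS_lt[l hl].
  have := h l I; rewrite /= in_itv /= => /le_trans; apply.
  by rewrite lerD2l ltW.
rewrite E in cv.
rewrite -(cvg_lim _ cv)//; apply: lime_ge; first by apply/cvg_ex; eexists; exact: cv.
by near=> l; exact: key2.
Unshelve. all: by end_near. Qed.

Lemma moments_unique (nu1 nu2 : {measure set R -> \bar R}) :
  (nu1 setT < +oo)%E -> (nu2 setT < +oo)%E ->
  nu1 (~` D) = 0%E -> nu2 (~` D) = 0%E ->
  (forall n, \int[nu1]_t (`|t| ^+ n)%:E = \int[nu2]_t (`|t| ^+ n)%:E)%E ->
  forall A, measurable A -> nu1 A = nu2 A.
Proof.
move=> f1 f2 n1 n2 mE.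
have E a : nu1 `]-oo, a]%classic = nu2 `]-oo, a]%classic.
  by apply/eqP; rewrite eq_le !cdf_le.
have fA (nu : {measure set R -> \bar R}) A : (nu setT < +oo)%E -> measurable A -> (nu A < +oo)%E.
  by move=> nuoo mA; apply: le_lt_trans nuoo; apply: le_measure; rewrite ?inE.
apply: (@measure_unique _ _ _ (@ocitv R) (fun n : nat => `](- n%:R), n%:R]%classic)) => //.
- exact: ocitvI.
- by move=> n; exact: is_ocitv.
- exact: (bigcup_itvT false false).
- move=> A /ocitvP[->|[[a b] /= ab ->]]; first by rewrite !measure0.
  have -> : `]a, b]%classic = `]-oo, b]%classic `\` `]-oo, a]%classic.
    by rewrite setDE setCitvl; apply/seteqP; split => x /=; rewrite !in_itv /= ?andbT;
      [move=> /andP[-> ->]|move=> [-> ->]].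
  have sub : `]-oo, b]%classic `&` `]-oo, a]%classic = `]-oo, a]%classic.
    apply/setIidr => x /=; rewrite !in_itv /= => /le_trans; apply; exact: ltW.
  have diff (nu : {measure set R -> \bar R}) : (nu setT < +oo)%E ->
      (nu (`]-oo, b]%classic `\` `]-oo, a]%classic) =
       nu `]-oo, b]%classic - nu `]-oo, a]%classic)%E.
    move=> nuoo; rewrite measureD; [by rewrite sub|by []|by []|exact: fA].
  by rewrite (diff _ f1) (diff _ f2) !E.
- by move=> n; exact: fA.
Qed.

End MomentUniqueness.

Section KernelOfProbabilities.
Context d d' (X : measurableType d) (Y : measurableType d') (R : realType).
Variable f : X -> probability Y R.
Hypothesis mf : forall U, measurable U -> measurable_fun setT (fun x => f x U).

Let g (x : X) : {measure set Y -> \bar R} := f x.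

#[local] HB.instance Definition _ := isKernel.Build _ _ X Y R g mf.

Let g_prob x : g x setT = 1%E.
Proof. exact: probability_setT. Qed.

#[local] HB.instance Definition _ := Kernel_isProbability.Build _ _ X Y R g g_prob.

Lemma exists_pker : exists P : R.-pker X ~> Y, forall x, P x = g x.
Proof. by exists g. Qed.

End KernelOfProbabilities.

(** * Solving the moment problem measurably in a parameter *)

Section HausdorffKernel.
Context d (X : measurableType d) (R : realType).
Variable M : X -> nat -> R.
Hypotheses (mM : forall n, measurable_fun setT (fun x => M x n))
  (M0 : forall x, M x 0%N = 1)
  (cM : forall x n k, 0 <= cdiff 1 (M x) n k).

Let measurable_pmom p : measurable_fun setT (fun x => pmom (M x) p).
Proof. by apply: measurable_sum => i; apply: measurable_funM. Qed.

Let measurable_cdfval t k : measurable_fun setT (fun x => cdfval (M x) t k).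
Proof.
rewrite /cdfval; case: (unpickle k : option (nat * nat * rat)) => [[[N l] q]|//]; case: (t + 2 * l.+1%:R^-1 < ratr q) => //.
apply: measurable_minr => //; apply: measurable_funD => //.
exact: measurable_pmom.
Qed.

Let measurable_mcdf t : measurable_fun setT (fun x => mcdf (M x) t).
Proof.
have -> : (fun x => mcdf (M x) t) =
    (fun x => infs ((fun k x => cdfval (M x) t k) ^~ x) 0%N).
  apply/funext => x; rewrite /mcdf /infs /=; congr inf.
  by apply/seteqP; split => [_ [k _ <-]|_ [k _ <-]]; exists k.
apply: measurable_fun_infs => //.
by move=> x _; exists 0 => _ [k _ <-]; exact: cdfval_ge0.
Qed.

(** [mcdf (M x) t] is measurable in x as an infimum of a sequence, which gives measurability on
    half-open intervals; Dynkin's lemma extends it to Borel sets. *)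
Lemma hausdorff_kernel (c : R) : 0 < c -> exists P : R.-pker X ~> R,
  forall x, P x (~` `[0, c]%classic) = 0%E /\
    forall n, (\int[P x]_t (`|t| ^+ n)%:E = (c ^+ n * M x n)%:E)%E.
Proof.
move=> c0.
have /choice [f hf] : forall x, exists nu : probability R R,
    forall t, nu `]-oo, t]%classic = (mcdf (M x) t)%:E.
  move=> x; apply: exists_probability_cdf.
  - exact: mcdf_homo.
  - exact: mcdf_right_continuous.
  - exact: mcdf_lt0.
  - exact: mcdf_ge1.
have ff x U : measurable U -> f x U \is a fin_num by exact: fin_num_measure.
have mf U : measurable U -> measurable_fun setT (fun x => f x U).
  move=> mU.
  pose H := [set U : set R | measurable U /\ measurable_fun setT (fun x => f x U)].
  suff [] : H U by [].
  have lsH : lambda_system setT H.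
    split.
    - by [].
    - split => //; rewrite (_ : (fun x => _) = cst 1%E)//.
      by apply/funext => x; exact: probability_setT.
    - move=> A B BA [mA hA] [mB hB]; split; first exact: measurableD.
      have -> : (fun x => f x (A `\` B)) = (fun x => f x A - f x B)%E.
        apply/funext => x; rewrite measureD//; last by rewrite ltey_eq ff.
        by rewrite setIidr.
      exact: emeasurable_funB.
    - move=> F ndF hF; split; first by apply: bigcupT_measurable => n; exact: (hF n).1.
      apply: (emeasurable_fun_cvg (fun n x => f x (F n))) => [n|x _].
        exact: (hF n).2.
      apply: nondecreasing_cvg_mu => //; first by move=> n; exact: (hF n).1.
      by apply: bigcupT_measurable => n; exact: (hF n).1.
  apply: (lambda_system_subset (@ocitvI R) lsH) => //.
  move=> A /ocitvP[->|[[a b] /= ab ->]].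
    split => //; rewrite (_ : (fun x => _) = cst 0%E)//.
    by apply/funext => x; exact: measure0.
  split => //.
  have -> : (fun x => f x `]a, b]%classic) = (fun x => (mcdf (M x) b - mcdf (M x) a)%:E).
    apply/funext => x.
    have -> : `]a, b]%classic = `]-oo, b]%classic `\` `]-oo, a]%classic.
      by rewrite setDE setCitvl; apply/seteqP; split => y /=; rewrite !in_itv /= ?andbT;
        [move=> /andP[-> ->]|move=> [-> ->]].
    rewrite measureD//; last by rewrite ltey_eq ff.
    rewrite (_ : _ `&` _ = `]-oo, a]%classic).
      by rewrite [X in (X - _)%E]hf [X in (_ - X)%E]hf.
    by apply/setIidr => y /=; rewrite !in_itv /= => /le_trans; apply; exact: ltW.
  by apply/measurable_EFinP; apply: measurable_funB.
(* The image under t |-> c t carries [0, 1] to [0, c] and multiplies the n-th moment by c^n. *)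
have ms : measurable_fun setT (fun t : R => c * t) by exact: measurable_funM.
pose S : {mfun R >-> R} := HB.pack (fun t : R => c * t) (isMeasurableFun.Build _ _ _ _ _ ms).
have [P hP] := @exists_pker _ _ X R R (fun x => distribution (f x) S)
  (fun U mU => mf _ (measurable_funPTI S mU)).
exists P => x.
have f01 := nu_itv01 (M0 x) (cM x) (hf x).
split.
  rewrite hP /= /distribution /pushforward.
  rewrite (_ : S @^-1` _ = ~` `[0, 1]%classic)//.
  rewrite preimage_setC; congr (~` _).
  have E t : (0 <= c * t <= c) = (0 <= t <= 1).
    by rewrite pmulr_rge0// -{2}[c]mulr1 ler_pM2l.
  by apply/seteqP; split => t /=; rewrite !in_itv /= E.
move=> n; rewrite hP /=.
rewrite ge0_integral_pushforward//; last exact: measurable_powabs.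
rewrite preimage_setT EFinM -(hausdorff_moments (M0 x) (cM x) (hf x)).
rewrite -ge0_integralZl_EFin//; last 2 first.
- exact: measurable_powabs.
- by rewrite exprn_ge0// ltW.
by apply: eq_integral => t _ /=; rewrite normrM (gtr0_norm c0) exprMn EFinM.
Qed.

End HausdorffKernel.

(** * L2 spaces and quasinormal operators *)

Section RieszFischer.
Context d (T : measurableType d) (R : realType).
Variable mu : {measure set T -> \bar R}.

Definition sqint (v : T -> R) : \bar R := (\int[mu]_x (v x ^+ 2)%:E)%E.

Lemma sqint_ge0 v : (0 <= sqint v)%E.
Proof. by apply: integral_ge0 => x _; rewrite lee_fin sqr_ge0. Qed.

Lemma measurable_sq (v : T -> R) : measurable_fun setT v ->
  measurable_fun setT (fun x => (v x ^+ 2)%:E).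
Proof. by move=> mv; apply/measurable_EFinP; exact: measurable_funX. Qed.

Lemma sqint_le2 (v w z : T -> R) : measurable_fun setT v -> measurable_fun setT w ->
  measurable_fun setT z -> (forall x, z x ^+ 2 <= 2 * v x ^+ 2 + 2 * w x ^+ 2) ->
  (sqint z <= 2%:E * sqint v + 2%:E * sqint w)%E.
Proof.
move=> mv mw mz h.
rewrite /sqint -!ge0_integralZl_EFin//; do ?exact: measurable_sq.
all: try by move=> x _; rewrite lee_fin sqr_ge0.
have m2 (u : T -> R) : measurable_fun setT u -> measurable_fun setT (fun x : T => (2%:E * (u x ^+ 2 : R)%:E)%E).
  by move=> mu_; apply: emeasurable_funM => //; exact: measurable_sq.
have p2 (u : T -> R) x : (0 <= 2%:E * (u x ^+ 2 : R)%:E)%E.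
  by rewrite -EFinM lee_fin mulr_ge0// sqr_ge0.
rewrite -ge0_integralD//; do ?exact: m2.
apply: ge0_le_integral => //.
- by move=> x _; rewrite lee_fin sqr_ge0.
- exact: measurable_sq.
- by apply: emeasurable_funD; exact: m2.
- by move=> x _; rewrite -!EFinM -EFinD lee_fin.
Qed.

(** Riesz-Fischer with a weighted series of squares, so that only integrals of squares have to be
    controlled: its finiteness a.e. forces a subsequence to converge a.e., and Fatou's lemma returns
    to the whole sequence. *)
Lemma sqint_complete (u : nat -> T -> R) :
  (forall n, measurable_fun setT (u n)) -> (forall n, sqint (u n) < +oo)%E ->
  (forall e : R, 0 < e -> exists N : nat, forall m n : nat,
     (N <= m)%N -> (N <= n)%N -> (sqint (u m \- u n)%R < e%:E)%E) ->
  exists l : T -> R, [/\ measurable_fun setT l, (sqint l < +oo)%E &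
    forall e : R, 0 < e -> exists N : nat, forall n : nat,
      (N <= n)%N -> (sqint (u n \- l)%R < e%:E)%E].
Proof.
move=> mu_ ufin cau.
(* With these tolerances the sum g of 4^k (v (k+1) - v k)^2 has integral at most 1, and the factor
   4^k bounds |v (k+1) - v k| by sqrt(g) 2^-k. *)
pose w k : R := (4 ^ k * 2 ^ k.+1)%:R^-1.
have w0 k : 0 < w k.
  by rewrite invr_gt0 ltr0n muln_gt0 !expn_gt0.
have /choice [N hN] := fun k => cau _ (w0 k).
(* Nondecreasing, at least [N k] for the tolerances, and at least k for the use of the Cauchy
   condition at K. *)
pose nk k := (k + \sum_(i < k.+1) N i)%N.
have nkS k : (nk k <= nk k.+1)%N.
  by rewrite /nk [in leqRHS]big_ord_recr /= leq_add// leq_addr.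
have Nnk k : (N k <= nk k)%N by rewrite /nk big_ord_recr /= addnA leq_addl.
pose v k := u (nk k).
have mv k : measurable_fun setT (v k) by exact: mu_.
pose g (x : T) : \bar R := (\sum_(0 <= k <oo) ((4 ^ k)%:R * (v k.+1 x - v k x) ^+ 2)%:E)%E.
have gterm0 k x : (0 <= ((4 ^ k)%:R * (v k.+1 x - v k x) ^+ 2)%:E)%E.
  by rewrite lee_fin mulr_ge0// sqr_ge0.
have mterm k : measurable_fun setT (fun x => ((4 ^ k)%:R * (v k.+1 x - v k x) ^+ 2 : R)%:E).
  by apply/measurable_EFinP; apply: measurable_funM => //; apply: measurable_funX;
     exact: measurable_funB.
have mg : measurable_fun setT g.
  by apply: ge0_emeasurable_sum => //; move=> k x *; exact: gterm0.
have g0 x : (0 <= g x)%E by apply: nneseries_ge0 => k _ _; exact: gterm0.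
have gint : (\int[mu]_x g x <= 1)%E.
  rewrite /g integral_nneseries//.
  have -> : 1%E = (\sum_(0 <= k <oo) (1 / (2 ^ (k + 1))%:R : R)%:E)%E.
    have := @cvg_geometric_eseries_half R 1 0.
    by rewrite expr0 divr1 => /cvg_lim <-.
  apply: lee_nneseries => k _.
    by move=> _; apply: integral_ge0 => x _; exact: gterm0.
  under eq_integral do rewrite EFinM.
  rewrite ge0_integralZl_EFin//; last 2 first.
  - by move=> x _; rewrite lee_fin sqr_ge0.
  - by apply: (@measurable_sq (v k.+1 \- v k)); exact: measurable_funB.
  apply: (@le_trans _ _ ((4 ^ k)%:R%:E * (w k)%:E)%E).
    apply: lee_wpmul2l; first by rewrite lee_fin.
    apply: ltW; apply: (hN k); last exact: Nnk.
    exact: leq_trans (Nnk k) (nkS k).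
  have n4 : (4 ^ k)%:R != 0 :> R by rewrite pnatr_eq0 expn_eq0.
  by rewrite -EFinM lee_fin /w natrM invfM mulrA divff// !mul1r addn1.
have gfin : {ae mu, forall x, g x \is a fin_num}.
  have := @integrable_ae _ _ _ mu _ measurableT g; case.
    apply/integrableP; split => //.
    under eq_integral do rewrite gee0_abs//.
    exact: le_lt_trans gint (ltry _).
  move=> A [mA A0 sA]; exists A; split => //.
  by apply: subset_trans sA => x /=; apply: contra_not => h; exact: h.
pose G : set T := [set x | g x \is a fin_num].
have mG : measurable G.
  by rewrite -[G]setTI; exact: emeasurable_fin_num.
have vcvg x : G x -> cvgn (v ^~ x).
  move=> Gx; set C := fine (g x).
  have C0 : 0 <= C by rewrite fine_ge0.
  have dk k : `|v k.+1 x - v k x| <= Num.sqrt C * (2^-1) ^+ k.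
    have h : (4 ^ k)%:R * (v k.+1 x - v k x) ^+ 2 <= C.
      rewrite -lee_fin fineK//; apply: le_trans _ (@nneseries_lim_ge _ _ _ 0 k.+1 _).
        by rewrite big_nat_recr//= leeDr// sume_ge0// => i _; exact: gterm0.
      by move=> i _ _; exact: gterm0.
    rewrite -(@ler_pXn2r _ 2)// ?nnegrE ?mulr_ge0 ?sqrtr_ge0 ?exprn_ge0 ?invr_ge0//.
    have E : (((2^-1 : R) ^+ k) ^+ 2) = (4 ^ k)%:R^-1.
      by rewrite !exprVn -exprM (_ : 4 = 2 ^ 2)%N// -expnM natrX mulnC.
    rewrite exprMn sqr_sqrtr// real_normK ?num_real// E.
    by rewrite ler_pdivlMr ?ltr0n ?expn_gt0// mulrC.
  have cd : cvgn (series (telescope (v ^~ x))).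
    apply: normed_cvg; apply: (@series_le_cvg _ _ (geometric (Num.sqrt C) 2^-1)).
    - by move=> k /=.
    - by move=> k /=; rewrite mulr_ge0 ?sqrtr_ge0 ?exprn_ge0 ?invr_ge0.
    - by move=> k /=; exact: dk.
    - by apply: is_cvg_geometric_series; rewrite ger0_norm ?invr_ge0// invf_lt1// ltr1n.
  rewrite telescopeK in cd.
  have -> : v ^~ x = (fun n => (v n x - v 0%N x) + v 0%N x).
    by apply/funext => n; rewrite subrK.
  by apply: is_cvgD => //; exact: is_cvg_cst.
(* The indicator makes the limit exist everywhere, hence measurable; off the conull set G it is
   0. *)
pose l x := limn (fun k => v k x * \1_G x).
have vl x : v k x * \1_G x @[k --> \oo] --> l x.
  have [Gx|nGx] := pselect (G x).
    suff : cvgn (fun k => v k x * \1_G x) by [].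
    by rewrite indicE mem_set//=; under eq_fun do rewrite mulr1; exact: vcvg.
  rewrite /l indicE memNset//=; under eq_fun do rewrite mulr0.
  by rewrite lim_cst//; exact: cvg_cst.
have ml : measurable_fun setT l.
  apply: (measurable_fun_cvg (h := fun k x => v k x * \1_G x)) => [k|x _]; last exact: vl.
  by apply: measurable_funM => //; exact: measurable_indic.
(* Fatou along v (k + K): all indices [nk (k + K)] are at least K, so every integral on the right is
   below e. *)
have ule (e : R) : 0 < e -> exists N0 : nat, forall n : nat,
      (N0 <= n)%N -> (sqint (u n \- l)%R <= e%:E)%E.
  move=> e0; have [K hK] := cau e e0; exists K => n Kn.
  pose f k x : \bar R := ((u n x - v (k + K)%N x * \1_G x) ^+ 2)%:E.
  have mf k : measurable_fun setT (f k).
    apply: (@measurable_sq (fun x => u n x - v (k + K)%N x * \1_G x)).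
    exact: measurable_funB (mu_ n) (measurable_funM (mv _) (measurable_indic mG)).
  have flim x : f k x @[k --> \oo] --> ((u n x - l x) ^+ 2)%:E.
    apply/cvg_EFin; first by near=> k.
    have : (v (k + K)%N x * \1_G x) @[k --> \oo] --> l x.
      by have := vl x; rewrite -(@cvg_shiftn K _ (fun k => v k x * \1_G x)).
    move=> h; rewrite /comp /f /=.
    have h' : (u n x - v (k + K)%N x * \1_G x) @[k --> \oo] --> u n x - l x.
      by apply: cvgB => //; exact: cvg_cst.
    by rewrite expr2; under eq_fun do rewrite expr2; exact: cvgM.
  have -> : sqint (u n \- l)%R = (\int[mu]_x limn_einf (f ^~ x))%E.
    by apply: eq_integral => x _; rewrite (cvg_limn_einf_sup (flim x)).1.
  apply: le_trans (fatou _ _ _ _) _ => //.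
    by move=> k x _; rewrite lee_fin sqr_ge0.
  have fe k : (\int[mu]_x f k x <= e%:E)%E.
    have -> : (\int[mu]_x f k x)%E = sqint (u n \- v (k + K)%N)%R.
      apply: ge0_ae_eq_integral => //.
      - by apply: (@measurable_sq (u n \- v (k + K)%N)); exact: measurable_funB.
      - by move=> x _; rewrite lee_fin sqr_ge0.
      - by move=> x _; rewrite lee_fin sqr_ge0.
      apply: filterS gfin => x Gx _.
      by rewrite /f indicE mem_set//= mulr1.
    apply/ltW/hK => //; rewrite /nk -addnA.
    by rewrite (leq_trans (leq_addl k K))// leq_add2l leq_addr.
  rewrite limn_einf_lim; apply: lime_le; first exact: is_cvg_einfs.
  apply: nearW => k; apply: le_trans (fe k).
  by apply: ereal_inf_lbound; exists k => //=.
have [n0 hn0] := ule 1 ltr01.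
exists l; split => //.
- have := @sqint_le2 (u n0) (u n0 \- l) l (mu_ n0) (measurable_funB (mu_ n0) ml) ml.
  move=> /(_ _)/le_lt_trans; apply.
    move=> x; have := sqr_ge0 (2 * u n0 x - l x); rewrite /=; nra.
  apply: lte_add_pinfty; apply: lte_mul_pinfty => //.
  exact: le_lt_trans (hn0 _ (leqnn _)) (ltry _).
- move=> e e0; have e20 : 0 < e / 2 by rewrite divr_gt0.
  have [N0 h] := ule _ e20; exists N0 => n /h /le_lt_trans; apply.
  by rewrite lte_fin ltr_pdivrMr// ltr_pMr// ltr1n.
Unshelve. all: by end_near. Qed.

End RieszFischer.

(* The Hilbert space S/N, where N is the null space of the semi-inner product
   ip0 on the subspace S; classes are encoded by chosen representatives. *)
Section HilbertQuotient.
Variables (R : realType) (V : lmodType R[i]) (S : V -> Prop) (ip0 : V -> V -> R[i]).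
Hypotheses (S0 : S 0)
  (Sl : forall a x y, S x -> S y -> S (a *: x + y))
  (ip0l : forall a x y z, S x -> S y -> S z ->
     ip0 (a *: x + y) z = a * ip0 x z + ip0 y z)
  (ip0C : forall x y, S x -> S y -> ip0 y x = (ip0 x y)^*)
  (ip0ge0 : forall x, S x -> 0 <= complex.Re (ip0 x x)).

Let SD x y : S x -> S y -> S (x + y).
Proof. by move=> Sx Sy; have := Sl 1 Sx Sy; rewrite scale1r. Qed.

Let SZ a x : S x -> S (a *: x).
Proof. by move=> Sx; have := Sl a Sx S0; rewrite addr0. Qed.

Let SN x : S x -> S (- x).
Proof. by move=> Sx; rewrite -scaleN1r; exact: SZ. Qed.

Let SB x y : S x -> S y -> S (x - y).
Proof. by move=> Sx Sy; apply: SD => //; exact: SN. Qed.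

Let ip0D x y z : S x -> S y -> S z -> ip0 (x + y) z = ip0 x z + ip0 y z.
Proof. by move=> Sx Sy Sz; have := ip0l 1 Sx Sy Sz; rewrite scale1r mul1r. Qed.

Let ip00 z : S z -> ip0 0 z = 0.
Proof.
by move=> Sz; apply: (@addrI _ (ip0 0 z)); rewrite -ip0D// !addr0.
Qed.

Let ip0Z a x z : S x -> S z -> ip0 (a *: x) z = a * ip0 x z.
Proof. by move=> Sx Sz; have := ip0l a Sx S0 Sz; rewrite addr0 ip00// addr0. Qed.

Let ip0Dr x y z : S x -> S y -> S z -> ip0 z (x + y) = ip0 z x + ip0 z y.
Proof.
move=> Sx Sy Sz; rewrite (ip0C (SD Sx Sy) Sz) (ip0C Sx Sz) (ip0C Sy Sz).
by rewrite ip0D// rmorphD.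
Qed.

Let ip0Zr a x z : S x -> S z -> ip0 z (a *: x) = a^* * ip0 z x.
Proof. by move=> Sx Sz; rewrite (ip0C (SZ a Sx) Sz) (ip0C Sx Sz) ip0Z// rmorphM. Qed.

(** Cauchy-Schwarz for a semidefinite form: null vectors are orthogonal to everything, so the form
    descends to classes. *)
Let null_re x y : S x -> S y -> complex.Re (ip0 x x) = 0 -> complex.Re (ip0 x y) = 0.
Proof.
move=> Sx Sy x0; apply/eqP; rewrite -sqrf_eq0 eq_le sqr_ge0 andbT.
rewrite -[X in _ <= X](mul0r (complex.Re (ip0 y y))) -x0.
apply: discr_le; first exact: ip0ge0.
move=> t; have := ip0ge0 (Sl t%:C%C Sx Sy).
have StX : S (t%:C%C *: x) by exact: SZ.
rewrite ip0D ?ip0Dr//; last exact: SD.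
rewrite !ip0Z// !ip0Zr// (ip0C Sx Sy) !cReD.
rewrite !cReM /= !mul0r !subr0.
by case: (ip0 x y) => a b /=; lra.
Qed.

Let null_ip x y : S x -> S y -> complex.Re (ip0 x x) = 0 -> ip0 x y = 0.
Proof.
move=> Sx Sy x0; apply: complex_ext; first exact: null_re.
have : complex.Re (ip0 x ('i%C *: y)) = 0 by apply: null_re => //; exact: SZ.
by rewrite ip0Zr// cReM /= mul0r mulN1r sub0r opprK.
Qed.

Let eqv x y := S y /\ complex.Re (ip0 (x - y) (x - y)) = 0.

(** A representative depending only on the class: equivalent vectors have the same set of
    equivalents, from which [xget] makes the same choice. Equality of classes becomes equality of
    representatives. *)
Let canon x : V := xget 0 [set y | eqv x y].

Let canonP x : S x -> eqv x (canon x).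
Proof.
move=> Sx; apply: (@xgetPex _ _ [set y | eqv x y]); exists x; split => //.
by rewrite subrr ip00.
Qed.

Let eqv_ip x y z : S x -> S z -> eqv x y -> ip0 x z = ip0 y z.
Proof.
move=> Sx Sz [Sy xy]; have h := null_ip (SB Sx Sy) Sz xy.
by rewrite -[x](subrK y) ip0D// ?h ?add0r//; exact: SB.
Qed.

Let eqv_trans x y z : S x -> eqv x y -> eqv y z -> eqv x z.
Proof.
move=> Sx xy [Sz yz]; split => //.
have [Sy xy0] := xy.
rewrite (_ : x - z = (x - y) + (y - z)); last by rewrite addrA subrK.
have S1 := SB Sx Sy; have S2 := SB Sy Sz; have S3 := SD S1 S2.
by rewrite (ip0D S1 S2 S3) (null_ip S1 S3 xy0) (null_ip S2 S3 yz) addr0.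
Qed.

Let eqv_sym x y : S x -> eqv x y -> eqv y x.
Proof.
move=> Sx [Sy xy]; split => //; rewrite -opprB -scaleN1r.
have Sxy := SB Sx Sy.
have S1 : S (-1 *: (x - y)) by exact: SZ.
by rewrite (ip0Z _ Sxy S1) (null_ip Sxy S1 xy) mulr0.
Qed.

Let canon_eq x y : S x -> eqv x y -> canon x = canon y.
Proof.
move=> Sx xy; rewrite /canon; congr xget; apply/seteqP; split => z /= h.
  by apply: eqv_trans h; [case: xy|exact: eqv_sym].
exact: eqv_trans h.
Qed.

Let eqv_lin a x x' y y' : S x -> S y -> eqv x x' -> eqv y y' ->
  eqv (a *: x + y) (a *: x' + y').
Proof.
move=> Sx Sy [Sx' xx'] [Sy' yy']; split; first exact: Sl.
have -> : a *: x + y - (a *: x' + y') = a *: (x - x') + (y - y').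
  by rewrite scalerBr opprD addrACA.
have S1 := SB Sx Sx'; have S2 := SB Sy Sy'; have S3 := Sl a S1 S2.
by rewrite (ip0l _ S1 S2 S3) (null_ip S1 S3 xx') (null_ip S2 S3 yy') mulr0 addr0.
Qed.

Let K := {x : V | `[< S x /\ canon x = x >]}.

Let KS (k : K) : S (val k). Proof. by case: k => x /= /asboolP[]. Qed.

Let Kcanon (k : K) : canon (val k) = val k. Proof. by case: k => x /= /asboolP[]. Qed.

Let SxK x : S x -> `[< S (canon x) /\ canon (canon x) = canon x >].
Proof.
move=> Sx; have [Sc cx] := canonP Sx; apply/asboolP; split => //.
by apply/esym/canon_eq.
Qed.

Let pi x (Sx : S x) : K := exist _ (canon x) (SxK Sx).

Let piK x (Sx : S x) : eqv x (val (pi Sx)). Proof. exact: canonP. Qed.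

Let K_ext (k l : K) : eqv (val k) (val l) -> k = l.
Proof.
move=> kl; apply: val_inj.
by rewrite -(Kcanon k) -(Kcanon l); exact: canon_eq.
Qed.

Let eqvxx x : S x -> eqv x x. Proof. by move=> Sx; split => //; rewrite subrr ip00. Qed.

Let Kadd (k l : K) : K := pi (SD (KS k) (KS l)).
Let Kopp (k : K) : K := pi (SN (KS k)).
Let Kzero : K := pi S0.
Let Kscale (a : R[i]) (k : K) : K := pi (SZ a (KS k)).

Let eqvD x x' y y' : S x -> S y -> eqv x x' -> eqv y y' -> eqv (x + y) (x' + y').
Proof. by move=> Sx Sy h h'; have := eqv_lin 1 Sx Sy h h'; rewrite !scale1r. Qed.

Let eqvZ a x x' : S x -> eqv x x' -> eqv (a *: x) (a *: x').
Proof. by move=> Sx h; have := eqv_lin a Sx S0 h (eqvxx S0); rewrite !addr0. Qed.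

Let val_add k l : eqv (val k + val l) (val (Kadd k l)). Proof. exact: piK. Qed.
Let val_scale a k : eqv (a *: val k) (val (Kscale a k)). Proof. exact: piK. Qed.
Let val_opp k : eqv (- val k) (val (Kopp k)). Proof. exact: piK. Qed.
Let val_zero : eqv 0 (val Kzero). Proof. exact: piK. Qed.

Let K_eq x (k l : K) : S x -> eqv x (val k) -> eqv x (val l) -> k = l.
Proof.
move=> Sx xk xl; apply: K_ext; apply: eqv_trans xl; first by case: xk.
exact: eqv_sym.
Qed.

Let KaddA : associative Kadd.
Proof.
move=> k l m; apply: (@K_eq (val k + val l + val m)).
- by do !apply: SD.
- rewrite -addrA; apply: eqv_trans (val_add k (Kadd l m)).
    by do !apply: SD.
  by apply: eqvD; [|exact: SD|exact: eqvxx|exact: val_add].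
- apply: eqv_trans (val_add (Kadd k l) m).
    by do !apply: SD.
  by apply: eqvD; [exact: SD| |exact: val_add|exact: eqvxx].
Qed.

Let KaddC : commutative Kadd.
Proof.
move=> k l; apply: (@K_eq (val k + val l)); [exact: SD|exact: val_add|].
by rewrite addrC; exact: val_add.
Qed.

Let Kadd0 : left_id Kzero Kadd.
Proof.
move=> k; apply: (@K_eq (0 + val k)); first exact: SD.
  apply: eqv_trans (val_add Kzero k); first exact: SD.
  by apply: eqvD => //; exact: eqvxx.
by rewrite add0r; exact: eqvxx.
Qed.

Let KaddN : left_inverse Kzero Kopp Kadd.
Proof.
move=> k; apply: (@K_eq (- val k + val k)).
- by apply: SD => //; exact: SN.
- apply: eqv_trans (val_add (Kopp k) k); first by apply: SD => //; exact: SN.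
  by apply: eqvD => //; [exact: SN|exact: eqvxx].
- by rewrite addNr; exact: val_zero.
Qed.

#[local] HB.instance Definition _ := Choice.on K.
#[local] HB.instance Definition _ := GRing.isZmodule.Build K KaddA KaddC Kadd0 KaddN.

Let KscaleA a b k : Kscale a (Kscale b k) = Kscale (a * b) k.
Proof.
apply: (@K_eq ((a * b) *: val k)); [exact: SZ| |exact: val_scale].
rewrite -scalerA; apply: eqv_trans (val_scale a (Kscale b k)); first by do !apply: SZ.
by apply: eqvZ; [exact: SZ|exact: val_scale].
Qed.

Let Kscale1 : left_id 1 Kscale.
Proof.
move=> k; apply: (@K_eq (1 *: val k)); [exact: SZ|exact: val_scale|].
by rewrite scale1r; exact: eqvxx.
Qed.

Let KscaleDr : right_distributive Kscale +%R.
Proof.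
move=> a k l; apply: (@K_eq (a *: (val k + val l))).
- by apply: SZ; exact: SD.
- apply: eqv_trans (val_scale a (Kadd k l)); first by apply: SZ; exact: SD.
  by apply: eqvZ; [exact: SD|exact: val_add].
- rewrite scalerDr; apply: eqv_trans (val_add (Kscale a k) (Kscale a l)).
    by apply: SD; exact: SZ.
  by apply: eqvD; [exact: SZ|exact: SZ|exact: val_scale|exact: val_scale].
Qed.

Let KscaleDl k : {morph Kscale^~ k : a b / a + b}.
Proof.
move=> a b; apply: (@K_eq ((a + b) *: val k)).
- exact: SZ.
- exact: val_scale.
- rewrite scalerDl; apply: eqv_trans (val_add (Kscale a k) (Kscale b k)).
    by apply: SD; exact: SZ.
  by apply: eqvD; [exact: SZ|exact: SZ|exact: val_scale|exact: val_scale].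
Qed.

#[local] HB.instance Definition _ := GRing.Zmodule_isLmodule.Build R[i] K
  KscaleA Kscale1 KscaleDr KscaleDl.

Let ipK (k l : K) : R[i] := ip0 (val k) (val l).

Hypothesis complete : forall u : nat -> V, (forall n, S (u n)) ->
  (forall e : R, 0 < e -> exists N : nat, forall m n : nat,
     (N <= m)%N -> (N <= n)%N -> complex.Re (ip0 (u m - u n) (u m - u n)) < e) ->
  exists2 l : V, S l & forall e : R, 0 < e -> exists N : nat, forall n : nat,
     (N <= n)%N -> complex.Re (ip0 (u n - l) (u n - l)) < e.

Let eqv_ipp x x' y y' : S x -> S y -> eqv x x' -> eqv y y' -> ip0 x y = ip0 x' y'.
Proof.
move=> Sx Sy xx' yy'; have [Sx' _] := xx'; have [Sy' _] := yy'.
rewrite (eqv_ip Sx Sy xx') (ip0C Sy Sx') (eqv_ip Sy Sx' yy').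
by rewrite -(ip0C Sy' Sx').
Qed.

Let val_sub (k l : K) : eqv (val k - val l) (val (k - l)).
Proof.
apply: eqv_trans (val_add k (Kopp l)); first exact: SB.
by apply: eqvD => //; [exact: SN|exact: eqvxx].
Qed.

Let ipK_sub (k l : K) : ipK (k - l) (k - l) = ip0 (val k - val l) (val k - val l).
Proof.
by apply/esym; apply: eqv_ipp; [exact: SB|exact: SB|exact: val_sub|exact: val_sub].
Qed.

(** The quotient structure stays local; only a projection [p], meaningful on S and 0 elsewhere, and
    a section [s] are exported. *)
Lemma hilbert_quotient : exists (H : lmodType R[i]) (ip : H -> H -> R[i])
    (p : V -> H) (s : H -> V),
  [/\ is_hilbert ip,
      forall a x y, S x -> S y -> p (a *: x + y) = a *: p x + p y,
      forall x y, S x -> S y -> ip (p x) (p y) = ip0 x y,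
      forall k, S (s k) &
      forall k, p (s k) = k].
Proof.
pose p x : K := if pselect (S x) is left Sx then pi Sx else 0.
have pE x (Sx : S x) : p x = pi Sx.
  rewrite /p; case: pselect => // Sx'; apply: K_ext.
  by rewrite /= ; apply: eqvxx; have [] := canonP Sx.
have pP x : S x -> eqv x (val (p x)) by move=> Sx; rewrite (pE _ Sx); exact: piK.
exists K, ipK, p, val; split.
- split.
  + move=> a x y z; rewrite /ipK -ip0l ?KS//.
    apply/esym; apply: eqv_ipp; [exact: Sl|exact: KS| |exact: eqvxx].
    apply: eqv_trans (val_add (Kscale a x) y); first exact: Sl.
    by apply: eqvD; [exact: SZ|exact: KS|exact: val_scale|exact: eqvxx].
  + by move=> x y; exact: ip0C.
  + move=> x; split; last exact: ip0ge0.
    have := ip0C (KS x) (KS x); rewrite /ipK.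
    case: (ip0 _ _) => a b [] /= /eqP.
    by rewrite -addr_eq0 -mulr2n mulrn_eq0 /= => /eqP.
  + move=> x x0; apply: (@K_eq (val x)) => //; first exact: eqvxx.
    apply: eqv_trans val_zero => //; split => //.
    by rewrite subr0 [ip0 _ _]x0.
  + move=> u hu.
    have [l Sl' hl] : exists2 l : V, S l & forall e : R, 0 < e -> exists N : nat, forall n : nat,
        (N <= n)%N -> complex.Re (ip0 (val (u n) - l) (val (u n) - l)) < e.
      apply: complete => // e /hu[N hN]; exists N => m n hm hn.
      by rewrite -ipK_sub; exact: hN.
    exists (p l) => e /hl[N hN]; exists N => n /hN.
    rewrite ipK_sub; congr (complex.Re _ < _).
    have h : eqv (val (u n) - l) (val (u n) - val (p l)).
      have := eqv_lin (-1) Sl' (KS (u n)) (pP _ Sl') (eqvxx (KS (u n))).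
      by rewrite !scaleN1r ![- _ + _]addrC.
    by apply: eqv_ipp => //; apply: SB.
- move=> a x y Sx Sy; apply: (@K_eq (a *: x + y)); first exact: Sl.
    by apply: pP; exact: Sl.
  apply: eqv_trans (val_add (Kscale a (p x)) (p y)); first exact: Sl.
  apply: eqvD; [exact: SZ|exact: Sy| |exact: pP].
  apply: eqv_trans (val_scale a (p x)); first exact: SZ.
  by apply: eqvZ => //; exact: pP.
- by move=> x y Sx Sy; apply/esym; apply: eqv_ipp => //; exact: pP.
- exact: KS.
- move=> k; apply/esym; apply: (@K_eq (val k)) => //; first exact: eqvxx.
  by apply: pP.
Qed.

End HilbertQuotient.

(** Polarisation for the real part; the imaginary part follows from [Im_ip] and complex
    linearity. *)
Lemma isometry_ip (R : realType) (K L : lmodType R[i]) (ip : K -> K -> R[i])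
    (ip' : L -> L -> R[i]) (U : K -> L) :
  is_hilbert ip -> is_hilbert ip' -> linmap U ->
  (forall x, hnsq ip' (U x) = hnsq ip x) ->
  forall x y, ip' (U x) (U y) = ip x y.
Proof.
move=> HK HL Ul Un x y.
have re z t : complex.Re (ip' (U z) (U t)) = complex.Re (ip z t).
  have := Un (z + t); rewrite (linmapD Ul) !(nsqD HK, nsqD HL) !Un.
  by move: (hnsq ip z) (hnsq ip t) => a b; lra.
by apply: complex_ext => //; rewrite (Im_ip HK) (Im_ip HL) -(linmapZ Ul) re.
Qed.

(** The bound makes T send null vectors to null vectors, so [p (T x)] depends only on [p x] and the
    operator can be read off on representatives. *)
Lemma quotient_lift (R : realType) (V : lmodType R[i]) (S : V -> Prop)
    (ip0 : V -> V -> R[i]) (H : lmodType R[i]) (ip : H -> H -> R[i])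
    (p : V -> H) (s : H -> V) (T : V -> V) (c : R) :
  (forall a x y, S x -> S y -> S (a *: x + y)) ->
  is_hilbert ip ->
  (forall a x y, S x -> S y -> p (a *: x + y) = a *: p x + p y) ->
  (forall x y, S x -> S y -> ip (p x) (p y) = ip0 x y) ->
  (forall k, S (s k)) -> (forall k, p (s k) = k) ->
  linmap T -> (forall x, S x -> S (T x)) ->
  (forall x, S x -> complex.Re (ip0 (T x) (T x)) <= c * complex.Re (ip0 x x)) ->
  exists T' : H -> H, [/\ linmap T', forall x, S x -> T' (p x) = p (T x) &
    forall k, hnsq ip (T' k) <= c * hnsq ip k].
Proof.
move=> Sl HH pl pip Ss ps Tl TS Tc.
have pB x y : S x -> S y -> p (x - y) = p x - p y.
  by move=> Sx Sy; rewrite addrC -scaleN1r pl// scaleN1r addrC.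
have SB x y : S x -> S y -> S (x - y).
  by move=> Sx Sy; rewrite addrC -scaleN1r; exact: Sl.
have wd x y : S x -> S y -> p x = p y -> p (T x) = p (T y).
  move=> Sx Sy xy; apply/subr0_eq/(nsq_eq0 HH)/eqP.
  have -> : p (T x) - p (T y) = p (T (x - y)).
    by rewrite (linmapB Tl) pB//; exact: TS.
  rewrite eq_le (nsq_ge0 HH) andbT.
  have Sxy := SB _ _ Sx Sy.
  have STxy := TS _ Sxy.
  rewrite /hnsq (pip _ _ STxy STxy); apply: le_trans (Tc _ Sxy) _.
  by rewrite -pip// pB// xy subrr (ip0l HH) /= mulr0.
exists (fun k => p (T (s k))); split.
- move=> a k l.
  rewrite -(pl _ _ _ (TS _ (Ss k)) (TS _ (Ss l))) -Tl.
  apply: wd => //; first exact: Sl.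
  by rewrite pl// !ps.
- by move=> x Sx; apply: wd => //; rewrite ps.
- move=> k; have STk := TS _ (Ss k).
  rewrite /hnsq (pip _ _ STk STk); apply: le_trans (Tc _ (Ss k)) _.
  by rewrite -pip// ps.
Qed.

(** * The complex L2 space as an abstract Hilbert space *)

Section ComplexL2.
Context d (T : measurableType d) (R : realType).
Variable mu : {measure set T -> \bar R}.

Definition realL2 (v : T -> R) : Prop :=
  measurable_fun setT v /\ (sqint mu v < +oo)%E.

Let dot (v w : T -> R) : R := \int[mu]_x (v x * w x).

Let integrable_mul v w : realL2 v -> realL2 w ->
  mu.-integrable setT (EFin \o (fun x => v x * w x)).
Proof.
move=> [mv fv] [mw fw]; apply/integrableP; split.
  by apply/measurable_EFinP; exact: measurable_funM.
apply: (@le_lt_trans _ _ (\int[mu]_x ((v x ^+ 2)%:E + (w x ^+ 2)%:E))%E).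
  apply: ge0_le_integral => //.
  - apply: measurableT_comp => //; apply/measurable_EFinP.
    exact: measurable_funM.
  - by apply: emeasurable_funD; exact: measurable_sq.
  - move=> x _; rewrite /= -EFinD lee_fin normrM.
    rewrite -(real_normK (num_real (v x))) -(real_normK (num_real (w x))).
    have := sqr_ge0 (`|v x| - `|w x|).
    have : 0 <= `|v x| * `|w x| by rewrite mulr_ge0.
    by nra.
rewrite ge0_integralD//; try exact: measurable_sq.
- exact: lte_add_pinfty.
- by move=> x _; rewrite lee_fin sqr_ge0.
- by move=> x _; rewrite lee_fin sqr_ge0.
Qed.

Let realL2_lin a b v w : realL2 v -> realL2 w -> realL2 (fun x => a * v x + b * w x).
Proof.
move=> [mv fv] [mw fw].
have m1 : measurable_fun setT (fun x => a * v x) by exact: measurable_funM.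
have m2 : measurable_fun setT (fun x => b * w x) by exact: measurable_funM.
have mz : measurable_fun setT (fun x => a * v x + b * w x) by exact: measurable_funD.
split => //; apply: le_lt_trans (@sqint_le2 _ _ _ mu _ _ _ m1 m2 mz _) _.
  by move=> x; have := sqr_ge0 (a * v x - b * w x); nra.
have sZ (k : R) (u : T -> R) : measurable_fun setT u -> (sqint mu u < +oo)%E ->
      (sqint mu (fun x => k * u x)%R < +oo)%E.
  move=> mu_ fu; rewrite /sqint.
  under eq_integral do rewrite exprMn EFinM.
  rewrite ge0_integralZl_EFin ?sqr_ge0//.
  - by apply: lte_mul_pinfty; rewrite ?lee_fin ?sqr_ge0.
  - by move=> x _; rewrite lee_fin sqr_ge0.
  - exact: measurable_sq.
by apply: lte_add_pinfty; apply: lte_mul_pinfty => //; exact: sZ.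
Qed.

Let dotC v w : dot v w = dot w v.
Proof. by rewrite /dot; congr fine; apply: eq_integral => x _; rewrite mulrC. Qed.

Let dot_lin a b v w z : realL2 v -> realL2 w -> realL2 z ->
  dot (fun x => a * v x + b * w x) z = a * dot v z + b * dot w z.
Proof.
move=> Lv Lw Lz; rewrite /dot.
have iv := integrable_mul Lv Lz; have iw := integrable_mul Lw Lz.
rewrite -(RintegralZl a measurableT iv) -(RintegralZl b measurableT iw).
rewrite -RintegralD//.
- by congr fine; apply: eq_integral => x _; congr EFin; ring.
- by under [X in integrable _ _ X]eq_fun do rewrite /= EFinM; exact: integrableZl.
- by under [X in integrable _ _ X]eq_fun do rewrite /= EFinM; exact: integrableZl.
Qed.

Let dot_ge0 v : 0 <= dot v v.
Proof.
by apply: fine_ge0; apply: integral_ge0 => x _; rewrite lee_fin -expr2 sqr_ge0.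
Qed.

Let sqint_dot v : realL2 v -> sqint mu v = (dot v v)%:E.
Proof.
move=> [mv fv]; rewrite /dot /Rintegral fineK.
  by apply: eq_integral => x _; rewrite expr2.
rewrite ge0_fin_numE.
  by under eq_integral do rewrite -expr2.
by apply: integral_ge0 => x _; rewrite lee_fin -expr2 sqr_ge0.
Qed.

Let rp (f : T -> R[i]) x := complex.Re (f x).
Let ipt (f : T -> R[i]) x := complex.Im (f x).

Lemma integral_csq (f : T -> R[i]) :
  measurable_fun setT (fun x => complex.Re (f x)) ->
  measurable_fun setT (fun x => complex.Im (f x)) ->
  (\int[mu]_x (csq (f x))%:E =
   sqint mu (fun x => complex.Re (f x)) + sqint mu (fun x => complex.Im (f x)))%E.
Proof.
move=> m1 m2; rewrite /sqint -ge0_integralD//.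
- by move=> x _; rewrite lee_fin sqr_ge0.
- exact: measurable_sq.
- by move=> x _; rewrite lee_fin sqr_ge0.
- exact: measurable_sq.
Qed.

Lemma L2P (f : T -> R[i]) : L2 mu f <->
  realL2 (fun x => complex.Re (f x)) /\ realL2 (fun x => complex.Im (f x)).
Proof.
split.
  move=> [m1 m2]; rewrite integral_csq// => h; split; split => //.
    by apply: le_lt_trans h; rewrite leeDl// sqint_ge0.
  by apply: le_lt_trans h; rewrite leeDr// sqint_ge0.
move=> [[m1 h1] [m2 h2]]; split => //.
by rewrite integral_csq//; exact: lte_add_pinfty.
Qed.

(** The integral of f times the conjugate of g, spelled out in real and imaginary parts so that only
    real integrals occur. *)
Definition L2ip (f g : T -> R[i]) : R[i] :=
  Complex (dot (rp f) (rp g) + dot (ipt f) (ipt g))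
          (dot (ipt f) (rp g) - dot (rp f) (ipt g)).

Lemma Re_L2ip f : L2 mu f -> complex.Re (L2ip f f) = L2nsq mu f.
Proof.
move=> /L2P[L1 L3].
by rewrite /L2nsq (integral_csq L1.1 L3.1) (sqint_dot L1) (sqint_dot L3).
Qed.

Lemma L2_0 : L2 mu (0 : T -> R[i]).
Proof.
split; [exact: measurable_cst|exact: measurable_cst|].
rewrite integral0_eq// => x _; congr EFin.
by rewrite /csq expr0n addr0.
Qed.

Let scalerE (a : R[i]) (f : T -> R[i]) x : (a *: f) x = a * f x. Proof. by []. Qed.

Let rp_lin (a : R[i]) f g : rp (a *: f + g) =
  (fun x => 1 * (fun x => complex.Re a * rp f x + (- complex.Im a) * ipt f x) x + 1 * rp g x).
Proof.
apply/funext => x; rewrite /rp /ipt fctE cReD scalerE cReM; ring.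
Qed.

Let ipt_lin (a : R[i]) f g : ipt (a *: f + g) =
  (fun x => 1 * (fun x => complex.Re a * ipt f x + complex.Im a * rp f x) x + 1 * ipt g x).
Proof.
apply/funext => x; rewrite /rp /ipt fctE cImD scalerE cImM; ring.
Qed.

Lemma L2_lin (a : R[i]) (f g : T -> R[i]) : L2 mu f -> L2 mu g -> L2 mu (a *: f + g).
Proof.
move=> /L2P[f1 f2] /L2P[g1 g2]; apply/L2P; split.
  by rewrite -/(rp _) rp_lin; apply: realL2_lin => //; exact: realL2_lin.
by rewrite -/(ipt _) ipt_lin; apply: realL2_lin => //; exact: realL2_lin.
Qed.

Let L2ip_lin (a : R[i]) f g z : L2 mu f -> L2 mu g -> L2 mu z ->
  L2ip (a *: f + g) z = a * L2ip f z + L2ip g z.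
Proof.
move=> /L2P[f1 f2] /L2P[g1 g2] /L2P[z1 z2].
have h1 := realL2_lin (complex.Re a) (- complex.Im a) f1 f2.
have h2 := realL2_lin (complex.Re a) (complex.Im a) f2 f1.
rewrite /L2ip rp_lin ipt_lin !dot_lin//.
by apply: complex_ext; rewrite ?cReD ?cImD ?cReM ?cImM /=; ring.
Qed.

Let L2ipC f g : L2 mu f -> L2 mu g -> L2ip g f = (L2ip f g)^*.
Proof.
move=> _ _; rewrite /L2ip; apply: complex_ext => /=.
  by congr (_ + _); rewrite dotC.
by rewrite opprB (dotC (ipt g)) (dotC (rp g)).
Qed.

Let L2_complete (u : nat -> T -> R[i]) : (forall n, L2 mu (u n)) ->
  (forall e : R, 0 < e -> exists N : nat, forall m n : nat,
     (N <= m)%N -> (N <= n)%N -> complex.Re (L2ip (u m - u n) (u m - u n)) < e) ->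
  exists2 l : T -> R[i], L2 mu l & forall e : R, 0 < e -> exists N : nat, forall n : nat,
     (N <= n)%N -> complex.Re (L2ip (u n - l) (u n - l)) < e.
Proof.
move=> Lu cau.
have Lr n : realL2 (rp (u n)) by have /L2P[] := Lu n.
have Li n : realL2 (ipt (u n)) by have /L2P[] := Lu n.
have rB (f g : T -> R[i]) : rp (f - g) = rp f \- rp g.
  by apply/funext => x; rewrite /rp fctE cReD raddfN.
have iB (f g : T -> R[i]) : ipt (f - g) = ipt f \- ipt g.
  by apply/funext => x; rewrite /ipt fctE cImD raddfN.
have realL2B v w : realL2 v -> realL2 w -> realL2 (v \- w).
  move=> hv hw; have := realL2_lin 1 (-1) hv hw.
  by under eq_fun do rewrite mul1r mulN1r.
have caur (e : R) : 0 < e -> exists N : nat, forall m n : nat,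
    (N <= m)%N -> (N <= n)%N -> (sqint mu (rp (u m) \- rp (u n))%R < e%:E)%E.
  move=> /cau[N hN]; exists N => m n hm hn.
  rewrite sqint_dot; last exact: realL2B.
  rewrite lte_fin; apply: le_lt_trans (hN m n hm hn).
  by rewrite /= rB lerDl dot_ge0.
have caui (e : R) : 0 < e -> exists N : nat, forall m n : nat,
    (N <= m)%N -> (N <= n)%N -> (sqint mu (ipt (u m) \- ipt (u n))%R < e%:E)%E.
  move=> /cau[N hN]; exists N => m n hm hn.
  rewrite sqint_dot; last exact: realL2B.
  rewrite lte_fin; apply: le_lt_trans (hN m n hm hn).
  by rewrite /= iB lerDr dot_ge0.
have [l1 [ml1 fl1 hl1]] := sqint_complete (fun n => (Lr n).1) (fun n => (Lr n).2) caur.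
have [l2 [ml2 fl2 hl2]] := sqint_complete (fun n => (Li n).1) (fun n => (Li n).2) caui.
exists (fun x => Complex (l1 x) (l2 x)); first exact/L2P.
move=> e e0; have e20 : 0 < e / 2 by rewrite divr_gt0.
have [N1 h1] := hl1 _ e20; have [N2 h2] := hl2 _ e20.
exists (maxn N1 N2) => n; rewrite geq_max => /andP[/h1 h1' /h2 h2'].
rewrite sqint_dot in h1'; last exact: realL2B.
rewrite sqint_dot in h2'; last exact: realL2B.
by rewrite /= rB iB [ltRHS](splitr e) ltrD// -lte_fin.
Qed.

Lemma L2_hilbert : exists (H : lmodType R[i]) (ip : H -> H -> R[i])
    (p : (T -> R[i]) -> H) (s : H -> (T -> R[i])),
  [/\ is_hilbert ip,
      forall a x y, L2 mu x -> L2 mu y -> p (a *: x + y) = a *: p x + p y,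
      forall x y, L2 mu x -> L2 mu y -> ip (p x) (p y) = L2ip x y,
      forall k, L2 mu (s k) &
      forall k, p (s k) = k].
Proof.
apply: hilbert_quotient.
- exact: L2_0.
- exact: L2_lin.
- exact: L2ip_lin.
- exact: L2ipC.
- by move=> x _ /=; rewrite addr_ge0.
- exact: L2_complete.
Qed.

Lemma L2ip_scale (r : T -> R) (f g : T -> R[i]) :
  L2ip (fun x => (r x)%:C%C * f x) g = L2ip f (fun x => (r x)%:C%C * g x).
Proof.
have E1 (h : T -> R[i]) : rp (fun x => (r x)%:C%C * h x) = (fun x => r x * rp h x).
  by apply/funext => x; rewrite /rp cReM /= mul0r subr0.
have E2 (h : T -> R[i]) : ipt (fun x => (r x)%:C%C * h x) = (fun x => r x * ipt h x).
  by apply/funext => x; rewrite /ipt cImM /= mul0r addr0.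
have dotE v w : dot (fun x => r x * v x) w = dot v (fun x => r x * w x).
  by congr fine; apply: eq_integral => x _; congr EFin; ring.
by rewrite /L2ip !E1 !E2 !dotE.
Qed.

End ComplexL2.

Lemma csq_ge0 (R : realType) (z : R[i]) : 0 <= csq z.
Proof. by rewrite addr_ge0// sqr_ge0. Qed.

Lemma csq_real_mul (R : realType) (r : R) (z : R[i]) :
  csq (r%:C%C * z) = r ^+ 2 * csq z.
Proof. by case: z => a b; rewrite /csq /= !mul0r subr0 addr0; ring. Qed.

Lemma measurable_csq d (T : measurableType d) (R : realType) (f : T -> R[i]) :
  measurable_fun setT (fun x => complex.Re (f x)) ->
  measurable_fun setT (fun x => complex.Im (f x)) ->
  measurable_fun setT (fun x => (csq (f x))%:E).
Proof.
move=> m1 m2; apply/measurable_EFinP.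
by apply: measurable_funD; exact: measurable_funX.
Qed.

(** * Normal extension of a quasinormal composition operator *)

Section QuasinormalExtension.
Context d (T : measurableType d) (R : realType).
Variables (rho : {measure set T -> \bar R}) (Phi : T -> T) (w : T -> R) (c : R).
Hypotheses (mPhi : measurable_fun setT Phi) (mw : measurable_fun setT w)
  (w0 : forall z, 0 <= w z) (wpos : {ae rho, forall z, 0 < w z})
  (wc : {ae rho, forall z, w z <= c}) (wPhi : forall z, w (Phi z) = w z)
  (PhiE : forall f : T -> \bar R, measurable_fun setT f -> (forall z, 0 <= f z)%E ->
     (\int[rho]_z f (Phi z) = \int[rho]_z (f z * (w z)%:E))%E).

Let Am (f : T -> R[i]) z : R[i] := (Num.sqrt (w z))%:C%C * f z.
(** The isometric factor of the polar decomposition. Where w = 0 the inverse root is 0; such points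
    are negligible by [wpos]. *)
Let Um (f : T -> R[i]) z : R[i] := ((Num.sqrt (w z))^-1)%:C%C * f (Phi z).

Let measurable_invr (v : T -> R) : measurable_fun setT v -> (forall z, 0 <= v z) ->
  measurable_fun setT (fun z => (v z)^-1).
Proof.
move=> mv v0; under eq_fun do rewrite -powR_inv1//.
exact: (measurableT_comp (measurable_powR (-1))).
Qed.

Let msqrt : measurable_fun setT (fun z => Num.sqrt (w z)).
Proof.
under eq_fun do rewrite -powR12_sqrt//.
exact: (measurableT_comp (measurable_powR 2^-1)).
Qed.

Let minv : measurable_fun setT (fun z => (Num.sqrt (w z))^-1).
Proof. by apply: measurable_invr => // z; rewrite sqrtr_ge0. Qed.

Let measurable_scale (r : T -> R) (f : T -> R[i]) : measurable_fun setT r ->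
  measurable_fun setT (fun x => complex.Re (f x)) ->
  measurable_fun setT (fun x => complex.Im (f x)) ->
  measurable_fun setT (fun x => complex.Re ((r x)%:C%C * f x)) /\
  measurable_fun setT (fun x => complex.Im ((r x)%:C%C * f x)).
Proof.
move=> mr m1 m2; split.
  under eq_fun do rewrite cReM /= mul0r subr0; exact: measurable_funM.
by under eq_fun do rewrite cImM /= mul0r addr0; exact: measurable_funM.
Qed.

Let integral_wc (g : T -> \bar R) : measurable_fun setT g -> (forall z, 0 <= g z)%E ->
  (\int[rho]_z (g z * (w z)%:E) <= c%:E * \int[rho]_z g z)%E.
Proof.
move=> mg g0.
(* A negative c contradicts [wpos] a.e., so rho is then the zero measure and both sides are 0. *)
have [cge0|clt0] := leP 0 c; last first.
  have null : {ae rho, forall z, g z = 0%E}.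
    by apply: filterS2 wpos wc => z h1 h2; move: (lt_le_trans h1 h2); rewrite ltNge (ltW clt0).
  rewrite (ge0_ae_eq_integral (g := cst 0%E)) => //.
  - rewrite (ge0_ae_eq_integral (g := cst 0%E) (f := g)) => //.
      by rewrite integral0 mule0.
    by apply: filterS null => z ->.
  - by apply: emeasurable_funM => //; exact/measurable_EFinP.
  - by move=> z _; rewrite mule_ge0// lee_fin.
  - by apply: filterS null => z -> _; rewrite mul0e.
rewrite -ge0_integralZl_EFin//; apply: ae_ge0_le_integral => //.
- by move=> z _; rewrite mule_ge0// lee_fin.
- by apply: emeasurable_funM => //; exact/measurable_EFinP.
- by move=> z _; rewrite mule_ge0// lee_fin.
- exact: emeasurable_funM.
- by apply: filterS wc => z h _; rewrite muleC lee_wpmul2r// lee_fin.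
Qed.

Let mcsq (f : T -> R[i]) : L2 rho f -> measurable_fun setT (fun z => (csq (f z))%:E).
Proof. by case=> m1 m2 _; exact: measurable_csq. Qed.

Let csq0 (f : T -> R[i]) z : (0 <= (csq (f z))%:E)%E.
Proof. by rewrite lee_fin csq_ge0. Qed.

Let L2_comp f : L2 rho f -> L2 rho (f \o Phi).
Proof.
move=> Lf; have [m1 m2 fin] := Lf; split.
- exact: (measurableT_comp m1 mPhi).
- exact: (measurableT_comp m2 mPhi).
- rewrite (PhiE (f := fun z => (csq (f z))%:E))//; last exact: mcsq.
  apply: le_lt_trans (integral_wc (mcsq Lf) (csq0 f)) _.
  move: fin; have : (0 <= \int[rho]_z (csq (f z))%:E)%E by apply: integral_ge0.
  by case: (\int[rho]_z _)%E => [r||]// _ _; rewrite -EFinM ltry.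
Qed.

Let Am_int f : L2 rho f ->
  (\int[rho]_z (csq (Am f z))%:E = \int[rho]_z ((csq (f z))%:E * (w z)%:E))%E.
Proof.
move=> Lf; apply: eq_integral => z _.
by rewrite csq_real_mul sqr_sqrtr// -EFinM mulrC.
Qed.

Let fin_mul (r : R) (x : \bar R) : (0 <= x)%E -> (x < +oo)%E -> (r%:E * x < +oo)%E.
Proof. by case: x => [x||]// _ _; rewrite -EFinM ltry. Qed.

Let L2_Am f : L2 rho f -> L2 rho (Am f).
Proof.
move=> Lf; have [m1 m2 fin] := Lf; have [m3 m4] := measurable_scale msqrt m1 m2.
split => //; rewrite Am_int//.
apply: le_lt_trans (integral_wc (mcsq Lf) (csq0 f)) _.
by apply: fin_mul => //; exact: integral_ge0.
Qed.

(** Invariance of w turns |f o Phi|^2 / w into (|f|^2 / w) o Phi, and the change of variables gives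
    the factor w back. *)
Let Um_int f : L2 rho f ->
  (\int[rho]_z (csq (Um f z))%:E = \int[rho]_z (csq (f z))%:E)%E.
Proof.
move=> Lf; pose g z := (((w z)^-1 * csq (f z))%:E : \bar R).
have mg : measurable_fun setT g.
  apply/measurable_EFinP; apply: measurable_funM; last exact/measurable_EFinP/mcsq.
  exact: measurable_invr.
have g0 z : (0 <= g z)%E by rewrite lee_fin mulr_ge0 ?csq_ge0 ?invr_ge0.
transitivity (\int[rho]_z g (Phi z))%E.
  apply: eq_integral => z _.
  by rewrite csq_real_mul exprVn sqr_sqrtr// /g wPhi.
rewrite PhiE//; apply: ge0_ae_eq_integral => //.
- by apply: emeasurable_funM => //; exact/measurable_EFinP.
- exact: mcsq.
- by move=> z _; rewrite mule_ge0// lee_fin.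
- by apply: filterS wpos => z wz _; rewrite /g -EFinM mulrAC mulVf ?mul1r// gt_eqF.
Qed.

Let L2_Um f : L2 rho f -> L2 rho (Um f).
Proof.
move=> Lf; have [m1 m2 fin] := Lf.
have [m3 m4] := @measurable_scale _ (f \o Phi) minv (measurableT_comp m1 mPhi) (measurableT_comp m2 mPhi).
by split => //; rewrite Um_int.
Qed.

Let Am_lin : linmap Am.
Proof.
move=> a x y; apply/funext => z; set r := (Num.sqrt (w z))%:C%C.
by change (r * (a * x z + y z) = a * (r * x z) + r * y z); ring.
Qed.

Let Um_lin : linmap Um.
Proof.
move=> a x y; apply/funext => z; set r := ((Num.sqrt (w z))^-1)%:C%C.
by change (r * (a * x (Phi z) + y (Phi z)) = a * (r * x (Phi z)) + r * y (Phi z)); ring.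
Qed.

Lemma quasinormal_extension :
  exists (K : lmodType R[i]) (ip : K -> K -> R[i]) (J : (T -> R[i]) -> K) (N : K -> K),
    [/\ is_hilbert ip,
        (forall (a : R[i]) f g, L2 rho f -> L2 rho g -> J (a *: f + g) = a *: J f + J g),
        (forall f, L2 rho f -> hnsq ip (J f) = L2nsq rho f),
        bounded_normal ip N &
        (forall f, L2 rho f -> N (J f) = J (f \o Phi))].
Proof.
have [H [ip [p [s [HH pl pip Ls ps]]]]] := @L2_hilbert _ T R rho.
have pnsq f : L2 rho f -> hnsq ip (p f) = L2nsq rho f.
  by move=> Lf; rewrite /hnsq pip// Re_L2ip.
have [U [Ul UE _]] : exists T' : H -> H, [/\ linmap T', forall x, L2 rho x -> T' (p x) = p (Um x) &
    forall k, hnsq ip (T' k) <= 1 * hnsq ip k].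
  apply: (@quotient_lift _ _ (L2 rho) (L2ip rho)) => //; try exact: L2_lin; try exact: pip.
  by move=> f Lf; rewrite mul1r (Re_L2ip (L2_Um Lf)) (Re_L2ip Lf) /L2nsq Um_int.
have [A [Al AE Ac]] : exists T' : H -> H, [/\ linmap T', forall x, L2 rho x -> T' (p x) = p (Am x) &
    forall k, hnsq ip (T' k) <= c * hnsq ip k].
  apply: (@quotient_lift _ _ (L2 rho) (L2ip rho)) => //; try exact: L2_lin; try exact: pip.
  move=> f Lf; rewrite (Re_L2ip (L2_Am Lf)) (Re_L2ip Lf) /L2nsq Am_int//.
  have h := integral_wc (mcsq Lf) (csq0 f); have [_ _ fin] := Lf.
  have i0 : (0 <= \int[rho]_z (csq (f z))%:E)%E by exact: integral_ge0.
  have i1 : (0 <= \int[rho]_z ((csq (f z))%:E * (w z)%:E))%E.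
    by apply: integral_ge0 => z _; rewrite mule_ge0// lee_fin.
  have f1 : (\int[rho]_z (csq (f z))%:E)%E \is a fin_num by rewrite ge0_fin_numE.
  rewrite -lee_fin EFinM !fineK//.
  by rewrite ge0_fin_numE//; apply: le_lt_trans h _; exact: fin_mul.
have Uiso : forall x y, ip (U x) (U y) = ip x y.
  apply: isometry_ip => // k.
  rewrite -(ps k) (UE _ (Ls k)) (pnsq _ (L2_Um (Ls k))) (pnsq _ (Ls k)).
  by rewrite /L2nsq Um_int.
have Asa x y : ip (A x) y = ip x (A y).
  rewrite -(ps x) -(ps y) (AE _ (Ls x)) (AE _ (Ls y)).
  rewrite (pip _ _ (L2_Am (Ls x)) (Ls y)) (pip _ _ (Ls x) (L2_Am (Ls y))).
  exact: L2ip_scale.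
have UA x : U (A x) = A (U x).
  rewrite -(ps x) (AE _ (Ls x)) (UE _ (Ls x)).
  rewrite (UE _ (L2_Am (Ls x))) (AE _ (L2_Um (Ls x))).
  congr p; apply/funext => z; rewrite /Um /Am wPhi; ring.
have [N [Nn NE]] := normal_extension HH Ul Al Uiso Asa (ex_intro _ c Ac) UA.
exists (H * H)%type, (prod_ip ip), (fun f => (p f, 0)), N; split => //.
- exact: prod_hilbert.
- move=> a f g Lf Lg; rewrite pl//.
  change ((a *: p f + p g, 0) = (a *: p f + p g, a *: (0 : H) + 0)).
  by rewrite scaler0 addr0.
- by move=> f Lf; rewrite prod_nsq /= pnsq// /hnsq (ip0l HH) addr0.
- move=> f Lf; rewrite NE AE// UE; last exact: L2_Am.
  (* [Um (Am f)] equals f o Phi only where w > 0, so the two classes are identified through the norm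
     of their difference. *)
  congr pair; apply/subr0_eq/(nsq_eq0 HH).
  have L1 := L2_Um (L2_Am Lf); have L3 := L2_comp Lf.
  have L4 : L2 rho (-1 *: (f \o Phi) + Um (Am f)) by exact: L2_lin.
  rewrite addrC -scaleN1r -pl// pnsq// /L2nsq.
  rewrite (ge0_ae_eq_integral (g := cst 0%E)) => //.
  - by rewrite integral0.
  - exact: mcsq.
  apply: filterS wpos => z wz _ /=; congr EFin.
  change (csq (-1 * f (Phi z) + Um (Am f) z) = 0).
  rewrite /Um /Am /= wPhi mulrA -rmorphM /= mulVf ?mul1r.
    by rewrite mulN1r addNr /csq expr0n addr0.
  by rewrite gt_eqF// sqrtr_gt0.
Qed.

End QuasinormalExtension.

(** * Composition operators *)

Section WeightedMeasure.
Context d (T : measurableType d) (R : realType).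
Variables (rho : {measure set T -> \bar R}) (w : T -> \bar R).
Hypotheses (mw : measurable_fun setT w) (w0 : forall z, (0 <= w z)%E).
Local Open Scope ereal_scope.

Let wm (S : set T) : \bar R := \int[rho]_(z in S) w z.

Let wm0 : wm set0 = 0. Proof. exact: integral_set0. Qed.

Let wm_ge0 S : 0 <= wm S. Proof. by apply: integral_ge0. Qed.

Let wm_sigma_additive : semi_sigma_additive wm.
Proof.
move=> F mF tF mU; rewrite /wm ge0_integral_bigcup//; last exact: measurable_funTS.
by apply: is_cvg_nneseries => n _ _; exact: wm_ge0.
Qed.

#[local] HB.instance Definition _ := isMeasure.Build _ _ _ wm
  wm0 wm_ge0 wm_sigma_additive.

Lemma exists_weighted_measure : exists nu : {measure set T -> \bar R},
  (forall S, measurable S -> nu S = \int[rho]_(z in S) w z) /\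
  forall f : T -> \bar R, measurable_fun setT f -> (forall z, 0 <= f z) ->
    \int[nu]_z f z = \int[rho]_z (f z * w z).
Proof. by exists wm; split => // f mf f0; apply: integral_density. Qed.

End WeightedMeasure.

(** * The identity (K) and the measures of iterated preimages *)

Section KernelIdentity.
Context d (X : measurableType d) (R : realType).
Variables (mu : {measure set X -> \bar R}) (phi : X -> X) (P : R.-pker X ~> R).
Hypothesis mphi : measurable_fun setT phi.
Local Open Scope ereal_scope.

(* Integrated form of (CC^-1). It says that h_Phi(x, t) = t for the transformation
   Phi(x, t) = (phi x, t) of X * R with the measure mu(dx) P(x, dt). The absolute
   value only keeps the integrand nonnegative, P x being carried by R_+. *)
Definition shift_identity := forall D s, measurable D -> measurable s ->
  \int[mu]_(x in phi @^-1` D) P x s = \int[mu]_(x in D) \int[P x]_(t in s) `|t|%:E.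

Lemma measurable_preim D : measurable D -> measurable (phi @^-1` D).
Proof. by move=> mD; rewrite -[X in measurable X]setTI; exact: mphi. Qed.

Lemma measurable_kernel_weight (g : R -> \bar R) s : measurable s ->
  measurable_fun setT g -> (forall t, 0 <= g t) ->
  measurable_fun setT (fun x => \int[P x]_(t in s) g t).
Proof.
move=> ms mg g0.
under eq_fun => x do rewrite -integral_indicl.
apply: (@measurable_kernel_integral _ _ X R R mu P (fun z => (\1_s z.2)%:E * g z.2)).
  apply: emeasurable_funM.
    apply/measurable_EFinP; exact: (measurableT_comp (measurable_indic ms) measurable_snd).
  exact: (measurableT_comp mg measurable_snd).
by move=> z; rewrite mule_ge0// lee_fin.
Qed.

Lemma measurable_abs_EFin : measurable_fun setT (fun t : R => `|t|%:E).
Proof. by apply/measurable_EFinP; exact: normr_measurable. Qed.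

Lemma shift_identity_finite : sigma_finite setT mu ->
  (forall D s, measurable D -> measurable s -> mu D < +oo ->
    \int[mu]_(x in phi @^-1` D) P x s = \int[mu]_(x in D) \int[P x]_(t in s) `|t|%:E) ->
  shift_identity.
Proof.
move=> [F FT mF] h D s mD ms.
pose G n := D `&` seqDU F n.
have mG n : measurable (G n).
  apply: measurableI => //; rewrite /seqDU; apply: measurableD; first exact: (mF n).1.
  by apply: bigsetU_measurable => i _; exact: (mF i).1.
have DG : D = \bigcup_n G n by rewrite -setI_bigcupr -seqDU_bigcup_eq -FT setIT.
have tG : trivIset setT G.
  by apply: trivIset_setIl; exact: trivIset_seqDU.
have Gfin n : mu (G n) < +oo.
  apply: le_lt_trans (mF n).2; apply: le_measure; rewrite ?inE//.
    exact: (mF n).1.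
  by move=> x [_ []].
have mw : measurable_fun setT (fun x => \int[P x]_(t in s) `|t|%:E).
  apply: measurable_kernel_weight => //; exact: measurable_abs_EFin.
rewrite DG preimage_bigcup !ge0_integral_bigcup//.
- by apply: eq_eseriesr => n _; exact: h.
- exact: measurable_funTS.
- by move=> x _; apply: integral_ge0 => t _; rewrite lee_fin.
- by move=> n; exact: measurable_preim.
- by apply: measurable_funTS; exact: measurable_kernel.
- move/trivIsetP : tG => tG; apply/trivIsetP => i j _ _ ij.
  by rewrite -preimage_setI tG// preimage_set0.
Qed.

Hypothesis sf : sigma_finite setT mu.
Hypothesis preim_fin : forall D, measurable D -> mu D < +oo -> mu (phi @^-1` D) < +oo.
Hypothesis shiftP : shift_identity.

Local Notation rho := (sdprod mu P).
Let Phi (z : X * R) : X * R := (phi z.1, z.2).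

Lemma measurable_shift : measurable_fun setT Phi.
Proof.
apply/measurable_fun_pairP; split; last exact: measurable_snd.
exact: (measurableT_comp mphi measurable_fst).
Qed.

Let mabs2 : measurable_fun setT (fun z : X * R => `|z.2|%:E).
Proof. exact: (measurableT_comp measurable_abs_EFin measurable_snd). Qed.

(** (K) says that the image of rho under Phi and the measure |t| rho agree on rectangles. Both are
    finite on the rectangles [F n] times R, by [preim_fin], so they coincide. *)
Lemma integral_shift (f : X * R -> \bar R) :
  measurable_fun setT f -> (forall z, 0 <= f z) ->
  \int[rho]_z f (Phi z) = \int[rho]_z (f z * `|z.2|%:E).
Proof.
move=> mf f0.
have [nu [nuS nuf]] := @exists_weighted_measure _ _ R rho (fun z => `|z.2|%:E) mabs2
  (fun z => normr_ge0 z.2).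
rewrite -nuf//.
transitivity (\int[pushforward rho Phi]_z f z).
  by rewrite ge0_integral_pushforward//; exact: measurable_shift.
have [F FT mF] := sf.
have rectE A B : measurable A -> measurable B -> rho (Phi @^-1` (A `*` B)) = nu (A `*` B).
  move=> mA mB; rewrite nuS; last exact: measurableX.
  have -> : Phi @^-1` (A `*` B) = (phi @^-1` A) `*` B by [].
  rewrite sdprodX//; last exact: measurable_preim.
  rewrite shiftP// -[RHS]integral_indicl integral_sdprod//; last first.
    apply: emeasurable_funM => //; apply/measurable_EFinP/measurable_indic.
    exact: measurableX.
  rewrite integral_mkcond; apply: eq_integral => x _.
  rewrite patchE; case: ifPn => xA.
    rewrite -integral_indicl; apply: eq_integral => t _.
    by rewrite !indicE in_setX xA.
  rewrite integral0_eq// => t _.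
  by rewrite indicE in_setX (negbTE xA) mul0e.
pose PM : {measure set (X * R) -> \bar R} :=
  measure_function_pushforward__canonical__measure_function_Measure rho measurable_shift.
apply: (@eq_measure_integral _ _ _ _ nu PM) => A mA _.
apply: (@measure_unique _ _ _ [set A `*` B | A in measurable & B in measurable]
   (fun n => F n `*` setT)) => //.
- exact: measurable_prod_measurableType.
- move=> _ _ [A1 mA1 [B1 mB1 <-]] [A2 mA2 [B2 mB2 <-]].
  exists (A1 `&` A2); first exact: measurableI.
  by exists (B1 `&` B2); [exact: measurableI|rewrite setXI].
- by move=> n; exists (F n); [exact: (mF n).1|exists setT].
- by rewrite -setX_bigcupl -FT setXTT.
- by move=> _ [A1 mA1 [B1 mB1 <-]]; exact: rectE.
- move=> n; rewrite /PM /= /pushforward.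
  have -> : Phi @^-1` (F n `*` setT) = (phi @^-1` F n) `*` setT by [].
  rewrite sdprodX//; last exact/measurable_preim/(mF n).1.
  under eq_integral do rewrite prob_kernel.
  rewrite integral_cst ?mul1e; last exact/measurable_preim/(mF n).1.
  by apply: preim_fin; [exact: (mF n).1|exact: (mF n).2].
Qed.

Lemma integral_preim (f : R -> \bar R) D : measurable D ->
  measurable_fun setT f -> (forall t, 0 <= f t) ->
  \int[mu]_(x in phi @^-1` D) \int[P x]_t f t =
  \int[mu]_(x in D) \int[P x]_t (f t * `|t|%:E).
Proof.
move=> mD mf f0.
pose g (z : X * R) : \bar R := (\1_D z.1)%:E * f z.2.
have mg : measurable_fun setT g.
  apply: emeasurable_funM.
    by apply/measurable_EFinP; exact: (measurableT_comp (measurable_indic mD) measurable_fst).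
  exact: (measurableT_comp mf measurable_snd).
have g0 z : 0 <= g z by rewrite mule_ge0// lee_fin.
have := integral_shift mg g0.
rewrite !integral_sdprod//; last 3 first.
- by apply: emeasurable_funM.
- by move=> z; rewrite mule_ge0// lee_fin.
- exact: (measurableT_comp mg measurable_shift).
rewrite [\int[mu]_(x in phi @^-1` D) _]integral_mkcond [\int[mu]_(x in D) _]integral_mkcond.
have i1 x (k : R -> \bar R) : (forall t, 0 <= k t) -> measurable_fun setT k ->
   \int[P x]_t ((\1_D x)%:E * k t) = ((fun x => \int[P x]_t k t) \_ D) x.
  move=> k0 mk; rewrite patchE indicE; case: (x \in D).
    by under eq_integral do rewrite mul1e.
  by rewrite integral0_eq// => t _; rewrite mul0e.
move=> E; transitivity (\int[mu]_x \int[P x]_t g (Phi (x, t))).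
  apply: eq_integral => x _; rewrite /g /= !patchE.
  have -> : (x \in phi @^-1` D) = (phi x \in D) by apply/idP/idP; rewrite !inE.
  rewrite indicE; case: (phi x \in D).
    by under [RHS]eq_integral do rewrite mul1e.
  by rewrite integral0_eq// => t _; rewrite mul0e.
rewrite E; apply: eq_integral => x _; rewrite /g /=.
under eq_integral do rewrite -muleA.
by rewrite i1// => [t|]; [rewrite mule_ge0// lee_fin|apply: emeasurable_funM => //; exact: measurable_abs_EFin].
Qed.

Fixpoint preim_iter n (D : set X) : set X :=
  if n is n'.+1 then phi @^-1` (preim_iter n' D) else D.

Lemma measurable_preim_iter n D : measurable D -> measurable (preim_iter n D).
Proof. by move=> mD; elim: n => //= n IH; exact: measurable_preim. Qed.

Lemma preim_iterSr n D : preim_iter n.+1 D = preim_iter n (phi @^-1` D).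
Proof. by elim: n => //= n ->. Qed.

Lemma measure_preim_iter n D : measurable D ->
  mu (preim_iter n D) = \int[mu]_(x in D) \int[P x]_t (`|t| ^+ n)%:E.
Proof.
elim: n D => [|n IH] D mD.
  under eq_integral => x _ do under eq_integral => t _ do rewrite expr0.
  under eq_integral => x _ do rewrite integral_cst// prob_kernel mul1e.
  by rewrite integral_cst// mul1e.
rewrite preim_iterSr IH; last exact: measurable_preim.
rewrite integral_preim//; last exact: measurable_powabs.
by under eq_integral => x _ do under eq_integral => t _ do rewrite -EFinM -exprSr.
Qed.

End KernelIdentity.

(** * The norm of the composition operator and measures of preimages *)

Section CompositionNorm.
Context d (X : measurableType d) (R : realType).
Variables (mu : {measure set X -> \bar R}) (phi : X -> X).
Hypotheses (ns : nonsingular mu phi) (bd : Cphi_bounded mu phi).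

Lemma L2_scaled_indic (a : R) D : measurable D -> (mu D < +oo)%E ->
  L2 mu (fun x => ((a * \1_D x)%:C)%C) /\
  L2nsq mu (fun x => ((a * \1_D x)%:C)%C) = a ^+ 2 * fine (mu D).
Proof.
move=> mD Doo.
have iE : (\int[mu]_x (csq ((a * \1_D x)%:C)%C)%:E = (a ^+ 2)%:E * mu D)%E.
  under eq_integral => x _.
    rewrite /csq /= expr0n addr0 exprMn EFinM.
    have -> : (\1_D x : R) ^+ 2 = \1_D x by rewrite indicE; case: (x \in D); rewrite ?expr1n ?expr0n.
    over.
  rewrite ge0_integralZl_EFin ?sqr_ge0//; last exact/measurable_EFinP/measurable_indic.
  by rewrite integral_indic// setIT.
have fD : mu D \is a fin_num by rewrite ge0_fin_numE.
split; last by rewrite /L2nsq iE fineM.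
split => /=; [|exact: measurable_cst|by rewrite iE -(fineK fD) ltry].
by apply: measurable_funM => //; exact: measurable_indic.
Qed.

Lemma L2nsq_ge0 f : 0 <= L2nsq mu f.
Proof. by apply: fine_ge0; apply: integral_ge0 => x _; rewrite lee_fin csq_ge0. Qed.

Lemma Cphi_norm2_fin : exists2 c : R, 0 <= c & Cphi_norm2 mu phi = c%:E.
Proof.
have [_ [c0 hc]] := bd.
have ub : (Cphi_norm2 mu phi <= (Num.max c0 0)%:E)%E.
  apply: ge_ereal_sup => _ [f [Lf f1] <-]; rewrite lee_fin.
  apply: le_trans (hc f Lf) _; apply: (@le_trans _ _ (Num.max c0 0 * L2nsq mu f)).
    by rewrite ler_wpM2r ?L2nsq_ge0// le_max lexx.
  by rewrite ler_piMr// le_max lexx orbT.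
have lb : (0 <= Cphi_norm2 mu phi)%E.
  have z : L2nsq mu (0 : X -> R[i]) = 0.
    rewrite /L2nsq integral0_eq// => x _; congr EFin.
    by rewrite /csq expr0n addr0.
  apply: ereal_sup_ubound => /=; exists 0; last exact: (congr1 EFin z).
  by split; [exact: L2_0|rewrite z ler01].
exists (fine (Cphi_norm2 mu phi)); first exact: fine_ge0.
by rewrite fineK// ge0_fin_numE//; exact: le_lt_trans ub (ltry _).
Qed.

(** C_phi maps the indicator of D to that of its preimage. The supremum [Cphi_norm2] runs over the
    unit ball, so the indicator is divided by the square root of mu(D); null sets are left to
    nonsingularity. *)
Lemma measure_preim_le c D : Cphi_norm2 mu phi = c%:E -> measurable D ->
  (mu D < +oo)%E -> (mu (phi @^-1` D) <= c%:E * mu D)%E.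
Proof.
move=> cE mD Doo.
have mpD : measurable (phi @^-1` D) by exact: (measurable_preim ns.1).
have [D0|D0] := eqVneq (mu D) 0%E; first by rewrite D0 mule0 ns.2.
have indE a : (fun x => ((a * \1_D x)%:C)%C) \o phi =
    (fun x => ((a * \1_(phi @^-1` D) x)%:C)%C) :> (X -> R[i]).
  by apply/funext => x /=; rewrite !indicE; congr ((_ * _%:R)%:C)%C; apply/idP/idP; rewrite !inE.
have pDoo : (mu (phi @^-1` D) < +oo)%E.
  have [L1 _] := L2_scaled_indic 1 mD Doo.
  have [_ _] := bd.1 _ L1; rewrite indE.
  under eq_integral => x _.
    rewrite /csq /= expr0n addr0 mul1r.
    have -> : (\1_(phi @^-1` D) x : R) ^+ 2 = \1_(phi @^-1` D) x.
      by rewrite indicE; case: (x \in _); rewrite ?expr1n ?expr0n.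
    over.
  by rewrite integral_indic// setIT.
have fD : mu D \is a fin_num by rewrite ge0_fin_numE.
have fpD : mu (phi @^-1` D) \is a fin_num by rewrite ge0_fin_numE.
set m := fine (mu D).
have m0 : 0 < m by rewrite fine_gt0// lt0e D0 Doo measure_ge0.
pose a := (Num.sqrt m)^-1.
have a2 : a ^+ 2 = m^-1 by rewrite exprVn sqr_sqrtr// ltW.
have [La na] := L2_scaled_indic a mD Doo.
have : ((L2nsq mu ((fun x => ((a * \1_D x)%:C)%C) \o phi))%:E <= Cphi_norm2 mu phi)%E.
  apply: ereal_sup_ubound => /=; exists (fun x => ((a * \1_D x)%:C)%C) => //.
  by split => //; rewrite na a2 mulVf// gt_eqF.
rewrite indE (L2_scaled_indic a mpD pDoo).2 cE lee_fin a2 mulrC ler_pdivrMr// => h.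
by rewrite -(fineK fD) -(fineK fpD) -EFinM lee_fin.
Qed.

Lemma measure_preim_fin D : measurable D -> (mu D < +oo)%E -> (mu (phi @^-1` D) < +oo)%E.
Proof.
move=> mD Doo; have [c c0 cE] := Cphi_norm2_fin.
apply: le_lt_trans (measure_preim_le cE mD Doo) _.
by rewrite -[mu D]fineK ?ge0_fin_numE// -EFinM ltry.
Qed.

Lemma measure_preim_iter_le c n D : Cphi_norm2 mu phi = c%:E -> 0 <= c ->
  measurable D -> (mu D < +oo)%E ->
  (mu (preim_iter phi n D) <= (c ^+ n)%:E * mu D)%E /\ (mu (preim_iter phi n D) < +oo)%E.
Proof.
move=> cE c0 mD Doo; elim: n => [|n [IH Ioo]] /=; first by rewrite expr0 mul1e.
have mn : measurable (preim_iter phi n D) by exact: (measurable_preim_iter ns.1).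
split; last exact: measure_preim_fin.
apply: le_trans (measure_preim_le cE mn Ioo) _.
by rewrite exprS EFinM -muleA; apply: lee_pmul.
Qed.

End CompositionNorm.

Lemma measurable_abs_gt (R : realType) (c : R) : measurable [set t : R | c < `|t|].
Proof.
rewrite (_ : [set t : R | _] = (fun t : R => `|t|) @^-1` `]c, +oo[%classic); last first.
  by apply/seteqP; split => t /=; rewrite in_itv/= andbT.
by rewrite -[X in measurable X]setTI; exact: (@normr_measurable R setT).
Qed.

(** Markov's inequality: the mass of |t| >= c + e is at most (c/(c + e))^n for every n. *)
Lemma moment_support (R : realType) (nu : {measure set R -> \bar R}) (c : R) :
  0 <= c -> (forall n, (\int[nu]_t (`|t| ^+ n)%:E <= (c ^+ n)%:E)%E) ->
  nu [set t | c < `|t|] = 0%E.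
Proof.
move=> c0 hm.
pose A k := [set t : R | c + k.+1%:R^-1 <= `|t|].
have mA k : measurable (A k).
  rewrite (_ : A k = (fun t : R => `|t|) @^-1` `[c + k.+1%:R^-1, +oo[%classic); last first.
    by apply/seteqP; split => t /=; rewrite in_itv/= andbT.
  rewrite -[X in measurable X]setTI; apply: (@normr_measurable R setT) => //.
have A0 k : nu (A k) = 0%E.
  have e0 : 0 < (k.+1%:R^-1 : R) by rewrite invr_gt0 ltr0n.
  have := mA k; rewrite /A => {}mA; move: (k.+1%:R^-1 : R) e0 mA => e e0 mA.
  set B := [set t : R | c + e <= `|t|] in mA *.
  have ce : 0 < c + e by rewrite ltr_wpDl.
  have bnd n : ((((c + e) ^+ n)%:E * nu B) <= (c ^+ n)%:E)%E.
    apply: le_trans _ (hm n); rewrite -integral_cst//.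
    apply: (@le_trans _ _ (\int[nu]_(t in B) (`|t| ^+ n)%:E)%E).
      apply: ge0_le_integral => //.
      - by move=> t _; rewrite lee_fin exprn_ge0// ltW.
      - by apply: measurable_funTS; exact: measurable_powabs.
      - by move=> t Bt; rewrite lee_fin lerXn2r// nnegrE ltW.
    apply: ge0_subset_integral => //.
    exact: measurable_powabs.
  have Boo : (nu B < +oo)%E.
    have := bnd 0%N; rewrite !expr0 mul1e => h; exact: le_lt_trans h (ltry _).
  apply/eqP; rewrite eq_le measure_ge0 andbT.
  have Bf : nu B \is a fin_num by rewrite ge0_fin_numE.
  rewrite -(fineK Bf) lee_fin.
  have cv : (c / (c + e)) ^+ n @[n --> \oo] --> (0 : R).
    apply: cvg_expr; rewrite ger0_norm; last by apply: divr_ge0 => //; exact: ltW.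
    by rewrite ltr_pdivrMr// mul1r ltrDl.
  have cB : (fun=> fine (nu B)) @ \oo --> fine (nu B) by exact: cvg_cst.
  apply: (ler_cvg_to cB cv).
  apply: nearW => n; rewrite expr_div_n ler_pdivlMr ?exprn_gt0// mulrC.
  by rewrite -lee_fin EFinM fineK.
have sub : [set t : R | c < `|t|] `<=` \bigcup_k A k.
  move=> t /= ct; have tc : 0 < `|t| - c by rewrite subr_gt0.
  have [k hk] := invS_lt tc; exists k => //=.
  by rewrite /A /= addrC -lerBrDr ltW.
have mS := measurable_abs_gt c.
apply: measure_negligible => //; apply: negligibleS sub _.
by apply: negligible_bigcup => k; exists (A k); split.
Qed.

Lemma ge0_integral_eq0_ae d (T : measurableType d) (R : realType)
    (mu : {measure set T -> \bar R}) (f : T -> \bar R) :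
  measurable_fun setT f -> (forall x, 0 <= f x)%E ->
  (\int[mu]_x f x = 0)%E -> {ae mu, forall x, f x = 0%E}.
Proof.
move=> mf f0 i0.
have /(ae_eq_integral_abs mu measurableT mf) : (\int[mu]_x `|f x| = 0)%E.
  by under eq_integral do rewrite gee0_abs//.
by apply: filterS => x; apply.
Qed.

Lemma measurable_Rplus (R : realType) : measurable [set t : R | 0 <= t].
Proof.
rewrite (_ : [set t | _] = `[0, +oo[%classic); first exact: measurable_itv.
by apply/seteqP; split => t /=; rewrite in_itv/= andbT.
Qed.

Lemma on_Rplus_null d (X : measurableType d) (R : realType) (P : R.-pker X ~> R) x :
  on_Rplus P -> P x (~` [set t : R | 0 <= t]) = 0%E.
Proof.
move=> Ppos.
have : (P x [set t | (0 <= t)%R] + P x (~` [set t | (0 <= t)%R]) = 1)%E.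
  rewrite -measureU//; last exact: setICr.
  - by rewrite setUv; exact: prob_kernel.
  - exact: measurable_Rplus.
  - by apply: measurableC; exact: measurable_Rplus.
rewrite (Ppos x); case: (P x _) => [r|//|//] /(congr1 fine) /= /eqP.
by rewrite -subr_eq0 addrAC subrr add0r => /eqP ->.
Qed.

Section ShiftIdentityConsequences.
Context d (X : measurableType d) (R : realType).
Variables (mu : {measure set X -> \bar R}) (phi : X -> X).
Hypotheses (sf : sigma_finite setT mu) (ns : nonsingular mu phi).
Hypothesis bd : Cphi_bounded mu phi.

Let mphi := ns.1.
Let preim_fin := measure_preim_fin ns bd.

Lemma measurable_moment (P : R.-pker X ~> R) n :
  measurable_fun setT (fun x => \int[P x]_t (`|t| ^+ n)%:E)%E.
Proof. by apply: measurable_kernel_weight => //; exact: measurable_powabs. Qed.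

(** (K) with D = X and s = {0}, where |t| vanishes. This makes the weight |t| positive a.e., as the
    polar decomposition requires, and later excludes h = 0. *)
Lemma shift_identity_zero (P : R.-pker X ~> R) : shift_identity mu phi P ->
  {ae mu, forall x, P x [set 0] = 0%E}.
Proof.
move=> kid; apply: ge0_integral_eq0_ae => //; first exact: measurable_kernel.
rewrite -[X in (\int[_]_(x in X) _)%E](preimage_setT phi) kid//.
rewrite integral0_eq// => x _; rewrite integral0_eq// => t ->.
by rewrite normr0.
Qed.

Lemma shift_identity_support (P : R.-pker X ~> R) c :
  0 <= c -> Cphi_norm2 mu phi = c%:E -> on_Rplus P -> shift_identity mu phi P ->
  {ae mu, forall x, P x (~` `[0, c]) = 0%E}.
Proof.
move=> c0 cE Ppos kid.
have mom : {ae mu, forall x, forall n, (\int[P x]_t (`|t| ^+ n)%:E <= (c ^+ n)%:E)%E}.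
  apply: ae_foralln => n; apply: (ae_le_integral sf) => //.
  - exact: measurable_moment.
  - by move=> x; apply: integral_ge0 => t _; rewrite lee_fin exprn_ge0.
  - by move=> x; rewrite lee_fin exprn_ge0.
  move=> D mD Doo; rewrite -(measure_preim_iter mphi sf preim_fin kid)// integral_cst//.
  exact: (measure_preim_iter_le ns bd n cE c0 mD Doo).1.
apply: filterS mom => x /(moment_support c0) h1.
have h2 := on_Rplus_null x Ppos.
apply: measure_negligible; first by apply: measurableC; exact: measurable_itv.
apply: (@negligibleS _ _ _ _ ([set t | c < `|t|] `|` ~` [set t | 0 <= t])).
  move=> t /= /negP; rewrite in_itv/= negb_and -!ltNge => /orP[t0|ct].
    by right => /=; apply/negP; rewrite -ltNge.
  by left; apply: lt_le_trans ct (ler_norm t).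
apply: negligibleU; apply/negligibleP => //.
  exact: measurable_abs_gt.
by apply: measurableC; exact: measurable_Rplus.
Qed.

Lemma shift_identity_subnormal (P : R.-pker X ~> R) :
  on_Rplus P -> shift_identity mu phi P -> Cphi_subnormal mu phi.
Proof.
move=> Ppos kid; have [c c0 cE] := Cphi_norm2_fin bd.
pose Phi (z : X * R) : X * R := (phi z.1, z.2).
have null A : measurable A -> {ae mu, forall x, P x A = 0%E} ->
    sdprod mu P (setT `*` A) = 0%E.
  move=> mA h; rewrite sdprodX// (ge0_ae_eq_integral (g := cst 0%E))//.
  - by rewrite integral0.
  - exact: measurable_kernel.
  - by apply: filterS h => x -> _.
have wpos : {ae sdprod mu P, forall z, 0 < `|z.2|}.
  exists (setT `*` [set 0]); split.
  - exact: measurableX.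
  - by apply: null => //; exact: shift_identity_zero.
  - by move=> z /= /negP; rewrite normr_gt0 negbK => /eqP.
have wc : {ae sdprod mu P, forall z, `|z.2| <= c}.
  exists (setT `*` ~` `[0, c]); split.
  - by apply: measurableX => //; apply: measurableC; exact: measurable_itv.
  - apply: null; last exact: shift_identity_support.
    by apply: measurableC; exact: measurable_itv.
  - move=> z /= zc; split => //; apply: contra_not zc.
    by rewrite in_itv/= => /andP[z0 zc]; rewrite ger0_norm.
have mw : measurable_fun setT (fun z : X * R => `|z.2|).
  exact: (measurableT_comp (@normr_measurable R setT) measurable_snd).
have [K [ip [J [N [hK Jlin Jn hN NJ]]]]] := quasinormal_extension
  (measurable_shift mphi) mw (fun z => normr_ge0 z.2) wpos wc (fun=> erefl)
  (integral_shift mphi sf preim_fin kid).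
have intE f : L2 mu f ->
    (\int[sdprod mu P]_z (csq (f z.1))%:E = \int[mu]_x (csq (f x))%:E)%E.
  move=> [m1 m2 _]; have mc : measurable_fun setT (fun x => (csq (f x))%:E).
    exact: measurable_csq.
  rewrite integral_sdprod//.
  - apply: eq_integral => x _ /=.
    by rewrite integral_cst// prob_kernel mule1.
  - exact: (measurableT_comp mc measurable_fst).
  - by move=> z; rewrite lee_fin csq_ge0.
have L2fst f : L2 mu f -> L2 (sdprod mu P) (f \o fst).
  move=> Lf; have [m1 m2 foo] := Lf; split.
  - exact: (measurableT_comp m1 measurable_fst).
  - exact: (measurableT_comp m2 measurable_fst).
  - by rewrite intE.
exists K, ip, (fun f => J (f \o fst)), N; split => //.
- move=> a f g Lf Lg; exact: (Jlin a (f \o fst) (g \o fst) (L2fst f Lf) (L2fst g Lg)).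
- by move=> f Lf; rewrite (Jn _ (L2fst f Lf)) /L2nsq intE.
- by move=> f Lf; rewrite (NJ _ (L2fst f Lf)).
Qed.

Lemma shift_identity_unique (P1 P2 : R.-pker X ~> R) :
  on_Rplus P1 -> on_Rplus P2 -> shift_identity mu phi P1 -> shift_identity mu phi P2 ->
  {ae mu, forall x, forall s, measurable s -> P1 x s = P2 x s}.
Proof.
move=> pos1 pos2 kid1 kid2; have [c c0 cE] := Cphi_norm2_fin bd.
(* [moments_unique] asks for an interval of positive length, while the norm may be 0. *)
have c1 : 0 < c + 1 by rewrite ltr_wpDl.
have mom : {ae mu, forall x, forall n,
    (\int[P1 x]_t (`|t| ^+ n)%:E = \int[P2 x]_t (`|t| ^+ n)%:E)%E}.
  apply: ae_foralln => n; apply: (ae_eq_integral_sets sf).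
  - exact: measurable_moment.
  - exact: measurable_moment.
  - by move=> x; apply: integral_ge0 => t _; rewrite lee_fin exprn_ge0.
  - by move=> x; apply: integral_ge0 => t _; rewrite lee_fin exprn_ge0.
  by move=> D mD Doo; rewrite -!(measure_preim_iter mphi sf preim_fin)//.
have sub (P : R.-pker X ~> R) x : P x (~` `[0, c]) = 0%E -> P x (~` `[0, c + 1]) = 0%E.
  move=> h; apply/eqP; rewrite -measure_le0 -h; apply: le_measure; rewrite ?inE.
  - by apply: measurableC; exact: measurable_itv.
  - by apply: measurableC; exact: measurable_itv.
  apply: subsetC => t /=; rewrite !in_itv/= => /andP[-> tc] /=.
  by apply: le_trans tc _; rewrite lerDl.
apply: filterS3 (shift_identity_support c0 cE pos1 kid1)
  (shift_identity_support c0 cE pos2 kid2) mom => x s1 s2 m12.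
apply: (moments_unique c1) => //.
- by rewrite prob_kernel ltry.
- by rewrite prob_kernel ltry.
- exact: sub.
- exact: sub.
Qed.

End ShiftIdentityConsequences.

Lemma ediv_mulK (R : realType) (a b : \bar R) :
  (0 < b)%E -> (b < +oo)%E -> (ediv a b * b)%E = a.
Proof.
move=> b0 boo; have bf : b \is a fin_num by rewrite ge0_fin_numE// ltW.
rewrite /ediv gt_eqF// lt_eqF// -muleA -{2}(fineK bf) -EFinM mulVf ?mule1//.
by rewrite gt_eqF// fine_gt0// b0.
Qed.

Lemma ediv_unique (R : realType) (a b w : \bar R) :
  (0 < b)%E -> (b < +oo)%E -> (w * b)%E = a -> w = ediv a b.
Proof.
move=> b0 boo <-; have bf : b \is a fin_num by rewrite ge0_fin_numE// ltW.
rewrite /ediv gt_eqF// lt_eqF// -muleA -{1}(fineK bf) -EFinM mulfV ?mule1//.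
by rewrite gt_eqF// fine_gt0// b0.
Qed.

Lemma integral_Rplus d (X : measurableType d) (R : realType) (P : R.-pker X ~> R) x
    (s : set R) : on_Rplus P -> measurable s ->
  P x s = P x (s `&` [set t | 0 <= t]) /\
  (\int[P x]_(t in s) `|t|%:E = \int[P x]_(t in s `&` [set t | (0 <= t)%R]) t%:E)%E.
Proof.
move=> Ppos ms; have mp := @measurable_Rplus R; have n0 := on_Rplus_null x Ppos.
split.
  rewrite -{1}(setIT s) -integral_indic// (integral_conull mp n0)//.
  - by rewrite integral_indic// setIC.
  - by apply/measurable_EFinP/measurable_indic.
rewrite -integral_indicl (integral_conull mp n0).
- rewrite [LHS]integral_mkcond [RHS]integral_mkcond; apply: eq_integral => t _.
  rewrite !patchE in_setI indicE; case: (boolP (t \in [set t | 0 <= t])) => [|_]; last by rewrite andbF.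
  rewrite inE/= andbT => t0; rewrite ger0_norm//.
  by case: (t \in s); rewrite ?mul1e ?mul0e.
- apply: emeasurable_funM; last exact: measurable_abs_EFin.
  by apply/measurable_EFinP/measurable_indic.
- by move=> t; rewrite mule_ge0// lee_fin.
Qed.

(** * Translation of (CC) and (CC^-1) into (K) *)

Section ConsistencyCondition.
Context d (X : measurableType d) (R : realType).
Variables (mu : {measure set X -> \bar R}) (phi : X -> X) (h : X -> \bar R)
  (E : (X -> \bar R) -> X -> \bar R).
Hypotheses (sf : sigma_finite setT mu) (ns : nonsingular mu phi).
Hypotheses (bd : Cphi_bounded mu phi) (hh : is_hphi mu phi h).
Hypothesis hE : forall f : X -> \bar R, measurable_fun setT f ->
  (forall x, (0 <= f x)%E) -> is_condexp mu phi f (E f).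
Local Open Scope ereal_scope.

Let mphi := ns.1.
Let mh : measurable_fun setT h. Proof. by case: hh. Qed.
Let h0 x : 0 <= h x. Proof. by case: hh. Qed.
Let hD D : measurable D -> mu (phi @^-1` D) = \int[mu]_(x in D) h x.
Proof. by case: hh => _ _; exact. Qed.

Lemma ae_comp (Q : X -> Prop) : {ae mu, forall x, Q x} -> {ae mu, forall x, Q (phi x)}.
Proof.
move=> [A [mA A0 AQ]]; exists (phi @^-1` A); split.
- exact: measurable_preim.
- exact: ns.2.
- by move=> x /= nQ; apply: AQ.
Qed.

Lemma hphi_ae_fin : {ae mu, forall x, h x < +oo}.
Proof.
have [c c0 cE] := Cphi_norm2_fin bd.
have : {ae mu, forall x, h x <= c%:E}.
  apply: (ae_le_integral sf) => //.
  move=> D mD Doo; rewrite -hD// integral_cst//; exact: measure_preim_le.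
by apply: filterS => x hx; exact: le_lt_trans hx (ltry _).
Qed.

Lemma condexp_factor (f : X -> \bar R) : measurable_fun setT f -> (forall x, 0 <= f x) ->
  exists w : X -> \bar R, [/\ measurable_fun setT w, forall x, 0 <= w x &
    forall x, E f x = w (phi x)].
Proof. by move=> mf f0; have [E0 Em _] := hE mf f0; exact: factor_through. Qed.

(** Test the definition of [E f] with the indicator of D composed with phi, then change variables.
    The conditional expectation now enters integrals over preimages only through [w x * h x]. *)
Lemma condexp_integral (f w : X -> \bar R) D :
  measurable_fun setT f -> (forall x, 0 <= f x) ->
  measurable_fun setT w -> (forall x, 0 <= w x) ->
  (forall x, E f x = w (phi x)) -> measurable D ->
  \int[mu]_(x in phi @^-1` D) f x = \int[mu]_(x in D) (w x * h x).
Proof.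
move=> mf f0 mw w0 Ew mD; have [_ _ Ei] := hE mf f0.
have mI : measurable_fun setT (fun x => (\1_D x : R)%:E).
  by apply/measurable_EFinP/measurable_indic.
have I0 x : 0 <= (\1_D x : R)%:E by rewrite lee_fin.
have := Ei _ mI I0.
under [X in _ = X -> _]eq_integral do rewrite Ew.
rewrite (@integral_comp_hphi _ _ _ mu phi h mphi hh (fun x => (\1_D x)%:E * w x)).
- under [X in _ = X -> _]eq_integral do rewrite -muleA.
  move=> Hu; rewrite -integral_indicl -[RHS]integral_indicl -Hu.
  exact: eq_integral.
- exact: emeasurable_funM.
- by move=> x; rewrite mule_ge0.
Qed.

(** The integral of h over A vanishes while h > 0. This converse of nonsingularity turns a.e.
    statements at [phi x] into a.e. statements at x. *)
Lemma null_of_preim A : {ae mu, forall x, 0 < h x} -> measurable A ->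
  mu (phi @^-1` A) = 0 -> mu A = 0.
Proof.
move=> hpos mA; rewrite hD// -integral_indicl => i0.
have := ge0_integral_eq0_ae _ _ i0.
have mI : measurable_fun setT (fun x => (\1_A x : R)%:E * h x).
  by apply: emeasurable_funM => //; apply/measurable_EFinP/measurable_indic.
move=> /(_ mI (fun x => mule_ge0 _ (h0 x))) => H.
apply: measure_negligible => //.
have : {ae mu, forall x, ~ A x}.
  apply: filterS2 hpos (H _) => [x hx|x]; last by rewrite lee_fin.
  rewrite indicE; case: (boolP (x \in A)) => [_|/negP xA _ Ax]; last by apply: xA; rewrite inE.
  by rewrite mul1e => hx0; move: hx; rewrite hx0 ltxx.
by apply: negligibleS => x /= Ax; exact.
Qed.

Lemma hphi_comp_neq0 : {ae mu, forall x, h (phi x) != 0}.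
Proof.
pose D := [set x | h x = 0].
have mD : measurable D by rewrite -[D]setTI; exact: (measurable_eqe measurableT mh).
exists (phi @^-1` D); split.
- exact: measurable_preim.
- by rewrite hD// integral0_eq.
- by move=> x /= /negP; rewrite negbK => /eqP.
Qed.

(** h is nonzero along phi, so C_phi kills the indicator of {h = 0}; intersecting with [F n] puts
    that indicator in L2. *)
Lemma injective_hphi_gt0 : Cphi_injective mu phi -> {ae mu, forall x, 0 < h x}.
Proof.
move=> inj; have [F FT mF] := sf.
pose D n := F n `&` [set x | h x = 0].
have mD n : measurable (D n) by apply: (measurable_eqe (mF n).1) => //; exact: measurable_funTS.
have D0 n : mu (D n) = 0.
  have Doo : mu (D n) < +oo.
    apply: le_lt_trans (mF n).2; apply: le_measure; rewrite ?inE//; first exact: (mF n).1.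
    by move=> x [].
  have [Lf _] := L2_scaled_indic 1 (mD n) Doo.
  apply: measure_negligible => //.
  have : {ae mu, forall x, ((1 * \1_(D n) (phi x))%:C)%C = 0%R :> R[i]}.
    apply: filterS hphi_comp_neq0 => x hx; rewrite indicE memNset ?mulr0//.
    by move=> [_ /= hx0]; rewrite hx0 eqxx in hx.
  move=> /(inj _ Lf); apply: negligibleS => x /= Dx.
  by rewrite indicE mem_set// mul1r => /eqP; rewrite eq_complex/= oner_eq0.
exists (\bigcup_n D n); split.
- exact: bigcupT_measurable.
- apply: measure_negligible; first exact: bigcupT_measurable.
  by apply: negligible_bigcup => n; exists (D n); split.
- move=> x /= /negP; rewrite lt0e h0 andbT negbK => /eqP hx.
  have : [set: X] x by []. rewrite FT => -[n _ Fx]; by exists n.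
Qed.

Lemma hphi_gt0_injective : {ae mu, forall x, 0 < h x} -> Cphi_injective mu phi.
Proof.
move=> hpos f [m1 m2 _] f0.
pose A := [set x | (csq (f x))%:E != 0].
have mA : measurable A.
  by rewrite -[A]setTI; apply: emeasurable_neq => //; exact: measurable_csq.
have csq0 z : (csq z)%:E = 0 -> z = 0%R :> R[i].
  move=> [] /eqP; rewrite paddr_eq0 ?sqr_ge0// !sqrf_eq0 => zz.
  by apply/eqP; rewrite eq_complex.
have pA : mu (phi @^-1` A) = 0.
  apply: measure_negligible; first exact: measurable_preim.
  apply: negligibleS f0 => x /= Ax fx0; move: Ax.
  by rewrite /A /= fx0 /csq/= expr0n addr0 eqxx.
exists A; split => //; first exact: null_of_preim.
by move=> x /= fx; apply/negP => /eqP /csq0.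
Qed.

Variable P : R.-pker X ~> R.
Hypothesis Ppos : on_Rplus P.

Let V s x := \int[P x]_(t in s) `|t|%:E.
Let mV s : measurable s -> measurable_fun setT (V s).
Proof. by move=> ms; apply: measurable_kernel_weight => //; exact: measurable_abs_EFin. Qed.
Let V0 s x : 0 <= V s x. Proof. by apply: integral_ge0 => t _; rewrite lee_fin. Qed.
Let mP s : measurable s -> measurable_fun setT (fun y => P y s).
Proof. by move=> ms; exact: measurable_kernel. Qed.

Let VE s x : borel_Rplus s -> \int[P x]_(t in s) t%:E = V s x.
Proof.
move=> [ms sp]; rewrite /V (integral_Rplus x Ppos ms).2.
by congr (integral _ _ _); apply/esym/setIidPl.
Qed.

(** The two sides of (K) are the integrals over D of [w x * h x] and of [V s x]. The factor w is not
    unique where h = 0, but its product with h is determined a.e., hence the quantification over all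
    w. *)
Lemma shift_identity_ae :
  (forall s, borel_Rplus s -> forall w, measurable_fun setT w -> (forall x, 0 <= w x) ->
     (forall x, E (fun y => P y s) x = w (phi x)) ->
     {ae mu, forall x, w x * h x = V s x}) <->
  shift_identity mu phi P.
Proof.
split.
  move=> H D s mD ms; pose s' := s `&` [set t : R | (0 <= t)%R].
  have bs' : borel_Rplus s'.
    by split; [apply: measurableI => //; exact: measurable_Rplus|move=> t []].
  have [w [mw w0 Ew]] := condexp_factor (mP bs'.1) (fun x => measure_ge0 _ _).
  under eq_integral => x _ do rewrite (integral_Rplus x Ppos ms).1.
  rewrite (condexp_integral (mP bs'.1) _ mw w0 Ew)//; apply: ge0_ae_eq_integral => //.
  - by apply: measurable_funTS; exact: emeasurable_funM.
  - by apply: measurable_funTS; exact: mV.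
  - by move=> x _; rewrite mule_ge0.
  - by move=> x _; exact: V0.
  apply: filterS (H s' bs' w mw w0 Ew) => x -> _.
  by rewrite -VE// (integral_Rplus x Ppos ms).2.
move=> kid s bs w mw w0 Ew.
apply: (ae_eq_integral_sets sf) => //.
- exact: emeasurable_funM.
- exact: mV bs.1.
- by move=> x; rewrite mule_ge0.
move=> D mD _; rewrite -kid//; last exact: bs.1.
by rewrite (condexp_integral (mP bs.1) _ mw w0 Ew).
Qed.

(** On {h = 0}, (K) with s = R says that |t| has zero integral against P(x, .), which is then
    concentrated at 0; [shift_identity_zero] forbids this a.e. *)
Lemma shift_identity_gt0 : shift_identity mu phi P -> {ae mu, forall x, 0 < h x}.
Proof.
move=> kid; pose D := [set x | h x = 0].
have mD : measurable D by rewrite -[D]setTI; exact: (measurable_eqe measurableT mh).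
have i0 : \int[mu]_x ((\1_D x)%:E * V setT x) = 0.
  rewrite integral_indicl -kid//; under eq_integral do rewrite prob_kernel.
  rewrite integral_cst ?mul1e ?hD//; last exact: measurable_preim.
  exact: integral0_eq.
have : {ae mu, forall x, (\1_D x)%:E * V setT x = 0}.
  apply: ge0_integral_eq0_ae i0.
    apply: emeasurable_funM; last exact: mV.
    by apply/measurable_EFinP/measurable_indic.
  by move=> x; rewrite mule_ge0// lee_fin.
apply: filterS2 (shift_identity_zero kid) => x P0 Vx.
rewrite lt0e h0 andbT; apply/eqP => hx.
move: Vx; rewrite indicE mem_set// mul1e => Vx.
have [A [mA PA AN]] := ge0_integral_eq0_ae (@measurable_abs_EFin R) (fun t => normr_ge0 t) Vx.
have : P x setT <= P x (~` [set 0%R]) + P x [set 0%R].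
  by rewrite -{1}(setvU [set 0%R]); apply: measureU2 => //; exact: measurableC.
rewrite [in X in _ <= _ + X -> _]P0 adde0.
have -> : P x (~` [set 0%R]) = 0.
  apply/eqP; rewrite -measure_le0 -PA; apply: le_measure; rewrite ?inE//.
    exact: measurableC.
  by move=> t /= t0; apply: AN => /= -[] /eqP; rewrite normr_eq0 => /eqP.
by rewrite prob_kernel lee_fin ler10.
Qed.

Lemma shift_identity_injective : shift_identity mu phi P -> Cphi_injective mu phi.
Proof. by move=> /shift_identity_gt0; exact: hphi_gt0_injective. Qed.

Lemma shift_identity_CCinv : CCinv mu phi h E P <-> shift_identity mu phi P.
Proof.
split.
  move=> cc; apply/shift_identity_ae => s bs w mw w0 Ew.
  (* The normalisation of E o phi^-1 asks for 0 where h = 0. Neither the product with h nor, up to a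
     null set, the values along phi are affected. *)
  pose g x := if h x == 0 then 0 else w x.
  have hg : is_Einv mu phi h (E (fun y => P y s)) g.
    split.
    - by apply: measurable_fun_ifT => //; exact: measurable_fun_eqe.
    - by move=> x; rewrite /g; case: ifP.
    - by apply: aeW => x hx; rewrite /g hx eqxx.
    - by apply: filterS hphi_comp_neq0 => x hx; rewrite /g (negbTE hx) Ew.
  apply: filterS (cc s bs g hg) => x; rewrite VE// => <-.
  by rewrite muleC /g; case: eqP => // ->; rewrite !mul0e.
(* Any admissible g agrees with w along phi, hence a.e. because (K) gives h > 0. *)
move=> kid s bs g [mg g0 _ gE].
have [w [mw w0 Ew]] := condexp_factor (mP bs.1) (fun x => measure_ge0 _ _).
have wV := shift_identity_ae.2 kid s bs w mw w0 Ew.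
pose A := [set x | g x != w x].
have mA : measurable A by rewrite -[A]setTI; exact: (measurable_neqe measurableT).
have A0 : mu A = 0.
  apply: null_of_preim => //; first exact: shift_identity_gt0.
  apply: measure_negligible; first exact: measurable_preim.
  by apply: negligibleS gE => x /= /negP Ax; rewrite Ew => Ex; apply: Ax; rewrite Ex.
have gw : {ae mu, forall x, g x = w x}.
  by exists A; split => // x /= /eqP.
by apply: filterS2 gw wV => x -> wVx; rewrite VE// -wVx muleC.
Qed.

(** (CC) is the equality of [w * h] and [V s] at [phi x], where h is a.e. positive and finite, so
    that [ediv] is a genuine quotient. Passing from [phi x] back to x is [null_of_preim]. *)
Lemma shift_identity_CC : {ae mu, forall x, 0 < h x} ->
  CC mu phi h E P <-> shift_identity mu phi P.
Proof.
move=> hpos; split.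
  move=> cc; apply/shift_identity_ae => s bs w mw w0 Ew.
  pose A := [set x | w x * h x != V s x].
  have mA : measurable A.
    rewrite -[A]setTI; apply: (measurable_neqe measurableT); last exact: mV bs.1.
    exact: emeasurable_funM.
  have A0 : mu A = 0.
    apply: null_of_preim => //.
    apply: measure_negligible; first exact: measurable_preim.
    have : {ae mu, forall x, w (phi x) * h (phi x) = V s (phi x)}.
      apply: filterS3 (ae_comp hpos) (ae_comp hphi_ae_fin) (cc s bs) => x hx1 hx2.
      by rewrite Ew => ->; rewrite VE// ediv_mulK.
    by apply: negligibleS => x /= /negP Ax Ex; apply: Ax; rewrite Ex.
  by exists A; split => // x /= /eqP.
move=> kid s bs.
have [w [mw w0 Ew]] := condexp_factor (mP bs.1) (fun x => measure_ge0 _ _).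
have wV := shift_identity_ae.2 kid s bs w mw w0 Ew.
apply: filterS3 (ae_comp hpos) (ae_comp hphi_ae_fin) (ae_comp wV) => x hx1 hx2 wx.
by rewrite Ew VE//; exact: ediv_unique.
Qed.

End ConsistencyCondition.

(* The sums of the positive and of the negative terms of the iterated difference
   [cdiff c m n k]; splitting them avoids subtraction in [\bar R]. *)
Fixpoint cdiff_parts (R : realType) (c : R) (m : nat -> \bar R) n k : \bar R * \bar R :=
  if k is k'.+1 then
    let p := cdiff_parts c m n k' in let q := cdiff_parts c m n.+1 k' in
    (c%:E * p.1 + q.2, c%:E * p.2 + q.1)%E
  else (m n, 0%E).

Section CdiffParts.
Variables (R : realType) (c : R).
Hypothesis c0 : 0 <= c.

Lemma cdiff_parts_ge0 (m : nat -> \bar R) n k : (forall n, 0 <= m n)%E ->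
  (0 <= (cdiff_parts c m n k).1)%E /\ (0 <= (cdiff_parts c m n k).2)%E.
Proof.
move=> m0; elim: k n => [|k IH] n //=.
have [h1 h2] := IH n; have [h3 h4] := IH n.+1.
by split; apply: adde_ge0 => //; apply: mule_ge0.
Qed.

Lemma cdiff_partsE (m : nat -> \bar R) (r : nat -> R) n k :
  (forall n, m n = (r n)%:E) ->
  ((cdiff_parts c m n k).2 <= (cdiff_parts c m n k).1)%E = (0 <= cdiff c r n k).
Proof.
move=> mr.
suff [x [y [-> /= ->]]] : exists x y,
    cdiff_parts c m n k = (x%:E, y%:E) /\ cdiff c r n k = x - y.
  by rewrite lee_fin subr_ge0.
elim: k n => [|k IH] n /=; first by exists (r n), 0; rewrite mr subr0.
have [x [y [-> ->]]] := IH n; have [x' [y' [-> ->]]] := IH n.+1.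
exists (c * x + y'), (c * y + x'); split => //=; ring.
Qed.

Lemma measurable_cdiff_parts d (X : measurableType d) (H : nat -> X -> \bar R) n k :
  (forall n, measurable_fun setT (H n)) ->
  measurable_fun setT (fun x => (cdiff_parts c (H ^~ x) n k).1) /\
  measurable_fun setT (fun x => (cdiff_parts c (H ^~ x) n k).2).
Proof.
move=> mH; elim: k n => [|k IH] n /=; first by split.
have [h1 h2] := IH n; have [h3 h4] := IH n.+1.
by split; apply: emeasurable_funD => //; apply: emeasurable_funM.
Qed.

Lemma integral_cdiff_parts d (X : measurableType d) (mu : {measure set X -> \bar R})
    (H : nat -> X -> \bar R) D n k :
  measurable D -> (forall n, measurable_fun setT (H n)) -> (forall n x, 0 <= H n x)%E ->
  (\int[mu]_(x in D) (cdiff_parts c (H ^~ x) n k).1 =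
     (cdiff_parts c (fun n => \int[mu]_(x in D) H n x) n k).1)%E /\
  (\int[mu]_(x in D) (cdiff_parts c (H ^~ x) n k).2 =
     (cdiff_parts c (fun n => \int[mu]_(x in D) H n x) n k).2)%E.
Proof.
move=> mD mH H0.
have p0 x n' k' := cdiff_parts_ge0 n' k' (H0 ^~ x).
have mp n' k' := measurable_cdiff_parts n' k' mH.
elim: k n => [|k IH] n /=; first by rewrite integral0.
have [h1 h2] := IH n; have [h3 h4] := IH n.+1.
split.
  rewrite ge0_integralD//.
  - by rewrite ge0_integralZl_EFin ?h1 ?h4//; [move=> x _; exact: (p0 _ _ _).1|
      apply: measurable_funTS; exact: (mp _ _).1].
  - by move=> x _; apply: mule_ge0 => //; exact: (p0 _ _ _).1.
  - by apply: measurable_funTS; apply: emeasurable_funM => //; exact: (mp _ _).1.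
  - by move=> x _; exact: (p0 _ _ _).2.
  - by apply: measurable_funTS; exact: (mp _ _).2.
rewrite ge0_integralD//.
- by rewrite ge0_integralZl_EFin ?h2 ?h3//; [move=> x _; exact: (p0 _ _ _).2|
    apply: measurable_funTS; exact: (mp _ _).2].
- by move=> x _; apply: mule_ge0 => //; exact: (p0 _ _ _).2.
- by apply: measurable_funTS; apply: emeasurable_funM => //; exact: (mp _ _).2.
- by move=> x _; exact: (p0 _ _ _).1.
- by apply: measurable_funTS; exact: (mp _ _).1.
Qed.

End CdiffParts.

Lemma cdiff_scale (R : realType) (c : R) (m : nat -> R) n k : c != 0 ->
  cdiff 1 (fun n => m n / c ^+ n) n k = cdiff c m n k / c ^+ (n + k).
Proof.
move=> c0; elim: k n => [|k IH] n /=; first by rewrite addn0.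
have e0 : c ^+ (n + k) != 0 by rewrite expf_neq0.
by rewrite !IH addSn addnS !exprS; field; exact/andP.
Qed.

(** 1, 0, 0, ... is the moment sequence of the Dirac mass at 0, the default on the exceptional
    set. *)
Lemma cdiff_delta (R : realType) n k : cdiff 1 (fun n => (n == 0)%N%:R : R) n k = (n == 0)%N%:R.
Proof. by elim: k n => //= k IH n; rewrite !IH mul1r subr0. Qed.

Lemma integral_indic_fst d (X : measurableType d) (R : realType)
    (mu : {measure set X -> \bar R}) (P : R.-pker X ~> R) (A : set X) (s : set R)
    (g : R -> \bar R) :
  (\int[mu]_x \int[P x]_(t in s) ((\1_A x)%:E * g t) =
   \int[mu]_(x in A) \int[P x]_(t in s) g t)%E.
Proof.
rewrite [RHS]integral_mkcond; apply: eq_integral => x _.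
rewrite patchE indicE; case: (x \in A).
  by under eq_integral do rewrite mul1e.
by rewrite integral0_eq// => t _; rewrite mul0e.
Qed.

(** The second marginal of rho weighted by g on A. Each side of (K), as a function of s, has this
    form: g = 1 over the preimage of D, and g = |t| over D. *)
Lemma exists_mixture d (X : measurableType d) (R : realType)
    (mu : {measure set X -> \bar R}) (P : R.-pker X ~> R) (A : set X) (g : R -> \bar R) :
  measurable A -> measurable_fun setT g -> (forall t, 0 <= g t)%E ->
  exists nu : {measure set R -> \bar R},
    (forall s, measurable s -> nu s = \int[mu]_(x in A) \int[P x]_(t in s) g t)%E /\
    forall f : R -> \bar R, measurable_fun setT f -> (forall t, 0 <= f t)%E ->
      (\int[nu]_t f t = \int[mu]_(x in A) \int[P x]_t (f t * g t))%E.
Proof.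
move=> mA mg g0.
pose k (z : X * R) := ((\1_A z.1)%:E * g z.2)%E.
have mk : measurable_fun setT k.
  apply: emeasurable_funM.
    by apply/measurable_EFinP; exact: (measurableT_comp (measurable_indic mA) measurable_fst).
  exact: (measurableT_comp mg measurable_snd).
have k0 z : (0 <= k z)%E by rewrite mule_ge0// lee_fin.
have [nu [nuS nuf]] := exists_weighted_measure (sdprod mu P) mk k0.
pose nu2 : {measure set R -> \bar R} :=
  measure_function_pushforward__canonical__measure_function_Measure nu
    (@measurable_snd _ _ X R).
have intE (f : R -> \bar R) : measurable_fun setT f -> (forall t, 0 <= f t)%E ->
    (\int[nu2]_t f t = \int[mu]_x \int[P x]_t ((\1_A x)%:E * (f t * g t)))%E.
  move=> mf f0; have mf2 : measurable_fun setT (fun z : X * R => f z.2).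
    exact: (measurableT_comp mf measurable_snd).
  rewrite ge0_integral_pushforward//= nuf//.
  rewrite integral_sdprod; last 2 first.
  - exact: emeasurable_funM.
  - by move=> z; exact: mule_ge0.
  by apply: eq_integral => x _; apply: eq_integral => t _; rewrite /k muleCA.
exists nu2; split => [s ms|f mf f0]; last by rewrite intE// integral_indic_fst.
transitivity (\int[nu2]_t (\1_s t)%:E)%E; first by rewrite integral_indic// setIT.
rewrite intE.
- rewrite integral_indic_fst; apply: eq_integral => x _.
  by rewrite integral_indicl.
- by apply/measurable_EFinP/measurable_indic.
- by move=> t; rewrite lee_fin.
Qed.

(** * From a normal extension to the kernel *)

Section SubnormalRepresentation.
Context d (X : measurableType d) (R : realType).
Variables (mu : {measure set X -> \bar R}) (phi : X -> X) (h : X -> \bar R)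
  (E : (X -> \bar R) -> X -> \bar R).
Hypotheses (sf : sigma_finite setT mu) (ns : nonsingular mu phi).
Hypotheses (bd : Cphi_bounded mu phi) (hh : is_hphi mu phi h).
Hypothesis hE : forall f : X -> \bar R, measurable_fun setT f ->
  (forall x, (0 <= f x)%E) -> is_condexp mu phi f (E f).

Let mphi := ns.1.

(** The density for n + 1 is h times the factor through phi of E applied to the density for n. *)
Lemma exists_iterate_density n : exists w : X -> \bar R,
  [/\ measurable_fun setT w, (forall x, 0 <= w x)%E &
   forall D, measurable D -> mu (preim_iter phi n D) = (\int[mu]_(x in D) w x)%E].
Proof.
elim: n => [|n [w [mw w0 wE]]].
  by exists (cst 1%E); split => // D mD; rewrite integral_cst// mul1e.
have [w' [mw' w'0 Ew']] := condexp_factor hE mw w0.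
have [mh h0 _] := hh.
exists (fun x => w' x * h x)%E; split.
- exact: emeasurable_funM.
- by move=> x; apply: mule_ge0.
- move=> D mD; rewrite preim_iterSr wE; last exact: measurable_preim.
  exact: (condexp_integral ns hh hE).
Qed.

Lemma subnormal_cdiff_ge0 : Cphi_subnormal mu phi -> exists2 c : R, 0 < c &
  forall D n k, measurable D -> (mu D < +oo)%E ->
    0 <= cdiff c (fun m => fine (mu (preim_iter phi m D))) n k.
Proof.
move=> [K [ip [J [N [hK _ Jn hN NJ]]]]].
have [[_ [c1 hc1]] _] := hN.
(* Dominates c1 and is strictly positive, since the moments are later divided by its powers. *)
exists (Num.max c1 0 + 1); first by rewrite ltr_wpDl// le_max lexx orbT.
move=> D n k mD Doo; have [c c0 cE] := Cphi_norm2_fin bd.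
have hc x : hnsq ip (N x) <= (Num.max c1 0 + 1) * hnsq ip x.
  apply: le_trans (hc1 x) _; apply: ler_wpM2r; first exact: (nsq_ge0 hK x).
  by apply: (@le_trans _ _ (Num.max c1 0)); rewrite ?le_max ?lexx// lerDl.
pose f m : X -> R[i] := fun x => ((1 * \1_(preim_iter phi m D) x)%:C)%C.
have mm m := measurable_preim_iter mphi m mD.
have Lf m := L2_scaled_indic 1 (mm m) (measure_preim_iter_le ns bd m cE c0 mD Doo).2.
have it m : iter m N (J (f 0%N)) = J (f m).
  elim: m => //= m ->; rewrite NJ; last exact: (Lf m).1.
  by congr J; apply/funext => x.
have := normal_cdiff_ge0 (J (f 0%N)) n k hK hN hc.
congr (0 <= cdiff _ _ _ _); apply/funext => m.
by rewrite it Jn ?(Lf m).2 ?expr1n ?mul1r//; exact: (Lf m).1.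
Qed.

Variable c : R.
Hypotheses (c0 : 0 <= c) (cE : Cphi_norm2 mu phi = c%:E).

(** The points whose densities can be used as a moment sequence as they stand. Countably many
    conditions define it, so it is measurable as well as conull. *)
Let regular (c' : R) (H : nat -> X -> \bar R) : set X :=
  [set x | [/\ forall n, (H n x <= (c ^+ n)%:E)%E, H 0%N x = 1%E &
     forall n k, ((cdiff_parts c' (H ^~ x) n k).2 <= (cdiff_parts c' (H ^~ x) n k).1)%E]].

Lemma subnormal_densities : Cphi_subnormal mu phi ->
  exists (c' : R) (H : nat -> X -> \bar R), [/\ 0 < c',
    (forall n, measurable_fun setT (H n)), (forall n x, 0 <= H n x)%E,
    (forall n D, measurable D -> mu (preim_iter phi n D) = (\int[mu]_(x in D) H n x)%E) &
    {ae mu, forall x, regular c' H x}].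
Proof.
move=> /subnormal_cdiff_ge0[c' c'0 hc].
have [H hH] := choice exists_iterate_density.
have mH n : measurable_fun setT (H n) by case: (hH n).
have H0 n x : (0 <= H n x)%E by case: (hH n).
have HE n D : measurable D -> mu (preim_iter phi n D) = (\int[mu]_(x in D) H n x)%E.
  by case: (hH n) => _ _; exact.
exists c', H; split => //.
have g1 : {ae mu, forall x, forall n, (H n x <= (c ^+ n)%:E)%E}.
  apply: ae_foralln => n; apply: (ae_le_integral sf) => //.
    by move=> x; rewrite lee_fin exprn_ge0.
  move=> D mD Doo; rewrite -HE// integral_cst//.
  exact: (measure_preim_iter_le ns bd n cE c0 mD Doo).1.
have g2 : {ae mu, forall x, H 0%N x = 1%E}.
  apply: (ae_eq_integral_sets sf) => // D mD Doo.
  by rewrite -HE// integral_cst// mul1e.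
(* Integration over D of finite measure turns both parts into those of n |-> mu(phi^-n D), where
   [subnormal_cdiff_ge0] applies. *)
have g3 : {ae mu, forall x, forall n k,
    ((cdiff_parts c' (H ^~ x) n k).2 <= (cdiff_parts c' (H ^~ x) n k).1)%E}.
  apply: ae_foralln => n; apply: ae_foralln => k.
  have c'0' := ltW c'0.
  apply: (ae_le_integral sf).
  - exact: (measurable_cdiff_parts c' n k mH).2.
  - exact: (measurable_cdiff_parts c' n k mH).1.
  - by move=> x; exact: (cdiff_parts_ge0 c'0' n k (H0 ^~ x)).2.
  - by move=> x; exact: (cdiff_parts_ge0 c'0' n k (H0 ^~ x)).1.
  move=> D mD Doo; have [-> ->] := integral_cdiff_parts c'0' mu n k mD mH H0.
  rewrite (@cdiff_partsE _ _ _ (fun m => fine (mu (preim_iter phi m D)))); first exact: hc.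
  move=> m; rewrite -HE// fineK// ge0_fin_numE//.
  exact: (measure_preim_iter_le ns bd m cE c0 mD Doo).2.
by apply: filterS3 g1 g2 g3 => x.
Qed.

Let measurable_regular c' H : (forall n, measurable_fun setT (H n)) ->
  measurable (regular c' H).
Proof.
move=> mH.
rewrite (_ : regular c' H = (\bigcap_n [set x | (H n x <= (c ^+ n)%:E)%E]) `&`
    [set x | H 0%N x = 1%E] `&` (\bigcap_n \bigcap_k
    [set x | ((cdiff_parts c' (H ^~ x) n k).2 <= (cdiff_parts c' (H ^~ x) n k).1)%E])); last first.
  apply/seteqP; split => x /=.
    by move=> [h1 h2 h3]; split; [split|] => //; [move=> n _|move=> n _ k _]; rewrite /=.
  by move=> [[h1 h2] h3]; split => [n| |n k] //; [exact: h1|exact: h3].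
apply: measurableI; first apply: measurableI.
- apply: bigcapT_measurable => n; rewrite -[X in measurable X]setTI.
  exact: (measurable_lee measurableT).
- by rewrite -[X in measurable X]setTI; exact: (measurable_eqe measurableT).
- apply: bigcapT_measurable => n; apply: bigcapT_measurable => k.
  rewrite -[X in measurable X]setTI.
  have [m1 m2] := measurable_cdiff_parts c' n k mH.
  exact: (measurable_lee measurableT).
Qed.

Lemma subnormal_kernel : Cphi_subnormal mu phi ->
  exists P : R.-pker X ~> R, [/\ on_Rplus P, shift_identity mu phi P &
    forall x, P x (~` `[0, c]) = 0%E].
Proof.
move=> /subnormal_densities[c' [H [c'0 mH H0 HE aeG]]].
set G := regular c' H in aeG.
have mG : measurable G by exact: measurable_regular.
have Hfin x n : G x -> (fine (H n x))%:E = H n x.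
  by move=> [h1 _ _]; rewrite fineK// ge0_fin_numE//; exact: le_lt_trans (h1 n) (ltry _).
(* Rescaled from [0, c'] to [0, 1] on G, and the moments of the Dirac mass at 0 off G, so that
   Hausdorff's condition holds at every x. *)
pose M x n : R := \1_G x * (fine (H n x) / c' ^+ n) + \1_(~` G) x * (n == 0)%N%:R.
have c'n0 n : c' ^+ n != 0 by rewrite expf_neq0// gt_eqF.
have MG x n : G x -> M x n = fine (H n x) / c' ^+ n.
  by move=> Gx; rewrite /M !indicE in_setC mem_set//= mul1r mul0r addr0.
have MnG x n : ~ G x -> M x n = (n == 0)%N%:R.
  by move=> Gx; rewrite /M !indicE in_setC memNset//= mul1r mul0r add0r.
have mM n : measurable_fun setT (M ^~ n).
  apply: measurable_funD.
    apply: measurable_funM; first exact: measurable_indic.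
    apply: measurable_funM => //; exact: measurableT_comp.
  apply: measurable_funM => //; apply: measurable_indic; exact: measurableC.
have M0 x : M x 0%N = 1.
  have [Gx|Gx] := pselect (G x); last by rewrite MnG.
  by rewrite MG//; have [_ -> _] := Gx; rewrite expr0 divr1.
have cM x n k : 0 <= cdiff 1 (M x) n k.
  have [Gx|Gx] := pselect (G x); last first.
    rewrite (_ : M x = fun n => (n == 0)%N%:R); last by apply/funext => m; exact: MnG.
    by rewrite cdiff_delta.
  rewrite (_ : M x = fun n => fine (H n x) / c' ^+ n); last by apply/funext => m; exact: MG.
  rewrite cdiff_scale ?gt_eqF//; apply: divr_ge0; last by rewrite exprn_ge0// ltW.
  have [_ _ /(_ n k)] := Gx; rewrite (@cdiff_partsE _ _ _ (fun m => fine (H m x)))//.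
  by move=> m; apply/esym/Hfin.
have [P PM] := hausdorff_kernel mM M0 cM c'0.
have mI a : measurable (~` `[0, a]%classic : set R).
  by apply: measurableC; exact: measurable_itv.
have Pmom x n : (\int[P x]_t (`|t| ^+ n)%:E)%E = (c' ^+ n * M x n)%:E := (PM x).2 n.
(* The n-th moment is at most c^n at every x, by the definition of G on G and by the Dirac moments
   off it; this shrinks the support from [0, c'] to [0, c]. *)
have Psup x : P x (~` `[0, c]) = 0%E.
  have h1 : P x [set t | c < `|t|] = 0%E.
    apply: moment_support => // n; rewrite Pmom.
    have [Gx|Gx] := pselect (G x).
      by rewrite MG// mulrC divfK// Hfin//; have [] := Gx.
    rewrite MnG// lee_fin; case: n => [|n]; first by rewrite !expr0 mulr1.
    by rewrite mulr0 exprn_ge0.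
  apply: measure_negligible => //.
  apply: (@negligibleS _ _ _ _ ([set t | c < `|t|] `|` ~` `[0, c'])).
    move=> t /= tc; have [t0|t0] := ltP t 0.
      by right; rewrite in_itv/= leNgt t0.
    left; rewrite ger0_norm// ltNge; apply/negP => h2.
    by apply: tc; rewrite in_itv/= t0.
  apply: negligibleU; apply/negligibleP => //; last exact: (PM x).1.
  exact: measurable_abs_gt.
have Ppos : on_Rplus P.
  move=> x; have : (P x [set t | (0 <= t)%R] + P x (~` [set t | (0 <= t)%R]) = 1)%E.
    rewrite -measureU//; last exact: setICr.
    - by rewrite setUv; exact: prob_kernel.
    - exact: measurable_Rplus.
    - by apply: measurableC; exact: measurable_Rplus.
  have -> : P x (~` [set t | (0 <= t)%R]) = 0%E; last by rewrite adde0.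
  apply/eqP; rewrite -measure_le0 -(Psup x); apply: le_measure; rewrite ?inE//.
    by apply: measurableC; exact: measurable_Rplus.
  by apply: subsetC => t /=; rewrite in_itv/= => /andP[].
have momE n D : measurable D ->
    mu (preim_iter phi n D) = (\int[mu]_(x in D) \int[P x]_t (`|t| ^+ n)%:E)%E.
  move=> mD; rewrite HE//; apply: ge0_ae_eq_integral => //.
  - exact: measurable_funTS.
  - by apply: measurable_funTS; exact: measurable_moment.
  - by move=> x _; apply: integral_ge0 => t _; rewrite lee_fin exprn_ge0.
  - by apply: filterS aeG => x Gx _; rewrite Pmom MG// mulrC divfK// Hfin.
exists P; split => //.
apply: shift_identity_finite => // D s mD ms Doo.
have mpD : measurable (phi @^-1` D) by exact: measurable_preim.
have m1 : measurable_fun setT (cst 1%E : R -> \bar R) by exact: measurable_cst.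
(* [nu1] and [nu2] are the two sides of (K) as measures in s. The extra |t| in [nu2] and the extra
   preimage in [nu1] both raise the moment index by one. *)
have [nu1 [nu1S nu1f]] := exists_mixture mu P mpD m1 (fun=> lee01).
have [nu2 [nu2S nu2f]] := exists_mixture mu P mD (@measurable_abs_EFin R)
  (fun t => normr_ge0 t).
have mom1 n : (\int[nu1]_t (`|t| ^+ n)%:E = mu (preim_iter phi n.+1 D))%E.
  rewrite nu1f; last 2 first.
  - exact: measurable_powabs.
  - by move=> t; rewrite lee_fin exprn_ge0.
  rewrite preim_iterSr momE//.
  by apply: eq_integral => x _; apply: eq_integral => t _; rewrite mule1.
have mom2 n : (\int[nu2]_t (`|t| ^+ n)%:E = mu (preim_iter phi n.+1 D))%E.
  rewrite nu2f; last 2 first.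
  - exact: measurable_powabs.
  - by move=> t; rewrite lee_fin exprn_ge0.
  rewrite momE//.
  by apply: eq_integral => x _; apply: eq_integral => t _; rewrite exprSr EFinM.
have massE (nu : {measure set R -> \bar R}) : (\int[nu]_t (`|t| ^+ 0)%:E = nu setT)%E.
  by under eq_integral do rewrite expr0; rewrite integral_cst// mul1e.
have pDoo : (mu (phi @^-1` D) < +oo)%E := measure_preim_fin ns bd mD Doo.
have := @moments_unique R c' c'0 nu1 nu2.
have -> : nu1 setT = mu (phi @^-1` D) by rewrite -massE mom1.
have -> : nu2 setT = mu (phi @^-1` D) by rewrite -massE mom2.
move=> /(_ pDoo pDoo) H12.
have {}H12 : forall s, measurable s -> nu1 s = nu2 s.
  apply: H12.
  - rewrite nu1S// integral0_eq// => x _.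
    by rewrite integral_cst// (PM x).1 mule0.
  - rewrite nu2S// integral0_eq// => x _; apply: null_set_integral => //.
      by apply: measurable_funTS; exact: measurable_abs_EFin.
    exact: (PM x).1.
  - by move=> n; rewrite mom1 mom2.
rewrite -nu2S// -H12// nu1S//; apply: eq_integral => x _.
by rewrite integral_cst// mul1e.
Qed.

End SubnormalRepresentation.

Lemma supp_in_itv d (X : measurableType d) (R : realType) (P : R.-pker X ~> R) x (c : R) :
  P x (~` `[0, c]) = 0%E -> supp_in P x c%:E.
Proof.
move=> P0 t tsupp; have [|tc] := pselect (`[0, c]%classic t).
  by rewrite /= in_itv/= lee_fin => /andP[].
have oU : open (~` `[0, c]%classic : set R).
  by apply: closed_openC; exact: interval_closed.
by have := tsupp _ oU tc; rewrite P0 ltxx.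
Qed.

Theorem theorem13 (R : realType) (d : measure_display) (X : measurableType d)
  (mu : {measure set X -> \bar R}) (phi : X -> X)
  (h : X -> \bar R) (E : (X -> \bar R) -> X -> \bar R) :
  sigma_finite setT mu ->
  nonsingular mu phi ->
  Cphi_bounded mu phi ->
  is_hphi mu phi h ->
  (forall f : X -> \bar R, measurable_fun setT f -> (forall x, (0 <= f x)%E) ->
     is_condexp mu phi f (E f)) ->
    (Cphi_subnormal mu phi <-> cond_ii mu phi h E) /\
      (Cphi_subnormal mu phi <-> cond_ii' mu phi h E) /\
      (Cphi_subnormal mu phi <-> cond_iii mu phi h E) /\
      (Cphi_subnormal mu phi <-> cond_iii' mu phi h E) /\
      (Cphi_subnormal mu phi <-> cond_iii_every mu phi h E) /\
      (Cphi_subnormal mu phi <-> cond_iii'_every mu phi h E) /\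
      (Cphi_subnormal mu phi -> CC_unique mu phi h E).
Proof.
move=> sf ns bd hh hE; have [c c0 cE] := Cphi_norm2_fin bd.
have subn P : on_Rplus P -> shift_identity mu phi P -> Cphi_subnormal mu phi.
  exact: shift_identity_subnormal.
have CCP P : Cphi_injective mu phi -> on_Rplus P -> CC mu phi h E P ->
    shift_identity mu phi P.
  move=> /(injective_hphi_gt0 sf ns hh) hpos Ppos.
  exact: (shift_identity_CC sf ns bd hh hE Ppos hpos).1.
have CCinvP P : on_Rplus P -> CCinv mu phi h E P -> shift_identity mu phi P.
  by move=> Ppos; exact: (shift_identity_CCinv sf ns hh hE Ppos).1.
have inj P : shift_identity mu phi P -> Cphi_injective mu phi.
  exact: (shift_identity_injective ns hh).
have ii : cond_ii mu phi h E -> Cphi_subnormal mu phi.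
  by move=> [ij [P [Ppos cc]]]; apply: (subn P) => //; exact: CCP.
have ii' : cond_ii' mu phi h E -> Cphi_subnormal mu phi.
  by move=> [P [Ppos cc]]; apply: (subn P) => //; exact: CCinvP.
have iii_ii : cond_iii mu phi h E -> cond_ii mu phi h E.
  by move=> [ij [P [Ppos cc _]]]; split => //; exists P.
have iii'_ii' : cond_iii' mu phi h E -> cond_ii' mu phi h E.
  by move=> [P [Ppos cc _]]; exists P.
have every_iii : cond_iii_every mu phi h E -> cond_iii mu phi h E.
  by move=> [ij [P [Ppos cc sp]]]; split => //; exists P; split => //; exact: aeW.
have every_iii' : cond_iii'_every mu phi h E -> cond_iii' mu phi h E.
  by move=> [P [Ppos cc sp]]; exists P; split => //; exact: aeW.
(* From (i) directly to the strongest conditions; the weaker ones follow by forgetting the support,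
   and all return to (i) through (K). *)
have i_every : Cphi_subnormal mu phi -> cond_iii_every mu phi h E.
  move=> /(subnormal_kernel sf ns bd hh hE c0 cE)[P [Ppos kid P0]].
  have hpos := shift_identity_gt0 ns hh kid.
  split; first exact: inj kid.
  exists P; split => //; first exact: (shift_identity_CC sf ns bd hh hE Ppos hpos).2.
  by move=> x; rewrite cE; exact: supp_in_itv.
have i_every' : Cphi_subnormal mu phi -> cond_iii'_every mu phi h E.
  move=> /(subnormal_kernel sf ns bd hh hE c0 cE)[P [Ppos kid P0]].
  exists P; split => //; first exact: (shift_identity_CCinv sf ns hh hE Ppos).2.
  by move=> x; rewrite cE; exact: supp_in_itv.
do 6! [split; first by split; auto].
move=> sub P1 P2 pos1 pos2 cc1 cc2; have [ij _] := i_every sub.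
have := shift_identity_unique sf ns bd pos1 pos2 (CCP _ ij pos1 cc1) (CCP _ ij pos2 cc2).
by apply: filterS => x hx s [ms _]; exact: hx.
Qed.
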